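(* Suppose double sample splitting is performed, with $\hat\psi^{\mathrm{INT}}_{k_1,k_2}$, $\hat\psi^{\mathrm{MC}}_{k_1,k_2}$, $\hat\psi^{\mathrm{IF}}_{k_1,k_2}$ the double sample split estimators of $\psi(\mathbb P)=\mathbb E_{\mathbb P}[\mathrm{Cov}_{\mathbb P}(A,Y\mid X)]$ defined in the context. Then: 1) $\displaystyle\sup_{\mathbb P\in\mathcal P_{(\alpha,\beta)}}\left|\mathbb E_{\mathbb P}\left(\hat\psi^{\mathrm{INT}}_{k_1,k_2}-\psi(\mathbb P)\right)\right|\asymp (k_1\wedge k_2)^{-(\alpha+\beta)/d}$ and $\displaystyle\sup_{\mathbb P\in\mathcal P_{(\alpha,\beta)}}\mathrm{Var}_{\mathbb P}(\hat\psi^{\mathrm{INT}}_{k_1,k_2})\lesssim \frac1n+\frac{k_1\wedge k_2}{n^2}$. 2a) $\displaystyle\sup_{\mathbb P\in\mathcal P_{(\alpha,\beta)}}\left|\mathbb E_{\mathbb P}\left(\hat\psi^{\mathrm{MC}}_{k_1,k_2}-\psi(\mathbb P)\right)\right|\asymp (k_1\wedge k_2)^{-(\alpha+\beta)/d}$ and $\displaystyle\sup_{\mathbb P\in\mathcal P_{(\alpha,\beta)}}\mathrm{Var}_{\mathbb P}(\hat\psi^{\mathrm{MC}}_{k_1,k_2})\lesssim \frac1n+\frac{k_1\vee k_2}{n^2}+\frac{k_1k_2}{n^3}$. 2b) There exists a $\mathbb P\in\mathcal P_{(\alpha,\beta)}$ such that for $k_1,k_2\gg n$: $\left|\mathbb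 E_{\mathbb P}\left(\hat\psi^{\mathrm{MC}}_{k_1,k_2}-\psi(\mathbb P)\right)\right|\gtrsim (k_1\wedge k_2)^{-(\alpha+\beta)/d}$ and $\mathrm{Var}_{\mathbb P}(\hat\psi^{\mathrm{MC}}_{k_1,k_2})\gtrsim \frac{k_1k_2}{n^3}$. 3a) $\displaystyle\sup_{\mathbb P\in\mathcal P_{(\alpha,\beta)}}\left|\mathbb E_{\mathbb P}\left(\hat\psi^{\mathrm{IF}}_{k_1,k_2}-\psi(\mathbb P)\right)\right|\asymp (k_1\vee k_2)^{-(\alpha+\beta)/d}$ and $\displaystyle\sup_{\mathbb P\in\mathcal P_{(\alpha,\beta)}}\mathrm{Var}_{\mathbb P}(\hat\psi^{\mathrm{IF}}_{k_1,k_2})\lesssim \frac1n+\frac{k_1\vee k_2}{n^2}+\frac{k_1k_2}{n^3}$. 3b) There exists a $\mathbb P\in\mathcal P_{(\alpha,\beta)}$ such that for $k_1,k_2\gg n$: $\left|\mathbb E_{\mathbb P}\left(\hat\psi^{\mathrm{IF}}_{k_1,k_2}-\psi(\mathbb P)\right)\right|\gtrsim (k_1\vee k_2)^{-(\alpha+\beta)/d}$ and $\mathrm{Var}_{\mathbb P}(\hat\psi^{\mathrm{IF}}_{k_1,k_2})\gtrsim \frac{k_1k_2}{n^3}$.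
   Context: Notation. $a\vee b=\max(a,b)$, $a\wedge b=\min(a,b)$; integrals are over $[0,1]^d$. For nonnegative sequences, $a_n\lesssim b_n$ means there is a constant $C>0$ with $a_n\le Cb_n$ for all $n\ge n_0$; $a_n\gtrsim b_n$ means $b_n\lesssim a_n$; $a_n\asymp b_n$ means both; $a_n\ll b_n$ means $a_n/b_n\to0$; $a_n\gg b_n$ means $b_n\ll a_n$. Resolutions $k_1,k_2$ may depend on $n$; implicit constants do not depend on $n$ or the resolutions. Wavelets. Fix a compactly supported Cohen–Daubechies–Vial type orthonormal wavelet basis $\{\Phi_{J_0m},\Psi^{\iota}_{lm'}: m\in\mathcal Z_{J_0},\,m'\in\mathcal Z_l,\,\iota\in\{0,1\}^d\setminus\{0\},\,l\ge J_0\}$ of $L^2([0,1]^d)$ of regularity $S\ge1$, $S>\alpha\vee\beta$, with $2^{J_0}\ge S$, $|\mathcal Z_l|\asymp 2^{ld}$. For $j\ge J_0$ let $V_j=\mathrm{span}\{\Phi_{jm}:m\in\mathcal Z_j\}$ ($\{\Phi_{jm}\}_m$ the orthonormal scaling functions at level $j$; the $V_j$ are nested). A resolution is a number $k=2^{jd}$, $j\ge J_0$; write $V_k,\Phi_{km},\mathcal Z_k$ for $V_j,\Phi_{jm},\mathcal Z_j$. Standard properties: $|\Phi_{km}|\lesssim\sqrt k$ uniformly with support in a set of Lebesgue measure $O(1/k)$; $V_k$ contains all polynomials of degree at most $S-1$. The projection kernel is $K_{V_k}(x,y)=\sum_{m\in\mathcal Z_k}\Phi_{km}(x)\Phi_{km}(y)$.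 Hölder ball. $H(\alpha,M)$ is the set of uniformly continuous $h:[0,1]^d\to\mathbb R$ with $2^{J_0(\alpha+d/2)}\max_m|\langle h,\Phi_{J_0m}\rangle|+\sup_{l\ge J_0,m\in\mathcal Z_l,\iota}2^{l(\alpha+d/2)}|\langle h,\Psi^\iota_{lm}\rangle|\le M$. Model. $\mathcal P_{(\alpha,\beta)}$ is the set of distributions $\mathbb P$ of $(X,A,Y)\in[0,1]^d\times\mathbb R\times\mathbb R$ with $X\sim\mathrm{Uniform}([0,1]^d)$, $A,Y\in[C_1,C_2]$ a.s., $p(x):=\mathbb E_{\mathbb P}[A\mid X=x]\in H(\alpha,M)$ and $b(x):=\mathbb E_{\mathbb P}[Y\mid X=x]\in H(\beta,M)$, where $C_1,C_2\in\mathbb R$, $\alpha,\beta,M>0$ are fixed known constants. The functional is $\psi(\mathbb P)=\mathbb E_{\mathbb P}[\mathrm{Cov}_{\mathbb P}(A,Y\mid X)]$. Estimators. I.i.d. observations from $\mathbb P$ are split into disjoint subsamples $\mathcal D_1,\mathcal D_2,\dots$, each of size $n$. Put $\hat p^{(j)}_k(x)=\frac1n\sum_{i\in\mathcal D_j}A_iK_{V_k}(X_i,x)$ and $\hat b^{(j)}_k(x)=\frac1n\sum_{i\in\mathcal D_j}Y_iK_{V_k}(X_i,x)$. With double sample splitting (all subsamples distinct): $\hat\psi^{\mathrm{INT}}_{k_1,k_2}=\frac1n\sum_{i\in\mathcal D_3}A_iY_i-\int\hat p^{(1)}_{k_1}(x)\hat b^{(2)}_{k_2}(x)\,dx$; $\hat\psi^{\mathrm{MC}}_{k_1,k_2}=\frac1n\sum_{i\in\mathcal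 D_3}A_iY_i-\frac1n\sum_{i\in\mathcal D_4}\hat p^{(1)}_{k_1}(X_i)\hat b^{(2)}_{k_2}(X_i)$; $\hat\psi^{\mathrm{IF}}_{k_1,k_2}=\frac1n\sum_{i\in\mathcal D_3}(A_i-\hat p^{(1)}_{k_1}(X_i))(Y_i-\hat b^{(2)}_{k_2}(X_i))$.
   Formalization: Added non-degeneracy, without which the lower bounds fail: C_1<C_2, and the model is already nonempty for some M'<M (for C_1=C_2 all biases vanish; for small M the model may be empty). Wavelets of regularity S are read as continuous on the cube. *)

(* Defs.v *)
From HB Require Import structures.
From mathcomp Require Import all_boot all_order all_algebra.
From mathcomp Require Import all_classical all_reals all_analysis.
Set Implicit Arguments.
Unset Strict Implicit.
Unset Printing Implicit Defensive.
Import Order.TTheory GRing.Theory Num.Theory.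
Import numFieldNormedType.Exports.
Local Open Scope classical_set_scope.
Local Open Scope ring_scope.

(** One constant serves the whole family [D] of sequences; the rank from which
    the bound holds may depend on the sequence. *)

Definition lesssim (R : realType) (I : Type) (D : set I)
    (a b : I -> nat -> \bar R) : Prop :=
  exists2 C : R, 0 < C &
    forall i, D i -> \forall n \near \oo, (a i n <= C%:E * b i n)%E.

Definition gtrsim (R : realType) (I : Type) (D : set I)
    (a b : I -> nat -> \bar R) : Prop := lesssim D b a.

Definition asymp (R : realType) (I : Type) (D : set I)
    (a b : I -> nat -> \bar R) : Prop := lesssim D a b /\ gtrsim D a b.

Definition much_less (R : realType) (a b : nat -> R) : Prop :=
  (fun n => a n / b n) @ \oo --> (0 : R).

(** [prob_pow P n] is the product probability P x ... x P (n factors) on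
    [n.-tuple T]. *)

Section product_power.
Context (dd : measure_display) (T : measurableType dd) (R : realType).

Definition tuple_cons (n : nat) (x : T * n.-tuple T) : n.+1.-tuple T :=
  [the n.+1.-tuple T of x.1 :: x.2].

Lemma measurable_tuple_cons (n : nat) :
  measurable_fun [set: T * n.-tuple T] (@tuple_cons n).
Proof. exact: measurable_cons. Qed.

HB.instance Definition _ (n : nat) :=
  isMeasurableFun.Build _ _ _ _ (@tuple_cons n) (@measurable_tuple_cons n).

Fixpoint prob_pow (P : probability T R) (n : nat) :
    probability (n.-tuple T) R :=
  match n return probability (n.-tuple T) R with
  | 0 => \d_([tuple] : 0.-tuple T)
  | n'.+1 => distribution (P \x prob_pow P n')%E (@tuple_cons n')
  end.

End product_power.

(** [measurableTypeR R], which carries [uniform_prob], and [R] have the same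
    measurable sets but distinct displays. *)
Section unif01.
Context (R : realType).

Definition idTR : measurableTypeR R -> R := idfun.

Lemma measurable_idTR : measurable_fun setT idTR.
Proof. exact: measurable_id. Qed.

HB.instance Definition _ :=
  @isMeasurableFun.Build _ _ _ _ idTR measurable_idTR.

Definition unif01 : probability R R :=
  distribution (uniform_prob (@ltr01 R)) idTR.

End unif01.

Section cube.
Context (R : realType) (d : nat).

Definition cube : set (d.-tuple R) :=
  [set x | forall i : 'I_d, 0 <= tnth x i <= 1].

(** Lebesgue measure on R^d restricted to [cube]: integrals over the cube are
    integrals against [unif]. *)
Definition unif : probability (d.-tuple R) R := prob_pow (@unif01 R) d.

Definition inner (f g : d.-tuple R -> R) : R := \int[unif]_x (f x * g x).

Definition ucont_cube (h : d.-tuple R -> R) : Prop :=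
  forall e : R, 0 < e -> exists2 r : R, 0 < r &
    forall x y, cube x -> cube y ->
      (forall i, `|tnth x i - tnth y i| < r) -> `|h x - h y| < e.

Definition lspan (I : finType) (f : I -> d.-tuple R -> R) :
    set (d.-tuple R -> R) :=
  [set g | exists c : I -> R, g = fun x => \sum_i c i * f i x].

End cube.

(** {0,1}^d without 0. *)
Definition details (d : nat) : finType :=
  {i : {ffun 'I_d -> bool} | i != [ffun=> false]}.

(** Functions on the cube are represented by functions on R^d; the wavelets are
    extended by zero, see [cdv_basis]. Values at levels below J0 are never
    used. *)
Record wavelets (R : realType) (d : nat) := Wavelets {
  Z : nat -> finType;
  Phi : forall j, Z j -> d.-tuple R -> R;
  Psi : forall l, details d -> Z l -> d.-tuple R -> R }.

Section wavelet_basis.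
Context (R : realType) (d : nat) (W : wavelets R d).

Definition V (j : nat) : set (d.-tuple R -> R) := lspan (@Phi R d W j).

Definition Phi_Psi (j : nat) (z : Z W j + details d * Z W j) :
    d.-tuple R -> R :=
  match z with inl m => Phi m | inr (i, m) => Psi i m end.

(** The last two clauses: |f| is at most C sqrt k with k = 2^(jd), and the
    support lies in a cube of side 2C 2^-j, so has measure O(1/k). *)
Definition atom (C : R) (j : nat) (f : d.-tuple R -> R) : Prop :=
  [/\ measurable_fun setT f,
      ucont_cube f,
      forall x, ~ cube x -> f x = 0,
      forall x, `|f x| <= C * Num.sqrt (2 ^ (j * d))%:R &
      exists a : d.-tuple R, forall x, f x != 0 ->
        forall i, `|tnth x i - tnth a i| <= C / (2 ^ j)%:R].

(** Compactly supported Cohen-Daubechies-Vial type orthonormal wavelet basis of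
    L^2 of the cube, of regularity [S], with coarsest level [J0]. Regularity
    enters as continuity of the wavelets and reproduction of the polynomials of
    degree at most S - 1 (equivalently, S vanishing moments); bases with
    smoother wavelets are included. *)
Record cdv_basis (S J0 : nat) : Prop := CDVBasis {
  Phi_orthonormal : forall j, (J0 <= j)%N -> forall m m' : Z W j,
    inner (Phi m) (Phi m') = (m == m')%:R;
  Psi_orthonormal : forall l, (J0 <= l)%N ->
    forall (i i' : details d) (m m' : Z W l),
    inner (Psi i m) (Psi i' m') = ((i, m) == (i', m'))%:R;
  Psi_orthogonal : forall l l', (J0 <= l)%N -> (J0 <= l')%N -> l <> l' ->
    forall (i i' : details d) (m : Z W l) (m' : Z W l'),
    inner (Psi i m) (Psi i' m') = 0;
  Phi_Psi_orthogonal : forall l, (J0 <= l)%N ->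
    forall (m : Z W J0) (i : details d) (m' : Z W l),
    inner (Phi m) (Psi i m') = 0;
  multiresolution : forall j, (J0 <= j)%N -> V j.+1 = lspan (@Phi_Psi j);
  V_dense : forall f : d.-tuple R -> R, measurable_fun setT f ->
    (unif R d).-integrable setT (fun x => (f x ^+ 2)%:E) ->
    forall e : R, 0 < e -> exists j g, [/\ (J0 <= j)%N, V j g &
      (\int[unif R d]_x ((f x - g x) ^+ 2)%:E < e%:E)%E];
  (** The two cardinality bounds on supports say that boundedly many wavelets
      of a level are nonzero at any given point. *)
  level_geometry : exists2 C : R, 0 < C & forall j, (J0 <= j)%N ->
    [/\ (2 ^ (j * d))%:R <= C * #|Z W j|%:R,
        #|Z W j|%:R <= C * (2 ^ (j * d))%:R,
        forall m : Z W j, atom C j (Phi m),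
        forall i (m : Z W j), atom C j (Psi i m) &
        forall x, #|[set m : Z W j | Phi m x != 0]%SET|%:R <= C /\
          forall i, #|[set m : Z W j | Psi i m x != 0]%SET|%:R <= C];
  V_polynomials : forall j, (J0 <= j)%N -> forall e : 'I_d -> nat,
    (\sum_i e i <= S.-1)%N -> exists2 g, V j g &
      forall x, cube x -> g x = \prod_i tnth x i ^+ e i }.

Definition holder_norm (J0 : nat) (a : R) (h : d.-tuple R -> R) : \bar R :=
  let w l : R := 2 `^ (l%:R * (a + d%:R / 2)) in
  ((w J0 * \big[Num.max/0]_(m : Z W J0) `|inner h (Phi m)|)%:E +
   ereal_sup [set t | exists l (m : Z W l) (i : details d),
     (J0 <= l)%N /\ t = (w l * `|inner h (Psi i m)|)%:E])%E.

Definition holder_ball (J0 : nat) (a M : R) : set (d.-tuple R -> R) :=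
  [set h | ucont_cube h /\ (holder_norm J0 a h <= M%:E)%E].

(** Projection kernel of V_k for the resolution k = 2^(jd). *)
Definition proj_kernel (j : nat) (x y : d.-tuple R) : R :=
  \sum_(m : Z W j) Phi m x * Phi m y.

End wavelet_basis.

(** An observation (X, A, Y), with projections [covX], [varA], [varY]. *)
Definition obs (R : realType) (d : nat) : Type := (d.-tuple R * R * R)%type.

Section model.
Context (R : realType) (d : nat).
Implicit Type P : probability (d.-tuple R * R * R)%type R.

Definition covX (o : obs R d) : d.-tuple R := o.1.1.
Definition varA (o : obs R d) : R := o.1.2.
Definition varY (o : obs R d) : R := o.2.

(** [g] is a version of x |-> E_P[U | X = x]. *)
Definition is_condexp P (U : obs R d -> R) (g : d.-tuple R -> R) : Prop :=
  [/\ measurable_fun setT g,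
      P.-integrable setT (EFin \o (g \o covX)) &
      forall B, measurable B ->
        (\int[P]_(o in covX @^-1` B) (g (covX o))%:E =
         \int[P]_(o in covX @^-1` B) (U o)%:E)%E].

(** [condexp] picks an arbitrary version. *)
Definition condexp P (U : obs R d -> R) : d.-tuple R -> R :=
  xget (fun=> 0) [set g | is_condexp P U g].

Definition condcov P (U U' : obs R d -> R) : d.-tuple R -> R :=
  condexp P (fun o => (U o - condexp P U (covX o)) *
                      (U' o - condexp P U' (covX o))).

Definition psi P : R := fine 'E_P[fun o => condcov P varA varY (covX o)].

Definition model (W : wavelets R d) (J0 : nat) (alpha beta M C1 C2 : R) :
    set (probability (d.-tuple R * R * R)%type R) :=
  [set P : probability (d.-tuple R * R * R)%type R |
    [/\ forall B, measurable B -> P (covX @^-1` B) = unif R d B,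
      {ae P, forall o, C1 <= varA o <= C2 /\ C1 <= varY o <= C2},
      exists2 p, is_condexp P varA p & holder_ball W J0 alpha M p &
      exists2 b, is_condexp P varY b & holder_ball W J0 beta M b]].

End model.

Section estimators.
Context (R : realType) (d : nat) (W : wavelets R d) (n : nat).

(** Only the four subsamples that enter the estimators are kept. *)
Definition samples : Type := 4.-tuple (n.-tuple (obs R d)).

Definition sample_law (P : probability (d.-tuple R * R * R)%type R) :=
  prob_pow (prob_pow P n) 4.

Definition D1 (w : samples) : n.-tuple (obs R d) := tnth w (inord 0).
Definition D2 (w : samples) : n.-tuple (obs R d) := tnth w (inord 1).
Definition D3 (w : samples) : n.-tuple (obs R d) := tnth w (inord 2).
Definition D4 (w : samples) : n.-tuple (obs R d) := tnth w (inord 3).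

Definition sample_mean (D : n.-tuple (obs R d)) (f : obs R d -> R) : R :=
  n%:R^-1 * \sum_(i < n) f (tnth D i).

Definition series_estimator (U : obs R d -> R) (j : nat)
    (D : n.-tuple (obs R d)) (x : d.-tuple R) : R :=
  sample_mean D (fun o => U o * proj_kernel W j (covX o) x).

Definition phat := series_estimator (@varA R d).
Definition bhat := series_estimator (@varY R d).

Definition psi_INT (j1 j2 : nat) (w : samples) : R :=
  sample_mean (D3 w) (fun o => varA o * varY o) -
  \int[unif R d]_x (phat j1 (D1 w) x * bhat j2 (D2 w) x).

Definition psi_MC (j1 j2 : nat) (w : samples) : R :=
  sample_mean (D3 w) (fun o => varA o * varY o) -
  sample_mean (D4 w)
    (fun o => phat j1 (D1 w) (covX o) * bhat j2 (D2 w) (covX o)).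

Definition psi_IF (j1 j2 : nat) (w : samples) : R :=
  sample_mean (D3 w) (fun o => (varA o - phat j1 (D1 w) (covX o)) *
                               (varY o - bhat j2 (D2 w) (covX o))).

Definition abs_bias (est : samples -> R)
    (P : probability (d.-tuple R * R * R)%type R) : \bar R :=
  `| 'E_(sample_law P)[(fun w => est w - psi P)%R] |%E.

Definition var (est : samples -> R)
    (P : probability (d.-tuple R * R * R)%type R) : \bar R :=
  'V_(sample_law P)[est].

End estimators.

(** Pairs of sequences of resolutions k_i(n) = 2^(j_i(n) d), given by the level
    sequences j_1, j_2. *)
Definition level_seqs (J0 : nat) : set ((nat -> nat) * (nat -> nat)) :=
  [set j | forall n, (J0 <= j.1 n)%N /\ (J0 <= j.2 n)%N].

Definition resolution (d : nat) (j : nat -> nat) (n : nat) : nat :=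
  2 ^ (j n * d).

Definition large_level_seqs (R : realType) (d J0 : nat) :
    set ((nat -> nat) * (nat -> nat)) :=
  [set j | level_seqs J0 j /\
    (much_less (fun n => n%:R : R) (fun n => (resolution d j.1 n)%:R) /\
     much_less (fun n => n%:R : R) (fun n => (resolution d j.2 n)%:R))].

(* Main.v *)
Require Import Defs.
From HB Require Import structures.
From mathcomp Require Import all_boot all_order all_algebra.
From mathcomp Require Import all_classical all_reals all_analysis.
From mathcomp Require Import measurable_realfun.
From mathcomp Require Import ring lra.
Set Implicit Arguments.
Unset Strict Implicit.
Unset Printing Implicit Defensive.
Import Order.TTheory GRing.Theory Num.Theory.
Import numFieldNormedType.Exports.
Local Open Scope classical_set_scope.
Local Open Scope ring_scope.

(** Write p and b for the two regression functions, pi_k for the projection onto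
    V_k, and k1, k2 for the two resolutions. A linear functional of a series
    estimator is a sample mean of bounded variables, so the mean of the estimator
    of p is pi_k1 p and similarly for b. Since the spaces V are nested, the means
    of the integral and Monte Carlo estimators involve
      < pi_k1 p, pi_k2 b > = < pi_kmin p, pi_kmin b >,
    while in < p - pi_k1 p, b - pi_k2 b >, the bias of the influence function
    estimator, only the finer projection remains (inner_projV2,
    inner_sub_projV2). Hence all three biases equal the truncation error
      < p, b > - < pi_k p, pi_k b >,
    at k = kmin for the first two and at k = kmax for the third one (INT_bias,
    MC_bias, IF_bias). This error is a sum over the levels l beyond k of products
    of wavelet coefficients; the Hoelder balls bound the contribution of level l
    by a constant times 2^(-l (alpha + beta)), and the geometric sum gives the
    upper bounds on the biases (detail_bound, tail_le).

    For the variances, condition on the samples that the two series estimators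
    use. The inner product of the two estimators has variance of order
    1/n + kmin/n^2, because the second estimator only sees the projection of the
    first one (sum_proj_Phi_le, ex_cross_sqr). The Monte Carlo and influence
    function estimators are in addition conditional sample means of a product of
    two residuals, the first with residuals 0 - phat and 0 - bhat, the second with
    A - phat and Y - bhat; a factor lam in {0, 1} in front of A and Y treats both
    at once. At a fixed observation the two squared residuals are independent,
    each with mean of order 1 + k/n since the kernel has diagonal of order k
    (ex_pointwise_le, ex_resid_sqr). Dividing by n gives
    1/n + kmax/n^2 + k1 k2/n^3. The diagonal of the kernel is also bounded below
    by a multiple of k, because V_k reproduces constants (proj_kernel_ge); if the
    conditional second moments of A and Y stay away from 0, the term k1 k2/n^3 is
    therefore present, and it dominates when k1 and k2 are much larger than n
    (ex_pointwise_ge, ex_resid_stat_sqr_ge, var_low_arith).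

    For the lower bounds on the biases take a law with regression functions in
    smaller Hoelder balls, replace p by its projection onto a fine V_J, pull it
    slightly towards the middle of the range, and add plus or minus a small
    multiple of a wave: a function all of whose wavelet coefficients of one type
    have the extremal size (wave_exists, perturbation_exists). Do the same for b,
    and let A and Y take only the two extreme values, with the prescribed
    conditional means (two_point_law). The truncation error is bilinear, so the
    alternating sum of its values over the four choices of signs is four times
    the error of the two waves, which is of the exact order
    2^(-j (alpha + beta)) at level j; at every level one of the four laws thus has
    a large bias. Beyond a fixed level the smooth parts do not contribute, and a
    single law works for all levels at once (least_favorable_laws).

    Responses are bounded only almost surely and regression functions are
    determined only up to null sets; clipping to the known range replaces them by
    bounded functions with the same moments (clip_regression_model,
    psi_moments). *)

(** * Expectations of bounded measurable functions *)

(** The moment computations only involve bounded integrands, so that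
    expectations are additive, monotone and exchangeable without further
    integrability conditions. *)
Definition bmeas d (T : measurableType d) (R : realType) (f : T -> R) : Prop :=
  measurable_fun setT f /\ exists C, forall x, `|f x| <= C.

Section bmeas_closure.
Context d (T : measurableType d) (R : realType).
Implicit Types f g : T -> R.

Lemma bmeas_cst (c : R) : bmeas (fun _ : T => c).
Proof. by split; [exact: measurable_cst | exists `|c|]. Qed.

Lemma bmeasD f g : bmeas f -> bmeas g -> bmeas (fun x => f x + g x).
Proof.
move=> [mf [a fa]] [mg [b gb]]; split; first exact: measurable_funD.
by exists (a + b) => x; rewrite (le_trans (ler_normD _ _))// lerD.
Qed.

Lemma bmeasN f : bmeas f -> bmeas (fun x => - f x).
Proof.
move=> [mf [a fa]]; split; first exact: measurableT_comp.
by exists a => x; rewrite normrN.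
Qed.

Lemma bmeasB f g : bmeas f -> bmeas g -> bmeas (fun x => f x - g x).
Proof. by move=> bf bg; apply: bmeasD => //; exact: bmeasN. Qed.

Lemma bmeasM f g : bmeas f -> bmeas g -> bmeas (fun x => f x * g x).
Proof.
move=> [mf [a fa]] [mg [b gb]]; split; first exact: measurable_funM.
by exists (a * b) => x; rewrite normrM ler_pM.
Qed.

Lemma bmeas_sqr f : bmeas f -> bmeas (fun x => f x ^+ 2).
Proof. exact: (fun bf => bmeasM bf bf). Qed.

Lemma bmeas_norm f : bmeas f -> bmeas (fun x => `|f x|).
Proof.
move=> [mf [a fa]]; split; first exact: measurableT_comp.
by exists a => x; rewrite normr_id.
Qed.

Lemma bmeas_sum (I : Type) (s : seq I) (F : I -> T -> R) :
  (forall i, bmeas (F i)) -> bmeas (fun x => \sum_(i <- s) F i x).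
Proof.
move=> bF; elim: s => [|i s IHs].
  by under eq_fun do rewrite big_nil; exact: bmeas_cst.
by under eq_fun do rewrite big_cons; exact: bmeasD.
Qed.

Lemma bmeas_indic (A : set T) : measurable A -> bmeas (\1_A : T -> R).
Proof.
move=> mA; split; first exact: measurable_indic.
by exists 1 => x; rewrite indicE; case: (_ \in _); rewrite ?normr1 ?normr0.
Qed.

End bmeas_closure.

Lemma bmeas_comp d d' (T : measurableType d) (T' : measurableType d')
    (R : realType) (f : T' -> R) (g : T -> T') :
  bmeas f -> measurable_fun setT g -> bmeas (fun x => f (g x)).
Proof.
by move=> [mf [a fa]] mg; split; [exact: measurableT_comp | exists a].
Qed.

Section expectation.
Context d (T : measurableType d) (R : realType) (P : probability T R).
Implicit Types f g : T -> R.

Lemma bmeas_integrable f : bmeas f -> P.-integrable setT (EFin \o f).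
Proof.
move=> [mf [a fa]]; apply: measurable_bounded_integrable => //.
  by rewrite [ltLHS]probability_setT ltry.
exists a; split; first by rewrite num_real.
by move=> b ab x _ /=; rewrite (le_trans (fa x))// ltW.
Qed.
Hint Resolve bmeas_integrable : core.

Lemma EFin_ex f : bmeas f ->
  (\int[P]_x (f x)%:E)%E = (\int[P]_x f x)%:E.
Proof.
move=> bf; rewrite /Rintegral fineK//.
by apply: integrable_fin_num => //; exact: bmeas_integrable.
Qed.

Lemma exD f g : bmeas f -> bmeas g ->
  \int[P]_x (f x + g x) = \int[P]_x f x + \int[P]_x g x.
Proof. by move=> bf bg; apply: RintegralD; auto. Qed.

Lemma exB f g : bmeas f -> bmeas g ->
  \int[P]_x (f x - g x) = \int[P]_x f x - \int[P]_x g x.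
Proof. by move=> bf bg; apply: RintegralB; auto. Qed.

Lemma exZ c f : bmeas f -> \int[P]_x (c * f x) = c * \int[P]_x f x.
Proof. by move=> bf; apply: RintegralZl; auto. Qed.

Lemma ex_cst (c : R) : \int[P]_x c = c.
Proof. by rewrite Rintegral_cst// [X in fine X](probability_setT P) mulr1. Qed.

Lemma ex_le f g : bmeas f -> bmeas g -> (forall x, f x <= g x) ->
  \int[P]_x f x <= \int[P]_x g x.
Proof. by move=> bf bg fg; apply: le_Rintegral; auto. Qed.

Lemma ex_ge0 f : (forall x, 0 <= f x) -> 0 <= \int[P]_x f x.
Proof. by move=> f0; apply: Rintegral_ge0. Qed.

Lemma ex_le_cst f c : bmeas f -> (forall x, f x <= c) -> \int[P]_x f x <= c.
Proof.
by move=> bf fc; rewrite -[leRHS]ex_cst; apply: ex_le => //; exact: bmeas_cst.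
Qed.

Lemma ex_abs f : bmeas f -> `|\int[P]_x f x| <= \int[P]_x `|f x|.
Proof. by move=> bf; apply: le_normr_Rintegral; auto. Qed.

Lemma ex_sum (I : Type) (s : seq I) (F : I -> T -> R) :
  (forall i, bmeas (F i)) ->
  \int[P]_x (\sum_(i <- s) F i x) = \sum_(i <- s) \int[P]_x F i x.
Proof.
move=> bF; elim: s => [|i s IHs].
  by under eq_Rintegral do rewrite big_nil; rewrite big_nil ex_cst.
under eq_Rintegral do rewrite big_cons.
by rewrite big_cons exD ?IHs//; exact: bmeas_sum.
Qed.

Lemma ex_ae f g : {ae P, forall x, f x = g x} ->
  measurable_fun setT f -> measurable_fun setT g ->
  \int[P]_x f x = \int[P]_x g x.
Proof.
move=> fg mf mg; congr fine; apply: ae_eq_integral => //.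
- exact/measurable_EFinP.
- exact/measurable_EFinP.
- by apply: filterS fg => x /= -> .
Qed.

End expectation.
#[global] Hint Extern 0 (is_true (0 <= _ ^+ 2)) => solve [exact: sqr_ge0] : core.

Lemma ex_eq d (T : measurableType d) (R : realType) (P : probability T R)
    (f g : T -> R) : (forall x, f x = g x) ->
  \int[P]_x f x = \int[P]_x g x.
Proof. by move=> /funext ->. Qed.

Section fubini.
Context d1 d2 (T1 : measurableType d1) (T2 : measurableType d2) (R : realType).
Variables (P : probability T1 R) (Q : probability T2 R).
Implicit Types f : T1 * T2 -> R.

Lemma ex_prod f : bmeas f ->
  \int[(P \x Q)%E]_z f z = \int[P]_x \int[Q]_y f (x, y).
Proof.
move=> bf; rewrite {1}/Rintegral -(integral12_prod_meas1 (bmeas_integrable _ bf)).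
congr fine; apply: eq_integral => x _; rewrite /fubini_F -EFin_ex//.
by apply: (bmeas_comp bf).
Qed.

Lemma ex_prod_swap f : bmeas f ->
  \int[P]_x \int[Q]_y f (x, y) = \int[Q]_y \int[P]_x f (x, y).
Proof.
move=> bf; rewrite -ex_prod// {1}/Rintegral.
rewrite -(integral21_prod_meas1 (bmeas_integrable _ bf)).
congr fine; apply: eq_integral => x _; rewrite /fubini_G -EFin_ex//.
by apply: (bmeas_comp bf).
Qed.

Lemma bmeas_ex f : bmeas f -> bmeas (fun x => \int[Q]_y f (x, y)).
Proof.
move=> bf; have bfx x : bmeas (fun y => f (x, y)) by apply: (bmeas_comp bf).
split.
  apply/measurable_EFinP.
  have := measurable_fubini_F (bmeas_integrable (P \x Q)%E bf).
  congr measurable_fun; apply/funext => x /=.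
  by rewrite /fubini_F/= EFin_ex.
have [_ [c fc]] := bf; exists c => x.
by rewrite (le_trans (ex_abs _ _))// ex_le_cst//; exact: bmeas_norm.
Qed.

End fubini.

(** Proves [bmeas] along the arithmetic structure of the function. *)
Ltac bm := repeat first
  [ match goal with H : bmeas ?f |- bmeas ?g => constr_eq f g; exact H end
  | lazymatch goal with
    | |- bmeas (fun x => @?f x - @?g x) => apply: bmeasB
    | |- bmeas (fun x => @?f x + @?g x) => apply: bmeasD
    | |- bmeas (fun x => - @?f x) => apply: bmeasN
    | |- bmeas (fun x => @?f x * @?g x) => apply: bmeasM
    | |- bmeas (fun x => (@?f x) ^+ 2) => apply: bmeas_sqr
    | |- bmeas (fun x => `|@?f x|) => apply: bmeas_norm
    | |- bmeas (fun x => \sum_(i <- _) @?F x i) => first [assumption | apply: bmeas_sum => ?]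
    | |- bmeas (fun x => ?c) => exact: bmeas_cst
    end
  | assumption ].

(** * Independent samples *)

Lemma ex_distribution d (T : measurableType d) (R : realType)
    (P : probability T R) d' (T' : measurableType d') (g : {mfun T >-> T'})
    (f : T' -> R) : bmeas f ->
  \int[distribution P g]_y f y = \int[P]_x f (g x).
Proof.
move=> bf; congr fine; rewrite integral_distribution//.
  by apply/measurable_EFinP; case: bf.
by apply: bmeas_integrable; apply: (bmeas_comp bf).
Qed.

Section product_power.
Context d (T : measurableType d) (R : realType) (P : probability T R).

Lemma ex_prob_pow n (f : n.+1.-tuple T -> R) : bmeas f ->
  \int[prob_pow P n.+1]_t f t =
  \int[P]_x \int[prob_pow P n]_t f (tuple_cons (x, t)).
Proof.
move=> bf; transitivity (\int[(P \x prob_pow P n)%E]_z f (tuple_cons z)).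
  exact: (@ex_distribution _ _ _ (P \x prob_pow P n)%E).
by rewrite ex_prod//; apply: (bmeas_comp bf); exact: measurable_tuple_cons.
Qed.

(** Serves for the cube, for small balls, and for samples whose entries all
    have an almost sure property. *)
Lemma prob_pow_box n (B : 'I_n -> set T) : (forall i, measurable (B i)) ->
  measurable [set t : n.-tuple T | forall i, B i (tnth t i)] /\
  prob_pow P n [set t | forall i, B i (tnth t i)] =
    (\prod_(i < n) fine (P (B i)))%:E.
Proof.
elim: n B => [|n IHn] B mB.
  rewrite (_ : [set t | _] = setT); last first.
    by apply/seteqP; split => // t _ [].
  by split=> //; rewrite big_ord0; exact: probability_setT.
have mt i : measurable [set t : n.+1.-tuple T | B i (tnth t i)].
  by rewrite -[X in measurable X]setTI; exact: measurable_tnth.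
have mbox : measurable [set t : n.+1.-tuple T | forall i, B i (tnth t i)].
  rewrite (_ : [set t | _] = \bigcap_(i in [set: 'I_n.+1])
      [set t : n.+1.-tuple T | B i (tnth t i)]); last first.
    by apply/seteqP; split=> t /= h i; [move=> _|]; exact: h.
  by apply: fin_bigcap_measurable.
split=> //; have [mB' IH] := IHn (fun i => B (lift ord0 i)) (fun i => mB _).
rewrite /= /distribution /pushforward.
rewrite (_ : _ @^-1` _ =
    B ord0 `*` [set t | forall i, B (lift ord0 i) (tnth t i)]); last first.
  apply/seteqP; split => -[x t] /=.
    move=> h; split; first by have := h ord0; rewrite tnth0.
    by move=> i; have := h (lift ord0 i); rewrite tnthS.
  move=> [h0 h] i; case: (unliftP ord0 i) => [j|] ->.
    by rewrite tnthS; exact: h.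
  by rewrite tnth0.
rewrite [LHS]product_measure1E// big_ord_recl EFinM fineK//.
  by congr (_ * _)%E; exact: IH.
by rewrite fin_num_measure.
Qed.

Lemma prob_pow_box1 n (B : set T) : measurable B -> P B = 1%E ->
  measurable [set t : n.-tuple T | forall i, B (tnth t i)] /\
  prob_pow P n [set t | forall i, B (tnth t i)] = 1%E.
Proof.
move=> mB PB; have [mb ->] := @prob_pow_box n (fun=> B) (fun=> mB).
by split=> //; rewrite PB big1_eq.
Qed.

Lemma prob_pow_ae n (B : set T) : measurable B -> P B = 1%E ->
  {ae prob_pow P n, forall t, forall i, B (tnth t i)}.
Proof.
move=> mB PB; have [mbox Pbox] := prob_pow_box1 n mB PB.
exists (~` [set t : n.-tuple T | forall i, B (tnth t i)]); split.
- exact: measurableC.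
- by rewrite [LHS]probability_setC// Pbox subee.
- by [].
Qed.

Section sums.
Variable g : T -> R.
Hypothesis bg : bmeas g.

Lemma bmeas_tnth n (i : 'I_n) : bmeas (fun t : n.-tuple T => g (tnth t i)).
Proof. exact: (bmeas_comp bg (measurable_tnth i)). Qed.

Lemma sample_sum_cons n x (t : n.-tuple T) :
  \sum_(i < n.+1) g (tnth (tuple_cons (x, t)) i) =
  g x + \sum_(i < n) g (tnth t i).
Proof.
by rewrite big_ord_recl tnth0; under eq_bigr do rewrite tnthS.
Qed.

Let bsum n : bmeas (fun t : n.-tuple T => \sum_(i < n) g (tnth t i)).
Proof. by apply: bmeas_sum => i; exact: bmeas_tnth. Qed.

Lemma ex_sample_sum n : \int[prob_pow P n]_t (\sum_(i < n) g (tnth t i)) =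
  n%:R * \int[P]_x g x.
Proof.
elim: n => [|n IHn].
  by under eq_Rintegral do rewrite big_ord0; rewrite ex_cst mul0r.
have bs := @bsum n.
rewrite ex_prob_pow; last exact: bsum.
transitivity (\int[P]_x (g x + n%:R * \int[P]_x g x)).
  apply: ex_eq => x; under ex_eq do rewrite sample_sum_cons.
  by rewrite exD; [rewrite ex_cst IHn|bm..].
by rewrite exD; [rewrite ex_cst -natr1 mulrDl mul1r addrC|bm..].
Qed.

(** Of the n^2 products, n are squares and the others have independent
    factors. *)
Lemma ex_sample_sum_sqr n :
  \int[prob_pow P n]_t (\sum_(i < n) g (tnth t i)) ^+ 2 =
  n%:R * \int[P]_x (g x ^+ 2) + (n%:R ^+ 2 - n%:R) * (\int[P]_x g x) ^+ 2.
Proof.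
elim: n => [|n IHn].
  under eq_Rintegral do rewrite big_ord0 expr0n/=.
  by rewrite ex_cst; ring.
have bs := @bsum n.
rewrite ex_prob_pow; last exact/bmeas_sqr/bsum.
set E1 := \int[P]_x g x; set E2 := \int[P]_x _ in IHn *.
transitivity (\int[P]_x (g x ^+ 2 + (2 * n%:R * E1 * g x +
    (n%:R * E2 + (n%:R ^+ 2 - n%:R) * E1 ^+ 2)))).
  apply: ex_eq => x.
  transitivity (\int[prob_pow P n]_t (g x ^+ 2 +
      (2 * g x * (\sum_(i < n) g (tnth t i)) +
       (\sum_(i < n) g (tnth t i)) ^+ 2))).
    by apply: ex_eq => t; rewrite sample_sum_cons; ring.
  rewrite exD; [|bm..]; rewrite exD; [|bm..]; rewrite exZ; [|bm].
  by rewrite ex_cst ex_sample_sum IHn -/E1; ring.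
rewrite exD; [|bm..]; rewrite exD; [|bm..]; rewrite exZ; [|bm].
by rewrite ex_cst -/E1 -/E2 -natr1; ring.
Qed.

(** Bias-variance decomposition of the mean of a sample about [c]. *)
Lemma ex_sample_mean_sqr n (c : R) : (0 < n)%N ->
  \int[prob_pow P n]_t (n%:R^-1 * (\sum_(i < n) g (tnth t i)) - c) ^+ 2 =
  n%:R^-1 * (\int[P]_x (g x ^+ 2) - (\int[P]_x g x) ^+ 2) +
  (\int[P]_x g x - c) ^+ 2.
Proof.
move=> n0; have n0' : n%:R != 0 :> R by rewrite pnatr_eq0 -lt0n.
have bs := @bsum n.
transitivity (\int[prob_pow P n]_t
  (n%:R^-1 ^+ 2 * (\sum_(i < n) g (tnth t i)) ^+ 2 +
   (- 2 * c * n%:R^-1 * (\sum_(i < n) g (tnth t i)) + c ^+ 2))).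
  by apply: ex_eq => t; ring.
rewrite exD; [|bm..]; rewrite exD; [|bm..]; rewrite exZ; [|bm].
rewrite exZ; [|bm]; rewrite ex_cst ex_sample_sum ex_sample_sum_sqr.
by field.
Qed.

End sums.
End product_power.

(** * Orthonormal families *)

Section inner_product.
Context (R : realType) (d : nat).
Implicit Types f g h : d.-tuple R -> R.

Lemma innerC f g : inner f g = inner g f.
Proof. by apply: ex_eq => x; rewrite mulrC. Qed.

Lemma innerDl f g h : bmeas f -> bmeas g -> bmeas h ->
  inner (fun x => f x + g x) h = inner f h + inner g h.
Proof.
by move=> bf bg bh; rewrite -exD; [apply: ex_eq => x; rewrite mulrDl|bm..].
Qed.

Lemma innerBl f g h : bmeas f -> bmeas g -> bmeas h ->
  inner (fun x => f x - g x) h = inner f h - inner g h.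
Proof.
by move=> bf bg bh; rewrite -exB; [apply: ex_eq => x; rewrite mulrBl|bm..].
Qed.

Lemma innerZl c f g : bmeas f -> bmeas g ->
  inner (fun x => c * f x) g = c * inner f g.
Proof.
by move=> bf bg; rewrite -exZ; [apply: ex_eq => x; rewrite mulrA|bm..].
Qed.

Lemma inner_suml (I : Type) (s : seq I) (F : I -> d.-tuple R -> R) g :
  (forall i, bmeas (F i)) -> bmeas g ->
  inner (fun x => \sum_(i <- s) F i x) g = \sum_(i <- s) inner (F i) g.
Proof.
move=> bF bg; rewrite -ex_sum; last by move=> i; bm.
by apply: ex_eq => x; rewrite big_distrl.
Qed.

Lemma inner_ge0 f : 0 <= inner f f.
Proof. by apply: ex_ge0 => x; rewrite -expr2. Qed.

Lemma inner_le_norm f c : bmeas f -> (forall x, `|f x| <= c) ->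
  inner f f <= c ^+ 2.
Proof.
move=> bf fc; apply: ex_le_cst => [|x]; first by bm.
by rewrite -expr2 -real_normK ?num_real// lerXn2r// nnegrE (le_trans _ (fc x)).
Qed.

Lemma inner_norm_le f g c : bmeas f -> bmeas g -> (forall x, `|f x| <= c) ->
  `|inner f g| <= c * \int[unif R d]_x `|g x|.
Proof.
move=> bf bg fc; have := ex_abs (unif R d) (bmeasM bf bg).
move=> /le_trans; apply; rewrite -exZ; last by bm.
by apply: ex_le => [||x]; [by bm|by bm|rewrite normrM ler_wpM2r].
Qed.

Lemma inner_lin2 f g (a b : R) : bmeas f -> bmeas g ->
  inner (fun x => a * f x - b * g x) (fun x => a * f x - b * g x) =
  a ^+ 2 * inner f f - 2 * a * b * inner f g + b ^+ 2 * inner g g.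
Proof.
move=> bf bg; transitivity (\int[unif R d]_x (a ^+ 2 * (f x * f x) -
    (2 * a * b) * (f x * g x) + b ^+ 2 * (g x * g x))).
  by apply: ex_eq => x; ring.
by rewrite exD; [|bm..]; rewrite exB; [|bm..]; rewrite !exZ//; bm.
Qed.

Lemma inner_Cauchy_Schwarz f g : bmeas f -> bmeas g ->
  inner f g ^+ 2 <= inner f f * inner g g.
Proof.
move=> bf bg; have g0 := inner_ge0 g.
have [gg0|gg0] := eqVneq (inner g g) 0.
  have [->|fg0] := eqVneq (inner f g) 0.
    by rewrite expr0n/= mulr_ge0// inner_ge0.
  have := inner_ge0 (fun x => 1 * f x - ((inner f f + 1) / inner f g) * g x).
  rewrite inner_lin2// gg0 mulr0 addr0 expr1n mul1r mulr1 -mulrA divfK//.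
  by have := inner_ge0 f; lra.
have := inner_ge0 (fun x => inner g g * f x - inner f g * g x).
rewrite inner_lin2// (_ : _ + _ = inner g g *
  (inner f f * inner g g - inner f g ^+ 2)); last by ring.
by rewrite pmulr_rge0 ?subr_ge0// lt_neqAle eq_sym gg0.
Qed.

End inner_product.

Section orthonormal_family.
Context (R : realType) (d : nat) (I : finType) (phi : I -> d.-tuple R -> R).
Hypothesis bphi : forall i, bmeas (phi i).
Hypothesis ophi : forall i j, inner (phi i) (phi j) = (i == j)%:R.
Implicit Types f g : d.-tuple R -> R.

Definition oproj f (x : d.-tuple R) : R := \sum_i inner f (phi i) * phi i x.

Lemma bmeas_proj f : bmeas (oproj f).
Proof. by apply: bmeas_sum => i; bm. Qed.
Hint Resolve bmeas_proj : core.

Lemma bmeas_lspan g : lspan phi g -> bmeas g.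
Proof. by move=> [c ->]; bm. Qed.

Lemma lspan_proj f : lspan phi (oproj f).
Proof. by exists (fun i => inner f (phi i)). Qed.

Lemma inner_proj_l f g : bmeas g ->
  inner (oproj f) g = \sum_i inner f (phi i) * inner g (phi i).
Proof.
move=> bg; rewrite inner_suml//; last by move=> i; bm.
by apply: eq_bigr => i _; rewrite innerZl// (innerC _ g).
Qed.

Lemma inner_proj_phi f i : inner (oproj f) (phi i) = inner f (phi i).
Proof.
rewrite inner_proj_l// (bigD1 i)//= ophi eqxx mulr1 big1 ?addr0// => j ji.
by rewrite ophi eq_sym (negPf ji) mulr0.
Qed.

Lemma inner_projC f g : bmeas f -> bmeas g ->
  inner (oproj f) g = inner f (oproj g).
Proof.
move=> bf bg; rewrite [RHS]innerC !inner_proj_l//.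
by apply: eq_bigr => i _; rewrite mulrC.
Qed.

Lemma inner_proj_proj f g :
  inner (oproj f) (oproj g) = \sum_i inner f (phi i) * inner g (phi i).
Proof.
rewrite inner_proj_l//; apply: eq_bigr => i _.
by rewrite inner_proj_phi.
Qed.

Lemma oproj_id g : lspan phi g -> oproj g = g.
Proof.
move=> [c ->]; apply/funext => x; apply: eq_bigr => i _; congr (_ * _).
rewrite inner_suml//; last by move=> j; bm.
rewrite (bigD1 i)//= innerZl// ophi eqxx mulr1 big1 ?addr0// => j ji.
by rewrite innerZl// ophi (negPf ji) mulr0.
Qed.

Lemma inner_sub_proj f g : bmeas f -> lspan phi g ->
  inner (fun x => f x - oproj f x) g = 0.
Proof.
move=> bf gV; have bg := bmeas_lspan gV.
by rewrite innerBl// inner_projC// oproj_id// subrr.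
Qed.

Lemma Bessel f : bmeas f -> \sum_i inner f (phi i) ^+ 2 <= inner f f.
Proof.
move=> bf; have := inner_ge0 (fun x => 1 * f x - 1 * oproj f x).
rewrite inner_lin2// expr1n !mul1r mulr1 inner_proj_proj innerC inner_proj_l//.
by under eq_bigr do rewrite -expr2; lra.
Qed.

Lemma inner_proj_le f : bmeas f -> inner (oproj f) (oproj f) <= inner f f.
Proof.
move=> bf; rewrite inner_proj_proj; apply: le_trans (Bessel bf).
by apply: ler_sum => i _; rewrite expr2.
Qed.

Lemma proj_best_approximation f g : bmeas f -> lspan phi g ->
  inner (fun x => f x - oproj f x) (fun x => f x - oproj f x) <=
  inner (fun x => f x - g x) (fun x => f x - g x).
Proof.
move=> bf gV; have bg := bmeas_lspan gV.
have br : bmeas (fun x => f x - oproj f x) by bm.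
have hV : lspan phi (fun x => g x - oproj f x).
  case: gV => c ->; exists (fun i => c i - inner f (phi i)).
  by apply/funext => x; rewrite -sumrB; apply: eq_bigr => i _; rewrite mulrBl.
have bh := bmeas_lspan hV.
rewrite [leRHS](_ : _ = inner (fun x => 1 * (f x - oproj f x) - 1 * (g x - oproj f x))
    (fun x => 1 * (f x - oproj f x) - 1 * (g x - oproj f x))); last first.
  by apply: ex_eq => x; ring.
rewrite inner_lin2// (inner_sub_proj bf hV) expr1n !mul1r mulr0 subr0.
by rewrite lerDl inner_ge0.
Qed.

End orthonormal_family.

(** Both sides are the inner product of the projections onto the smaller
    span. *)
Lemma inner_proj_sub (R : realType) (d : nat) (I J : finType)
    (phi : I -> d.-tuple R -> R) (psi : J -> d.-tuple R -> R)
    (f g : d.-tuple R -> R) :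
  (forall i, bmeas (phi i)) -> (forall j, bmeas (psi j)) ->
  (forall i j, inner (psi i) (psi j) = (i == j)%:R) ->
  lspan phi `<=` lspan psi -> bmeas f -> bmeas g ->
  inner (oproj phi f) (oproj psi g) =
  \sum_i inner f (phi i) * inner g (phi i).
Proof.
move=> bphi bpsi opsi sub bf bg; have bp := bmeas_proj bphi f.
have bq := bmeas_proj bpsi g.
rewrite -inner_projC// (oproj_id bpsi opsi); last exact/sub/lspan_proj.
exact: inner_proj_l.
Qed.

(** Each side is the inner product of the projections onto the common span. *)
Lemma sum_inner_basis (R : realType) (d : nat) (I J : finType)
    (phi : I -> d.-tuple R -> R) (psi : J -> d.-tuple R -> R)
    (f g : d.-tuple R -> R) :
  (forall i, bmeas (phi i)) -> (forall j, bmeas (psi j)) ->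
  (forall i j, inner (phi i) (phi j) = (i == j)%:R) ->
  (forall i j, inner (psi i) (psi j) = (i == j)%:R) ->
  lspan phi = lspan psi -> bmeas f -> bmeas g ->
  \sum_i inner f (phi i) * inner g (phi i) =
  \sum_i inner f (psi i) * inner g (psi i).
Proof.
move=> bphi bpsi ophi opsi eqV bf bg.
rewrite -(inner_proj_sub bphi bpsi)//; last by rewrite eqV.
rewrite innerC (inner_proj_sub bpsi bphi)//; last by rewrite eqV.
by apply: eq_bigr => i _; rewrite mulrC.
Qed.

(** * The uniform distribution on the cube *)

Section uniform.
Context (R : realType).

Lemma unif01_lebesgue (A : set R) : measurable A ->
  unif01 R A = lebesgue_measure (A `&` `[0, 1]).
Proof.
move=> mA; transitivity (uniform_prob (@ltr01 R) A); first by [].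
rewrite /uniform_prob integral_uniform_pdf.
rewrite (eq_integral (fun=> 1%:E)); last first.
  by move=> x; rewrite inE/= in_itv/= /uniform_pdf => -[_ ->]; rewrite subr0 invr1.
by rewrite integral_cst//= ?mul1e//; exact: measurableI.
Qed.

Lemma unif01_ball (a r : R) : 0 <= r ->
  fine (unif01 R [set x | `|x - a| <= r]) <= 2 * r.
Proof.
move=> r0; have -> : [set x | `|x - a| <= r] = `[a - r, a + r]%classic.
  by apply/seteqP; split => x /=; rewrite in_itv/= ler_distl.
pose I : set R := `[a - r, a + r]%classic.
have mI : measurable I by exact: measurable_itv.
rewrite -/I.
rewrite unif01_lebesgue//.
have h : (lebesgue_measure (I `&` `[0%R, 1%R]) <= (2 * r)%:E)%E.
  apply: (@le_trans _ _ (lebesgue_measure I)).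
    by apply: le_measure; rewrite ?inE//; exact: measurableI.
  rewrite /I lebesgue_measure_itv/= lte_fin; case: ifP => _.
    by rewrite -EFinB lee_fin; lra.
  by rewrite lee_fin mulr_ge0.
by rewrite -lee_fin fineK// ge0_fin_numE// (le_lt_trans h)// ltry.
Qed.

Lemma unif01_lt (t : R) : 0 <= t <= 1 -> fine (unif01 R [set x | x < t]) = t.
Proof.
move=> /andP[t0 t1]; have -> : [set x | x < t] = `]-oo, t[%classic.
  by apply/seteqP; split => x /=; rewrite in_itv.
rewrite unif01_lebesgue//; have -> : `]-oo, t[ `&` `[0, 1] = `[0, t[%classic :> set R.
  apply/seteqP; split => x /=; rewrite !in_itv/=.
    by move=> -[-> /andP[->]].
  by move=> /andP[-> xt]; rewrite xt (ltW (lt_le_trans xt t1)).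
rewrite lebesgue_measure_itv/= lte_fin; case: ifPn => [_|].
  by rewrite oppr0 adde0.
by rewrite -leNgt /= => t0'; apply/eqP; rewrite eq_le t0 t0'.
Qed.

Lemma unif01_itv01 : unif01 R `[0, 1]%classic = 1%E.
Proof.
by rewrite unif01_lebesgue// setIid lebesgue_measure_itv/= lte_fin ltr01 oppr0 adde0.
Qed.

End uniform.

Section cube.
Context (R : realType) (d : nat).

Let itv01E : [set x : R | 0 <= x <= 1] = `[0, 1]%classic.
Proof. by apply/seteqP; split => x /=; rewrite in_itv. Qed.

Lemma measurable_cube : measurable (@cube R d).
Proof.
have m (i : 'I_d) : measurable [set x : R | 0 <= x <= 1].
  by rewrite itv01E; exact: measurable_itv.
by have [] := prob_pow_box (unif01 R) m.
Qed.

Lemma cube_ae : {ae unif R d, forall x, cube x}.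
Proof.
apply: (@prob_pow_ae _ _ _ (unif01 R) d [set x | 0 <= x <= 1]).
  by rewrite itv01E; exact: measurable_itv.
by rewrite itv01E; exact: unif01_itv01.
Qed.

Lemma ex_cube (f g : d.-tuple R -> R) : (forall x, cube x -> f x = g x) ->
  measurable_fun setT f -> measurable_fun setT g ->
  \int[unif R d]_x f x = \int[unif R d]_x g x.
Proof.
by move=> fg mf mg; apply: ex_ae => //; apply: filterS cube_ae => x /fg.
Qed.

Lemma unif_ball (a : d.-tuple R) (r : R) : 0 <= r ->
  let B := [set x : d.-tuple R | forall i, `|tnth x i - tnth a i| <= r] in
  measurable B /\ \int[unif R d]_x (\1_B x) <= (2 * r) ^+ d.
Proof.
move=> r0 B.
have mb i : measurable [set x : R | `|x - tnth a i| <= r].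
  rewrite (_ : [set x | _] = `[tnth a i - r, tnth a i + r]%classic)//.
  by apply/seteqP; split => x /=; rewrite in_itv/= ler_distl.
have [mB PB] := prob_pow_box (unif01 R) mb.
split=> //; rewrite /Rintegral integral_indic// setIT.
rewrite [X in fine X]PB /= -[d in _ ^+ d]card_ord -prodr_const.
by apply: ler_prod => i _; rewrite fine_ge0//=; exact: unif01_ball.
Qed.

End cube.

(** * Multiresolution analysis *)

Section multiresolution.
Context (R : realType) (d S J0 : nat) (W : wavelets R d).
Hypothesis W_cdv : cdv_basis W S J0.
Implicit Types f g : d.-tuple R -> R.

Lemma bmeas_Phi j (m : Z W j) : (J0 <= j)%N -> bmeas (Phi m).
Proof.
have [C _ geom] := level_geometry W_cdv; move=> /geom[_ _ /(_ m)[mf _ _ bf _] _ _].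
by split=> //; exists (C * Num.sqrt (2 ^ (j * d))%:R).
Qed.

Lemma bmeas_Psi j i (m : Z W j) : (J0 <= j)%N -> bmeas (Psi i m).
Proof.
have [C _ geom] := level_geometry W_cdv.
move=> /geom[_ _ _ /(_ i m)[mf _ _ bf _] _].
by split=> //; exists (C * Num.sqrt (2 ^ (j * d))%:R).
Qed.

Lemma bmeas_Phi_Psi j (z : Z W j + details d * Z W j) : (J0 <= j)%N ->
  bmeas (Phi_Psi z).
Proof. by case: z => [m|[i m]] J0j; [exact: bmeas_Phi | exact: bmeas_Psi]. Qed.

Lemma V_cube0 j g : (J0 <= j)%N -> V W j g -> forall x, ~ cube x -> g x = 0.
Proof.
have [C _ geom] := level_geometry W_cdv.
move=> J0j [c ->] x xc; apply: big1 => m _.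
by have [_ _ /(_ m)[_ _ -> // _ _] _ _] := geom _ J0j; rewrite mulr0.
Qed.

Lemma V_bmeas j g : (J0 <= j)%N -> V W j g -> bmeas g.
Proof.
by move=> J0j; apply: bmeas_lspan => m; exact: bmeas_Phi.
Qed.

Lemma V_subS j : (J0 <= j)%N -> V W j `<=` V W j.+1.
Proof.
move=> J0j; rewrite (multiresolution W_cdv)// => g [c ->].
exists (fun z => match z with inl m => c m | inr _ => 0 end).
apply/funext => x; rewrite big_sumType/= [X in _ + X]big1 ?addr0// => z _.
by rewrite mul0r.
Qed.

Lemma V_sub j j' : (J0 <= j <= j')%N -> V W j `<=` V W j'.
Proof.
move=> /andP[J0j]; elim: j' => [|j' IHj].
  by rewrite leqn0 => /eqP ->.
rewrite leq_eqVlt => /predU1P[->//|]; rewrite ltnS => jj'.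
by apply: subset_trans (IHj jj') (V_subS _); exact: leq_trans jj'.
Qed.

(** Down to the coarsest level, [V j] is spanned by coarse scaling functions
    and wavelets of levels below [j]. *)
Lemma V_Psi_orthogonal j l g i (m : Z W l) : (J0 <= j <= l)%N -> V W j g ->
  inner g (Psi i m) = 0.
Proof.
move=> /andP[/subnKC <-]; move: (j - J0)%N => t.
elim: t g => [|t IHt] g Jl.
  rewrite addn0 in Jl *; move=> [c ->].
  rewrite inner_suml; [|by move=> ?; bm; exact: bmeas_Phi|exact: bmeas_Psi].
  apply: big1 => m' _; rewrite innerZl; [|exact: bmeas_Phi|exact: bmeas_Psi].
  by rewrite (Phi_Psi_orthogonal W_cdv)// mulr0.
rewrite addnS (multiresolution W_cdv) ?leq_addr// => -[c ->].
have J0t : (J0 <= J0 + t)%N by rewrite leq_addr.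
have Jl' : (J0 + t <= l)%N by apply: leq_trans Jl; rewrite addnS.
have J0l := leq_trans J0t Jl'; have bP := bmeas_Psi i m J0l.
rewrite inner_suml//; last by move=> z; bm; exact: bmeas_Phi_Psi.
apply: big1 => z _; rewrite innerZl//; last exact: bmeas_Phi_Psi.
case: z => [m'|[i' m']] /=.
  rewrite IHt ?mulr0//; exists (fun m => (m == m')%:R).
  apply/funext => x; rewrite (bigD1 m')//= eqxx mul1r big1 ?addr0// => m'' mm.
  by rewrite (negPf mm) mul0r.
rewrite (Psi_orthogonal W_cdv) ?mulr0// => tl.
by move: Jl; rewrite addnS tl ltnn.
Qed.

Lemma Phi_in_V j (m : Z W j) : V W j (Phi m).
Proof.
exists (fun m' => (m' == m)%:R).
apply/funext => x; rewrite (bigD1 m)//= eqxx mul1r big1 ?addr0// => m'' mm.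
by rewrite (negPf mm) mul0r.
Qed.

Lemma Phi_Psi_orthonormal j (z z' : Z W j + details d * Z W j) : (J0 <= j)%N ->
  inner (Phi_Psi z) (Phi_Psi z') = (z == z')%:R.
Proof.
move=> J0j; have jj : (J0 <= j <= j)%N by rewrite J0j leqnn.
case: z z' => [m|[i m]] [m'|[i' m']] /=.
- by rewrite (Phi_orthonormal W_cdv).
- by rewrite (V_Psi_orthogonal _ _ jj)//; exact: Phi_in_V.
- by rewrite innerC (V_Psi_orthogonal _ _ jj)//; exact: Phi_in_V.
- by rewrite (Psi_orthonormal W_cdv).
Qed.

Definition projV (j : nat) f : d.-tuple R -> R := oproj (@Phi R d W j) f.

(** The inner product of the projections onto [V j]. *)
Definition coarse (j : nat) f g : R :=
  \sum_(m : Z W j) inner f (Phi m) * inner g (Phi m).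

(** The contribution of the wavelets of level [l] to an inner product. *)
Definition detail (l : nat) f g : R :=
  \sum_(z : details d * Z W l) inner f (Psi z.1 z.2) * inner g (Psi z.1 z.2).

Lemma coarseS j f g : (J0 <= j)%N -> bmeas f -> bmeas g ->
  coarse j.+1 f g = coarse j f g + detail j f g.
Proof.
move=> J0j bf bg.
rewrite /coarse (@sum_inner_basis _ _ _ _ _ (@Phi_Psi R d W j))//.
- by rewrite big_sumType; congr (_ + _); apply: eq_bigr => -[].
- by move=> m; apply: bmeas_Phi; rewrite leqW.
- by move=> z; exact: bmeas_Phi_Psi.
- by move=> m m'; rewrite (Phi_orthonormal W_cdv)// leqW.
- by move=> z z'; exact: Phi_Psi_orthonormal.
- by rewrite -(multiresolution W_cdv).
Qed.

Lemma coarse_telescope j n f g : (J0 <= j)%N -> bmeas f -> bmeas g ->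
  coarse (j + n) f g = coarse j f g + \sum_(i < n) detail (j + i) f g.
Proof.
move=> J0j bf bg; elim: n => [|n IHn]; first by rewrite addn0 big_ord0 addr0.
rewrite addnS coarseS//; last by rewrite (leq_trans J0j) ?leq_addr.
by rewrite IHn big_ord_recr/= addrA.
Qed.

Lemma bmeas_projV j f : (J0 <= j)%N -> bmeas (projV j f).
Proof. by move=> J0j; apply: bmeas_proj => m; exact: bmeas_Phi. Qed.

Lemma projV_in_V j f : V W j (projV j f).
Proof. exact: lspan_proj. Qed.

Lemma inner_projV_l j f g : (J0 <= j)%N -> bmeas g ->
  inner (projV j f) g = coarse j f g.
Proof. by move=> J0j bg; apply: inner_proj_l => // m; exact: bmeas_Phi. Qed.

(** Projections onto two levels meet at the coarser one. *)
Lemma inner_projV2 j1 j2 f g : (J0 <= j1)%N -> (J0 <= j2)%N ->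
  bmeas f -> bmeas g ->
  inner (projV j1 f) (projV j2 g) = coarse (minn j1 j2) f g.
Proof.
move=> J1 J2 bf bg.
have b j : (J0 <= j)%N -> forall m : Z W j, bmeas (Phi m).
  by move=> Jj m; exact: bmeas_Phi.
have o j : (J0 <= j)%N -> forall m m' : Z W j,
    inner (Phi m) (Phi m') = (m == m')%:R.
  by move=> Jj m m'; exact: (Phi_orthonormal W_cdv).
wlog le12 : j1 j2 f g bf bg J1 J2 / (j1 <= j2)%N => [hw|].
  case/orP: (leq_total j1 j2) => [|le21]; first exact: hw.
  rewrite innerC hw// minnC; apply: eq_bigr => m _; exact: mulrC.
have sub := @V_sub j1 j2; rewrite J1 le12 in sub.
have /minn_idPl -> := le12.
by apply: inner_proj_sub; [exact: b|exact: b|exact: o|exact: sub|..].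
Qed.

(** The left side is the inner product of the residuals of both projections.
    The inner product of the projections sits at the coarser level and cancels
    the cross term of that level, so that only the finer level remains. *)
Lemma inner_sub_projV2 j1 j2 f g : (J0 <= j1)%N -> (J0 <= j2)%N ->
  bmeas f -> bmeas g ->
  inner f g - inner f (projV j2 g) - inner g (projV j1 f) +
    inner (projV j1 f) (projV j2 g) =
  inner f g - coarse (maxn j1 j2) f g.
Proof.
move=> J1 J2 bf bg; rewrite inner_projV2//.
rewrite (innerC f (projV _ _)) (innerC g (projV _ _)) !inner_projV_l//.
have -> : coarse j2 g f = coarse j2 f g.
  by apply: eq_bigr => m _; exact: mulrC.
by case: (leqP j1 j2) => _; ring.
Qed.

(** Some element of some [V j0] is close to [g]; projections onto finer spaces
    approximate [g] at least as well, and Cauchy-Schwarz transfers this to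
    inner products. *)
Lemma coarse_cvg f g e : bmeas f -> bmeas g -> 0 < e ->
  exists2 j0, (J0 <= j0)%N & forall j, (j0 <= j)%N ->
    `|inner f g - coarse j f g| <= e.
Proof.
move=> bf bg e0; have f1 : 0 < inner f f + 1 by rewrite ltr_wpDl// inner_ge0.
have e1 : 0 < e ^+ 2 / (inner f f + 1) by rewrite divr_gt0// exprn_gt0.
have [|j0 [h [J0j0 hV he]]] := V_dense W_cdv (proj1 bg) _ e1.
  by apply: bmeas_integrable; bm.
exists j0 => // j j0j; have J0j := leq_trans J0j0 j0j.
have bp := bmeas_projV g J0j; have bh := V_bmeas J0j0 hV.
have b j' : (J0 <= j')%N -> forall m : Z W j', bmeas (Phi m).
  by move=> Jj m; exact: bmeas_Phi.
have {hV}hV : V W j h by apply: V_sub hV; rewrite J0j0.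
have -> : inner f g - coarse j f g = inner (fun x => g x - projV j g x) f.
  rewrite innerBl// innerC inner_projV_l//; congr (_ - _).
  by apply: eq_bigr => m _; exact: mulrC.
have br : bmeas (fun x => g x - projV j g x) by bm.
rewrite -ler_sqr ?nnegrE ?(ltW e0)// real_normK ?num_real//.
apply: le_trans (inner_Cauchy_Schwarz br bf) _.
apply: (@le_trans _ _ (e ^+ 2 / (inner f f + 1) * inner f f)); last first.
  by rewrite mulrAC ler_pdivrMr// ler_wpM2l// ?sqr_ge0// lerDl.
rewrite ler_wpM2r ?inner_ge0//.
apply: le_trans (proj_best_approximation (b _ J0j) _ bg hV) _.
  by move=> m m'; exact: (Phi_orthonormal W_cdv).
rewrite /inner -lee_fin -EFin_ex; last by bm.
by apply: ltW; under eq_integral do rewrite -expr2.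
Qed.

End multiresolution.

(** * Localization of the wavelets *)

Section localization.
Context (R : realType) (d : nat).

Lemma sqrt_natK (k : nat) : (0 < k)%N ->
  Num.sqrt k%:R * Num.sqrt k%:R = k%:R :> R.
Proof. by move=> k0; rewrite -expr2 sqr_sqrtr. Qed.

Lemma sqrt_res_gt0 j : 0 < Num.sqrt (2 ^ (j * d))%:R :> R.
Proof. by rewrite sqrtr_gt0 ltr0n expn_gt0. Qed.

Lemma res_gt0 j : 0 < (2 ^ (j * d))%:R :> R.
Proof. by rewrite ltr0n expn_gt0. Qed.

(** Cauchy-Schwarz against the indicator of a cube of volume (2C)^d / k that
    contains the support. *)
Lemma atom_L1 (C : R) j f : 0 < C -> atom C j f -> inner f f = 1 ->
  (\int[unif R d]_x `|f x|) * Num.sqrt (2 ^ (j * d))%:R <=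
  Num.sqrt ((2 * C) ^+ d).
Proof.
move=> C0 [mf _ _ bf [a supp]] ff1.
have bmf : bmeas f by split=> //; exists (C * Num.sqrt (2 ^ (j * d))%:R).
have r0 : 0 <= C / (2 ^ j)%:R by rewrite divr_ge0// ltW.
have [mB] := unif_ball a r0; set B := [set x | _]; move=> hB.
have bB : bmeas (\1_B : d.-tuple R -> R) by exact: bmeas_indic.
have bmn : bmeas (fun x => `|f x|) by bm.
have -> : \int[unif R d]_x `|f x| = inner (fun x => `|f x|) (\1_B).
  apply: ex_eq => x; have [->|fx0] := eqVneq (f x) 0; first by rewrite normr0 mul0r.
  by rewrite indicE mem_set ?mulr1//; exact: supp.
rewrite -ler_sqr ?nnegrE ?sqrtr_ge0//; last first.
  rewrite mulr_ge0 ?sqrtr_ge0//; apply: ex_ge0 => x.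
  by rewrite mulr_ge0// indicE.
rewrite exprMn !sqr_sqrtr ?exprn_ge0 ?mulr_ge0 ?(ltW C0)//.
apply: (@le_trans _ _ ((2 * (C / (2 ^ j)%:R)) ^+ d * (2 ^ (j * d))%:R)).
  rewrite ler_wpM2r//; apply: le_trans (inner_Cauchy_Schwarz bmn bB) _.
  rewrite [X in X * _](_ : _ = 1) ?mul1r; last first.
    by rewrite -ff1; apply: ex_eq => x; rewrite -normrM -!expr2 ger0_norm.
  apply: le_trans hB; rewrite le_eqVlt; apply/orP; left; apply/eqP.
  by apply: ex_eq => x; rewrite indicE -natrM mulnb andbb.
rewrite expnM (natrX _ (2 ^ j)) -exprMn [X in X ^+ d <= _](_ : _ = 2 * C)//.
by rewrite mulrA mulfVK// pnatr_eq0 expn_eq0.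
Qed.

(** One factor [C] counts the nonzero terms, the other belongs to the size of
    [u]. *)
Lemma overlap_sum (I : finType) (a u : I -> R) (A C s : R) :
  0 <= A -> 0 <= C -> 0 <= s ->
  #|[set m | u m != 0]%SET|%:R <= C -> (forall m, `|u m| <= C * s) ->
  (forall m, u m != 0 -> `|a m| <= A) ->
  `|\sum_m a m * u m| <= A * (C ^+ 2 * s).
Proof.
move=> A0 C0 s0 card us aA.
have -> : \sum_m a m * u m = \sum_(m in [set m | u m != 0]%SET) a m * u m.
  rewrite [LHS](bigID (mem [set m | u m != 0]%SET))/= [X in _ + X]big1 ?addr0// => m.
  by rewrite inE negbK => /eqP ->; rewrite mulr0.
apply: le_trans (ler_norm_sum _ _ _) _.
apply: (@le_trans _ _ (\sum_(m in [set m | u m != 0]%SET) A * (C * s))).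
  by apply: ler_sum => m; rewrite inE => um; rewrite normrM ler_pM// aA.
rewrite sumr_const -mulr_natl [leRHS](_ : _ = C * (A * (C * s))); last by ring.
by rewrite ler_wpM2r// !mulr_ge0.
Qed.

End localization.

Section kernel.
Context (R : realType) (d S J0 : nat) (W : wavelets R d).
Hypothesis W_cdv : cdv_basis W S J0.
Implicit Types f g : d.-tuple R -> R.

(** The bounds on the wavelets with the constant exposed: the constants of the
    upper bounds depend on the basis only through it. *)
Definition level_bounds (C : R) : Prop := forall j, (J0 <= j)%N ->
    [/\ (2 ^ (j * d))%:R <= C * #|Z W j|%:R,
        #|Z W j|%:R <= C * (2 ^ (j * d))%:R,
        forall m : Z W j, atom C j (Phi m),
        forall i (m : Z W j), atom C j (Psi i m) &
        forall x, #|[set m : Z W j | Phi m x != 0]%SET|%:R <= C /\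
          forall i, #|[set m : Z W j | Psi i m x != 0]%SET|%:R <= C].

Variable C : R.
Hypothesis C_gt0 : 0 < C.
Hypothesis geom : level_bounds C.

Let C_ge0 : 0 <= C. Proof. exact: ltW. Qed.

Definition projV_norm : R := Num.sqrt ((2 * C) ^+ d) * C ^+ 2.

Lemma projV_norm_ge0 : 0 <= projV_norm.
Proof. by rewrite mulr_ge0 ?sqrtr_ge0 ?sqr_ge0. Qed.

Lemma Phi_L1 j (m : Z W j) : (J0 <= j)%N ->
  (\int[unif R d]_x `|Phi m x|) * Num.sqrt (2 ^ (j * d))%:R <=
  Num.sqrt ((2 * C) ^+ d).
Proof.
move=> J0j; have [_ _ /(_ m) am _ _] := geom J0j.
by apply: atom_L1 am _ => //; rewrite (Phi_orthonormal W_cdv)// eqxx.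
Qed.

(** A scaling function has height of order sqrt k but L1 norm of order
    1 / sqrt k, and boundedly many of them are nonzero at [x]; this makes the
    projections uniformly bounded in the supremum norm. *)
Lemma sum_Phi_le j (a : Z W j -> R) (A : R) x : (J0 <= j)%N -> 0 <= A ->
  (forall m, Phi m x != 0 -> `|a m| <= A * \int[unif R d]_y `|Phi m y|) ->
  `|\sum_m a m * Phi m x| <= A * projV_norm.
Proof.
move=> J0j A0 aA; have [_ _ am _ /(_ x)[cx _]] := geom J0j.
have s0 := @sqrt_res_gt0 R d j; set s := Num.sqrt _ in s0.
have -> : A * projV_norm = (A * (Num.sqrt ((2 * C) ^+ d) / s)) * (C ^+ 2 * s).
  by rewrite /projV_norm; field; rewrite gt_eqF.
apply: overlap_sum => //.
- by rewrite mulr_ge0// divr_ge0 ?sqrtr_ge0.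
- exact: ltW.
- by move=> m; have [_ _ _ + _] := am m; apply.
- move=> m /aA /le_trans; apply; rewrite ler_wpM2l// ler_pdivlMr//.
  exact: Phi_L1.
Qed.

Lemma projV_bound j f A : (J0 <= j)%N -> bmeas f -> 0 <= A ->
  (forall x, `|f x| <= A) -> forall x, `|projV W j f x| <= A * projV_norm.
Proof.
move=> J0j bf A0 fA x; apply: sum_Phi_le => // m _; apply: inner_norm_le => //.
exact: bmeas_Phi W_cdv _ _ _.
Qed.

Lemma one_in_V j : (0 < S)%N -> (J0 <= j)%N -> exists2 e, V W j e & forall x, cube x -> e x = 1.
Proof.
move=> S0 J0j.
have [|e eV e1] := V_polynomials W_cdv J0j (e := fun=> 0%N); first by rewrite big1.
by exists e => // x /e1 ->; apply: big1 => i _; rewrite expr0.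
Qed.

Lemma proj_kernel_ge0 j x : 0 <= proj_kernel W j x x.
Proof. by apply: sumr_ge0 => m _; rewrite -expr2. Qed.

Lemma proj_kernel_le j x : (J0 <= j)%N ->
  proj_kernel W j x x <= C ^+ 3 * (2 ^ (j * d))%:R.
Proof.
move=> J0j; have [_ _ am _ /(_ x)[cx _]] := geom J0j.
have s0 := @sqrt_res_gt0 R d j.
rewrite -(ger0_norm (proj_kernel_ge0 j x)) -sqrt_natK ?expn_gt0//.
set s := Num.sqrt _ in s0 *.
rewrite (_ : C ^+ 3 * _ = (C * s) * (C ^+ 2 * s)); last by ring.
apply: overlap_sum => //.
- by rewrite mulr_ge0// ltW.
- exact: ltW.
- by move=> m; have [_ _ _ + _] := am m; apply.
- by move=> m _; have [_ _ _ + _] := am m; apply.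
Qed.

(** The value at [x] of the projection of 1 involves the few coefficients of
    1 whose scaling functions do not vanish at [x], and these are small. *)
Lemma proj_kernel_ge j x : (0 < S)%N -> (J0 <= j)%N -> cube x ->
  (2 ^ (j * d))%:R <= C * (2 * C) ^+ d * proj_kernel W j x x.
Proof.
move=> S0 J0j xc; have [e eV e1] := one_in_V S0 J0j.
have [_ _ am _ /(_ x)[cx _]] := geom J0j.
have bP (m : Z W j) : bmeas (Phi m) by exact: bmeas_Phi W_cdv _ _ _.
have oP (m m' : Z W j) : inner (Phi m) (Phi m') = (m == m')%:R.
  exact: (Phi_orthonormal W_cdv).
have be := V_bmeas W_cdv J0j eV.
have ele y : `|e y| <= 1.
  have [/e1 ->|yc] := pselect (cube y); first by rewrite normr1.
  by rewrite (V_cube0 W_cdv J0j eV)// normr0.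
have k0 := @res_gt0 R d j; set k : R := _%:R in k0 *.
have D0 : 0 < (2 * C) ^+ d by rewrite exprn_gt0// mulr_gt0.
set D := (2 * C) ^+ d in D0 *.
have s0 := @sqrt_res_gt0 R d j.
have ca (m : Z W j) : inner e (Phi m) ^+ 2 <= D / k.
  rewrite ler_pdivlMr// -[k]sqr_sqrtr ?(ltW k0)// -exprMn.
  rewrite -[D]sqr_sqrtr ?(ltW D0)// -real_normK ?num_real// lerXn2r ?nnegrE ?sqrtr_ge0//.
  rewrite normrM (ger0_norm (sqrtr_ge0 _)).
  apply: le_trans (Phi_L1 m J0j); rewrite ler_wpM2r ?sqrtr_ge0//.
  by rewrite -[leRHS]mul1r; exact: inner_norm_le.
have := oproj_id bP oP eV => /(congr1 (@^~ x)); rewrite e1// /oproj => sum1.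
pose A : {set Z W j} := [set m : Z W j | Phi m x != 0]%SET.
pose l := k / (C * D).
have l0 : 0 < l by rewrite divr_gt0// mulr_gt0.
have : 2 <= l * (\sum_(m in A) inner e (Phi m) ^+ 2) +
    proj_kernel W j x x / l.
  rewrite /proj_kernel [X in X / l](bigID (mem A))/=.
  rewrite [X in (_ + X) / l]big1 ?addr0; last first.
    by move=> m; rewrite inE negbK => /eqP ->; rewrite mulr0.
  move: sum1; rewrite [X in X = _ -> _](bigID (mem A))/=.
  rewrite [X in _ + X = _ -> _]big1 ?addr0; last first.
    by move=> m; rewrite inE negbK => /eqP ->; rewrite mulr0.
  move=> sum1; rewrite -[X in X <= _]mulr1 -[X in _ * X]sum1 !mulr_sumr mulr_suml -big_split/=.
  (* 2 c u <= l c^2 + u^2 / l term by term, where l balances the two sums. *)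
  apply: ler_sum => m _; rewrite -subr_ge0.
  rewrite (_ : _ - _ = l^-1 * (l * inner e (Phi m) - Phi m x) ^+ 2).
    by rewrite mulr_ge0// invr_ge0 ltW.
  by field; rewrite gt_eqF.
have : \sum_(m in A) inner e (Phi m) ^+ 2 <= C * (D / k).
  apply: (@le_trans _ _ (\sum_(m in A) (D / k))).
    by apply: ler_sum => m _; exact: ca.
  by rewrite sumr_const -mulr_natl ler_wpM2r// divr_ge0// ltW.
rewrite -(ler_pM2l l0) (_ : l * (C * (D / k)) = 1); last first.
  by rewrite /l; field; rewrite !gt_eqF.
have -> : k = C * D * l by rewrite /l; field; rewrite !gt_eqF.
move=> h1 h2; rewrite ler_wpM2l ?mulr_ge0 ?(ltW D0)//.
by rewrite -[l]mul1r -ler_pdivlMr//; lra.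
Qed.

(** Constants are reproduced, and only values of [f] near [x] enter the
    projection at [x]. *)
Lemma projV_approx j f (eta : R) x : (0 < S)%N -> (J0 <= j)%N -> bmeas f ->
  0 <= eta -> cube x ->
  (forall y, cube y -> (forall i, `|tnth y i - tnth x i| <= 2 * C / (2 ^ j)%:R) ->
     `|f y - f x| <= eta) ->
  `|projV W j f x - f x| <= eta * projV_norm.
Proof.
move=> S0 J0j bf eta0 xc osc; have [e eV e1] := one_in_V S0 J0j.
have [_ _ am _ /(_ x)[cx _]] := geom J0j.
have bP (m : Z W j) : bmeas (Phi m) by exact: bmeas_Phi W_cdv _ _ _.
have oP (m m' : Z W j) : inner (Phi m) (Phi m') = (m == m')%:R.
  exact: (Phi_orthonormal W_cdv).
have be := V_bmeas W_cdv J0j eV.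
have := oproj_id bP oP eV => /(congr1 (@^~ x)); rewrite e1// /oproj => sum1.
have -> : projV W j f x - f x =
    \sum_(m : Z W j) inner (fun y => f y - f x * e y) (Phi m) * Phi m x.
  rewrite /projV /oproj -[X in _ - X]mulr1 -{1}sum1 mulr_sumr -sumrB.
  apply: eq_bigr => m _; rewrite innerBl//; last by bm.
  by rewrite innerZl//; ring.
apply: sum_Phi_le => // m mx.
have [_ _ P0 _ [a supp]] := am m.
have -> : inner (fun y => f y - f x * e y) (Phi m) =
    \int[unif R d]_y ((f y - f x * e y) * Phi m y) by [].
apply: le_trans (ex_abs _ _) _; first by bm.
rewrite -exZ; last by bm.
apply: ex_le => [||y]; [by bm|by bm|rewrite normrM].
have [->|my] := eqVneq (Phi m y) 0; first by rewrite normr0 !mulr0.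
rewrite ler_wpM2r//; have yc : cube y by apply: contrapT => /P0; move/eqP: my.
rewrite e1// mulr1; apply: osc => // i.
rewrite (_ : 2 * C / _ = C / (2 ^ j)%:R + C / (2 ^ j)%:R); last by ring.
rewrite (le_trans (ler_distD (tnth a i) _ _))// lerD//; first exact: supp.
by rewrite distrC; exact: supp.
Qed.

End kernel.

(** * Decay of the details of Hoelder functions *)

Section decay.
Context (R : realType) (d : nat).

Definition weight (a : R) (l : nat) : R := 2 `^ (l%:R * (a + d%:R / 2)).

Definition decay (s : R) : R := 2 `^ (- s).

Lemma weight_gt0 a l : 0 < weight a l.
Proof. exact: powR_gt0. Qed.

Lemma decay_gt0 s : 0 < decay s.
Proof. exact: powR_gt0. Qed.

Lemma decay_lt1 s : 0 < s -> decay s < 1.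
Proof.
move=> s0; rewrite /decay powRN invf_lt1 ?powR_gt0//.
rewrite -[X in X < _](congr1 (@^~ s) (powR1 R)).
by apply: gt0_ltr_powR; rewrite ?nnegrE//; lra.
Qed.

Lemma decay_exp s l : decay s ^+ l = 2 `^ (- (l%:R * s)).
Proof. by rewrite /decay -powR_mulrn ?powR_ge0// -powRrM; congr (_ `^ _); ring. Qed.

Lemma res_powR l : (2 ^ (l * d))%:R = 2 `^ (l%:R * d%:R) :> R.
Proof. by rewrite natrX -powR_mulrn// natrM. Qed.

Lemma sqrt_res_weight a l :
  (weight a l)^-1 * Num.sqrt (2 ^ (l * d))%:R = decay a ^+ l.
Proof.
rewrite res_powR -powR12_sqrt ?powR_ge0// -powRrM /weight -powRN -powRD; last first.
  by rewrite pnatr_eq0 implybT.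
by rewrite decay_exp; congr (_ `^ _); field.
Qed.

Lemma res_weight a b l :
  (2 ^ (l * d))%:R * (weight a l)^-1 * (weight b l)^-1 = decay (a + b) ^+ l.
Proof.
rewrite res_powR /weight -!powRN -!powRD ?pnatr_eq0 ?implybT//.
by rewrite decay_exp; congr (_ `^ _); field.
Qed.

Lemma geometric_sum_le (r : R) n : 0 < r < 1 ->
  \sum_(i < n) r ^+ i <= (1 - r)^-1.
Proof.
move=> /andP[r0 r1]; have r1' : 0 < 1 - r by rewrite subr_gt0.
rewrite -(ler_pM2l r1') mulfV ?gt_eqF// -[1 - r]opprB mulNr -subrX1.
by rewrite opprB gerBl exprn_ge0// ltW.
Qed.

Lemma rateE s j : (0 < d)%N ->
  (2 ^ (j * d))%:R `^ (- (s / d%:R)) = decay s ^+ j.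
Proof.
move=> d0; rewrite res_powR -powRrM decay_exp; congr (_ `^ _).
by field; rewrite pnatr_eq0 -lt0n.
Qed.

End decay.

Section tails.
Context (R : realType) (d S J0 : nat) (W : wavelets R d).
Hypothesis W_cdv : cdv_basis W S J0.
Implicit Types f g : d.-tuple R -> R.

Lemma holder_ball_Psi a M h l i (m : Z W l) : (J0 <= l)%N ->
  holder_ball W J0 a M h -> `|inner h (Psi i m)| <= M / weight d a l.
Proof.
move=> J0l [_ hM]; rewrite ler_pdivlMr ?weight_gt0// mulrC -lee_fin.
apply: le_trans hM; rewrite -[leLHS]add0e; apply: leeD.
  rewrite lee_fin mulr_ge0 ?powR_ge0//.
  by apply: (big_ind (fun x => 0 <= x)) => // x y x0 y0; rewrite le_max x0.
by apply: ereal_sup_ubound; exists l, m, i.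
Qed.

Variable C : R.
Hypothesis C_gt0 : 0 < C.
Hypothesis geom : level_bounds J0 W C.

(** There are of order 2^(l d) wavelets of level [l], which turns the product of
    the two coefficient bounds into a geometric sequence. *)
Lemma detail_bound a b Ma Mb f g l : (J0 <= l)%N ->
  0 <= Ma -> 0 <= Mb ->
  (forall i (m : Z W l), `|inner f (Psi i m)| <= Ma / weight d a l) ->
  (forall i (m : Z W l), `|inner g (Psi i m)| <= Mb / weight d b l) ->
  `|detail W l f g| <= #|details d|%:R * C * (Ma * Mb) * decay (a + b) ^+ l.
Proof.
move=> J0l Ma0 Mb0 fM gM; have [_ cZ _ _ _] := geom J0l.
apply: le_trans (ler_norm_sum _ _ _) _.
apply: (@le_trans _ _ (\sum_(z : details d * Z W l)
    (Ma / weight d a l) * (Mb / weight d b l))).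
  by apply: ler_sum => z _; rewrite normrM ler_pM.
rewrite sumr_const -[leLHS]mulr_natl card_prod natrM -(res_weight d a b l).
rewrite [leRHS](_ : _ = #|details d|%:R * (C * (2 ^ (l * d))%:R) *
   (Ma / weight d a l * (Mb / weight d b l))); last by ring.
rewrite ler_wpM2r ?ler_wpM2l//.
by rewrite !mulr_ge0// invr_ge0 powR_ge0.
Qed.

(** The coarse parts converge without a known rate; the rate comes from the
    geometric sum of the details in between. *)
Lemma tail_le f g (A r : R) j : (J0 <= j)%N -> bmeas f -> bmeas g ->
  0 <= A -> 0 < r < 1 ->
  (forall l, (j <= l)%N -> `|detail W l f g| <= A * r ^+ l) ->
  `|inner f g - coarse W j f g| <= A * r ^+ j / (1 - r).
Proof.
move=> J0j bf bg A0 /andP[r0 r1] hA; apply/ler_addgt0Pr => e e0.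
have [j0 J0j0 /(_ (maxn j j0))] := coarse_cvg W_cdv bf bg e0.
rewrite leq_maxr => /(_ isT) he.
have jm : (j <= maxn j j0)%N by rewrite leq_maxl.
have := coarse_telescope W_cdv (maxn j j0 - j) J0j bf bg; rewrite subnKC// => tel.
have r1' : 0 < 1 - r by rewrite subr_gt0.
have : `|coarse W (maxn j j0) f g - coarse W j f g| <= A * r ^+ j / (1 - r).
  rewrite tel addrC addKr; apply: le_trans (ler_norm_sum _ _ _) _.
  apply: (@le_trans _ _ (\sum_(i < maxn j j0 - j) A * r ^+ j * r ^+ i)).
    by apply: ler_sum => i _; rewrite -mulrA -exprD hA// leq_addr.
  rewrite -mulr_sumr ler_wpM2l ?mulr_ge0 ?exprn_ge0 ?(ltW r0)//.
  by rewrite geometric_sum_le// r0.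
have -> : inner f g - coarse W j f g =
  (inner f g - coarse W (maxn j j0) f g) +
  (coarse W (maxn j j0) f g - coarse W j f g) by ring.
by move=> h; rewrite (le_trans (ler_normD _ _))// addrC lerD.
Qed.

(** Details of one sign cannot cancel, so the first of them survives. *)
Lemma tail_ge f g j : (J0 <= j)%N -> bmeas f -> bmeas g ->
  (forall l, (j <= l)%N -> 0 <= detail W l f g) ->
  detail W j f g <= inner f g - coarse W j f g.
Proof.
move=> J0j bf bg pos; rewrite -lerN2; apply/ler_addgt0Pr => e e0.
have [j0 J0j0 /(_ (maxn j.+1 j0))] := coarse_cvg W_cdv bf bg e0.
rewrite leq_maxr => /(_ isT); set m := maxn _ _ => he.
have jm : (j < m)%N by rewrite leq_maxl.
have := coarse_telescope W_cdv (m - j) J0j bf bg; rewrite subnKC ?(ltnW jm)//.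
have -> : (m - j = (m - j.+1).+1)%N by rewrite -subSn// subSS.
rewrite big_ord_recl addn0 => tel.
have : 0 <= \sum_(i < m - j.+1) detail W (j + bump 0 i) f g.
  by apply: sumr_ge0 => i _; rewrite pos// leq_addr.
by move: he; rewrite ler_norml tel => /andP[]; lra.
Qed.

End tails.

(** * Conditional expectations given the covariate *)

Section conditional_expectation.
Context (R : realType) (d : nat).
Variable P : probability (d.-tuple R * R * R)%type R.
Implicit Types (U V : obs R d -> R) (g h : d.-tuple R -> R).

Lemma measurable_covX : measurable_fun [set: d.-tuple R * R * R] (@covX R d).
Proof. exact: measurableT_comp measurable_fst measurable_fst. Qed.

Lemma measurable_varA : measurable_fun [set: d.-tuple R * R * R] (@varA R d).
Proof. exact: measurableT_comp measurable_snd measurable_fst. Qed.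

Lemma measurable_varY : measurable_fun [set: d.-tuple R * R * R] (@varY R d).
Proof. exact: measurable_snd. Qed.

Lemma measurable_covX_preimage (B : set (d.-tuple R)) : measurable B ->
  measurable (@covX R d @^-1` B : set (d.-tuple R * R * R)).
Proof. by move=> mB; rewrite -[X in measurable X]setTI; exact: measurable_covX. Qed.

Lemma is_condexp_ae U V g : {ae P, forall o, U o = V o} ->
  measurable_fun setT U -> measurable_fun setT V ->
  is_condexp P U g -> is_condexp P V g.
Proof.
move=> UV mU mV [mg ig gU]; split=> // B mB; rewrite gU//.
apply: ae_eq_integral.
- exact: measurable_covX_preimage.
- by apply/measurable_EFinP; exact: measurable_funTS.
- by apply/measurable_EFinP; exact: measurable_funTS.
- by apply: filterS UV => o /= -> .
Qed.

(** On the set of covariates where the bound fails, the defining identity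
    equates the integral of a positive function with a nonpositive number. The
    sign [e] gives bounds from above as well. *)
Lemma condexp_ge U g (e c : R) : bmeas U -> (forall o, c <= e * U o) ->
  is_condexp P U g -> {ae P, forall o, c <= e * g (covX o)}.
Proof.
move=> bU cU [mg ig gU]; pose D := [set x | e * g x < c].
have mD : measurable D.
  rewrite (_ : D = (fun x => e * g x) @^-1` `]-oo, c[%classic).
    rewrite -[X in measurable X]setTI.
    by apply: measurable_funM => //; exact: measurable_cst.
  by apply/seteqP; split => x /=; rewrite in_itv.
pose N : set (d.-tuple R * R * R) := @covX R d @^-1` D.
have mN : measurable N by exact: measurable_covX_preimage.
have iN f : P.-integrable setT (EFin \o f) -> P.-integrable N (EFin \o f).
  exact: integrableS.
have iU : P.-integrable N (EFin \o U) by apply/iN/bmeas_integrable.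
have ic : P.-integrable N (EFin \o cst c) by apply/iN/bmeas_integrable/bmeas_cst.
have ieg : P.-integrable N (EFin \o (fun o => e * g (covX o))).
  exact: (integrableZl mN e (iN _ ig)).
have ieU : P.-integrable N (EFin \o (fun o => e * U o)).
  by apply/iN/bmeas_integrable; bm.
have ifg : P.-integrable N (EFin \o (fun o => c - e * g (covX o))).
  exact: (integrableB mN ic ieg).
have le0 : \int[P]_(o in N) (c - e * g (covX o)) <= 0.
  rewrite (RintegralB mN ic ieg) (RintegralZl e mN (iN _ ig)).
  have -> : \int[P]_(o in N) g (covX o) = \int[P]_(o in N) U o.
    by congr fine; exact: gU.
  by rewrite -(RintegralZl e mN iU) subr_le0; exact: le_Rintegral.
have /ae_eq_integral_abs h : measurable_fun N (fun o => (c - e * g (covX o))%:E).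
  by have := measurable_int _ ifg.
have [M [mM PM NM]] : ae_eq P N (fun o => (c - e * g (covX o))%:E) (cst 0).
  apply/h => //; rewrite (eq_integral (fun o => (c - e * g (covX o))%:E)).
    apply/eqP; rewrite eq_le integral_ge0 ?andbT.
      have fin : (\int[P]_(o in N) (c - e * g (covX o))%:E \is a fin_num)%E.
        exact: integrable_fin_num.
      by rewrite -(fineK fin) lee_fin.
    by move=> o; rewrite /N/= /D/= lee_fin subr_ge0 => /ltW.
  move=> o; rewrite inE /N/= /D/= => /ltW h1.
  by rewrite /= ger0_norm// subr_ge0.
exists M; split=> // o /= /negP; rewrite -ltNge => oD; apply: NM => /= /(_ oD).
by move=> [] /eqP; rewrite subr_eq0 => /eqP ce; move: oD; rewrite -ce ltxx.
Qed.

(** The density of the measure with density [V], pushed to the covariate, with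
    respect to the law of the covariate. *)
Lemma is_condexp_exists V : bmeas V -> exists h, is_condexp P V h.
Proof.
move=> bV; have iV := bmeas_integrable P bV.
pose X : {mfun (d.-tuple R * R * R)%type >-> d.-tuple R} :=
  HB.pack (@covX R d) (@isMeasurableFun.Build _ _ _ _ _ measurable_covX).
pose nu := induced_charge iV.
pose mu : probability (d.-tuple R) R := distribution P X.
have dom : pushforward nu X `<< mu.
  apply: dominates_pushforward; first exact: measurable_covX.
  apply/null_content_dominatesP => A mA PA; rewrite /nu /induced_charge.
  apply: null_set_integral => //.
  by apply: measurable_funTS; have := measurable_int _ iV.
have [f [ffin fint fE]] : exists f : d.-tuple R -> \bar R,
    [/\ forall x, f x \is a fin_num, mu.-integrable setT f &
     forall A, measurable A -> pushforward nu X A = (\int[mu]_(x in A) f x)%E].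
  exact: (ex_intro _ _ (And3 (fun x => Radon_Nikodym_fin_num x dom)
    (Radon_Nikodym_integrable dom) (fun A mA => Radon_Nikodym_integral dom mA))).
have mf := measurable_int _ fint.
have EfE : EFin \o (fun x => fine (f x)) = f.
  by apply/funext => x /=; rewrite fineK.
have ifX : P.-integrable setT (f \o @covX R d).
  apply/integrableP; split.
    exact: measurableT_comp mf measurable_covX.
  move/integrableP : fint => [_]; rewrite ge0_integral_pushforward//.
  exact: measurableT_comp mf.
exists (fun x => fine (f x)); split.
- by apply/measurable_EFinP; rewrite EfE.
- by move: ifX; rewrite -EfE.
- move=> B mB; transitivity (\int[mu]_(x in B) f x)%E; last first.
    by rewrite -fE.
  rewrite [RHS]integral_pushforward//.
    by apply: eq_integral => o _ /=; rewrite fineK.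
  by apply: integrableS ifX => //; exact: measurable_covX_preimage.
Qed.

End conditional_expectation.

(** * The model in terms of bounded variables *)

Section clip.
Context (R : realType) (lo hi : R).
Hypothesis lohi : lo <= hi.

Definition clip (t : R) : R := Num.max lo (Num.min t hi).

Lemma clip_itv t : lo <= clip t <= hi.
Proof. by rewrite /clip le_max lexx/= ge_max lohi ge_min lexx orbT. Qed.

Lemma clip_id t : lo <= t <= hi -> clip t = t.
Proof.
by move=> /andP[lt th]; rewrite /clip (min_idPl th) (max_idPr lt).
Qed.

Lemma clip_norm t : `|clip t| <= Num.max `|lo| `|hi|.
Proof.
have /andP[h1 h2] := clip_itv t; rewrite le_max !ler_norml.
have := ler_norm hi; have := ler_norm (- lo); rewrite normrN => l1 l2.
have [c0|c0] := leP 0 (clip t); apply/orP; [right|left]; apply/andP; split; lra.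
Qed.

Lemma measurable_clip : measurable_fun setT clip.
Proof.
apply: measurable_maxr; first exact: measurable_cst.
by apply: measurable_minr; [exact: measurable_id|exact: measurable_cst].
Qed.

Lemma bmeas_clip d (T : measurableType d) (f : T -> R) :
  measurable_fun setT f -> bmeas (fun x => clip (f x)).
Proof.
move=> mf; split; first exact: measurableT_comp measurable_clip mf.
by exists (Num.max `|lo| `|hi|) => x; exact: clip_norm.
Qed.

End clip.

Lemma measurable_set_ltr d (T : measurableType d) (R : realType)
    (f g : T -> R) : measurable_fun setT f -> measurable_fun setT g ->
  measurable [set x | f x < g x].
Proof.
move=> mf mg; rewrite (_ : [set x | _] = (fun x => g x - f x) @^-1` `]0, +oo[%classic).
  by rewrite -[X in measurable X]setTI; apply: measurable_funB.
by apply/seteqP; split => x /=; rewrite in_itv/= andbT subr_gt0.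
Qed.

Lemma ex_indic d (T : measurableType d) (R : realType) (P : probability T R)
    (A : set T) : measurable A -> \int[P]_x (\1_A x : R) = fine (P A).
Proof. by move=> mA; rewrite /Rintegral integral_indic// setIT. Qed.

Section versions.
Context (R : realType) (d : nat).
Variable P : probability (d.-tuple R * R * R)%type R.
Implicit Types (U V : obs R d -> R) (g h : d.-tuple R -> R).

Lemma bmeas_covX g : bmeas g -> bmeas (fun o : d.-tuple R * R * R => g (covX o)).
Proof. by move=> bg; apply: (bmeas_comp bg); exact: measurable_covX. Qed.

(** For the indicator of a set this is the definition of a version, and a
    bounded [phi] is an average of indicators of its upper level sets. *)
Lemma condexp_regression U g phi : bmeas U -> bmeas g -> is_condexp P U g ->
  bmeas phi ->
  \int[P]_o (U o * phi (covX o)) = \int[P]_o (g (covX o) * phi (covX o)).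
Proof.
move=> bU bg [_ _ gU] [mphi [c0 phic0]].
have [c [c_gt0 phic]] : exists c, 0 < c /\ forall x, `|phi x| <= c.
  exists (`|c0| + 1); split; first by rewrite ltr_wpDl.
  by move=> x; rewrite (le_trans (phic0 x))// (le_trans (ler_norm _))// lerDl.
have bphi : bmeas phi by split=> //; exists c.
pose h o := U o - g (covX o); have bgX := bmeas_covX bg.
have bh : bmeas h by rewrite /h; bm.
have h1 B : measurable B -> \int[P]_o (h o * \1_B (covX o)) = 0.
  move=> mB; have mXB := measurable_covX_preimage mB.
  have bB : bmeas (fun o : d.-tuple R * R * R => \1_B (covX o) : R).
    by apply: bmeas_covX; exact: bmeas_indic.
  under eq_Rintegral do rewrite /h mulrBl.
  rewrite exB; [|bm..]; apply/eqP; rewrite subr_eq0; apply/eqP.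
  have E f : \int[P]_o (f o * \1_B (covX o)) = \int[P]_(o in @covX R d @^-1` B) f o.
    rewrite [RHS]Rintegral_mkcond; apply: ex_eq => o; rewrite patchE indicE.
    by rewrite (_ : (o \in _) = (covX o \in B)) ?in_setE//; case: ifP => _; rewrite ?mulr1 ?mulr0.
  by rewrite !E; congr fine; rewrite gU.
pose psi x := (phi x + c) / (2 * c).
have bpsi : bmeas psi by rewrite /psi; bm.
have psi01 x : 0 <= psi x <= 1.
  have := phic x; rewrite ler_norml => /andP[l u].
  by rewrite /psi divr_ge0 ?ler_pdivrMr ?mulr_gt0//=; lra.
have mpsi : measurable [set z : (d.-tuple R * R * R) * R | z.2 < psi (covX z.1)].
  apply: measurable_set_ltr; first exact: measurable_snd.
  exact: (measurableT_comp (proj1 (bmeas_covX bpsi)) measurable_fst).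
pose L := [set z : (d.-tuple R * R * R) * R | z.2 < psi (covX z.1)].
have hpsi : \int[P]_o (h o * psi (covX o)) = 0.
  transitivity (\int[P]_o \int[unif01 R]_u (h o * \1_L (o, u))).
    apply: ex_eq => o; rewrite exZ; last first.
      by apply: (bmeas_comp (bmeas_indic R mpsi)); exact: measurable_pair1.
    congr (_ * _); rewrite -[LHS](unif01_lt (psi01 (covX o))).
    have mlt : measurable [set u : R | u < psi (covX o)].
      apply: measurable_set_ltr; first exact: measurable_id.
      exact: measurable_cst.
    rewrite -(ex_indic (unif01 R) mlt).
    by apply: ex_eq => u; rewrite !indicE.
  rewrite (ex_prod_swap P (unif01 R) (f := fun z => h z.1 * \1_L z)); last first.
    apply: bmeasM; last exact: bmeas_indic.
    exact: (bmeas_comp bh measurable_fst).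
  transitivity (\int[unif01 R]_u (0 : R)); last exact: ex_cst.
  apply: ex_eq => u; rewrite -[RHS](h1 [set x | u < psi x]).
    by apply: ex_eq => o; rewrite !indicE.
  by apply: measurable_set_ltr; [exact: measurable_cst|case: bpsi].
have -> : \int[P]_o (U o * phi (covX o)) =
    \int[P]_o (2 * c * (h o * psi (covX o)) + (g (covX o) * phi (covX o) - c * h o)).
  apply: ex_eq => o; rewrite /h /psi; field.
  by rewrite gt_eqF.
have bphiX := bmeas_covX bphi; have bpsiX := bmeas_covX bpsi.
rewrite exD; [|bm..]; rewrite exZ; [|bm]; rewrite exB; [|bm..]; rewrite exZ; [|bm].
have -> : \int[P]_o h o = 0.
  rewrite -[RHS](h1 setT)//; apply: ex_eq => o.
  by rewrite indicE in_setT mulr1.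
by rewrite hpsi !mulr0 add0r subr0.
Qed.

Lemma is_condexp_clip U g lo hi : lo <= hi -> bmeas U ->
  (forall o, lo <= U o <= hi) -> is_condexp P U g ->
  {ae P, forall o, g (covX o) = clip lo hi (g (covX o))} /\
  is_condexp P U (fun x => clip lo hi (g x)).
Proof.
move=> lohi bU Uitv cg.
have ae1 : {ae P, forall o, lo <= 1 * g (covX o)}.
  by apply: condexp_ge cg => // o; rewrite mul1r; case/andP: (Uitv o).
have ae2 : {ae P, forall o, - hi <= - 1 * g (covX o)}.
  by apply: condexp_ge cg => // o; rewrite mulN1r lerN2; case/andP: (Uitv o).
have ae3 : {ae P, forall o, g (covX o) = clip lo hi (g (covX o))}.
  apply: filterS2 ae1 ae2 => o; rewrite mul1r mulN1r lerN2 => h1 h2.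
  by rewrite clip_id// h1 h2.
split=> //; case: cg => mg ig gU.
have bc : bmeas (fun x => clip lo hi (g x)) by exact: bmeas_clip.
split; first by case: bc.
  by apply: bmeas_integrable; exact: bmeas_covX.
move=> B mB; rewrite -gU//; apply: ae_eq_integral.
- exact: measurable_covX_preimage.
- by apply/measurable_EFinP/measurable_funTS; case: (bmeas_covX bc).
- apply/measurable_EFinP/measurable_funTS.
  exact: (measurableT_comp mg (@measurable_covX R d)).
- by apply: filterS ae3 => o /= <-.
Qed.

Hypothesis X_unif : forall B, measurable B -> P (@covX R d @^-1` B) = unif R d B.

Lemma ex_covX phi : bmeas phi ->
  \int[P]_o phi (covX o) = \int[unif R d]_x phi x.
Proof.
move=> bphi.
pose X : {mfun (d.-tuple R * R * R)%type >-> d.-tuple R} :=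
  HB.pack (@covX R d) (@isMeasurableFun.Build _ _ _ _ _ (@measurable_covX R d)).
rewrite -(ex_distribution P X bphi); congr fine.
by apply: eq_measure_integral => A mA _; exact: X_unif.
Qed.

Lemma ae_covX (g h : d.-tuple R -> R) : measurable_fun setT g -> measurable_fun setT h ->
  {ae P, forall o, g (covX o) = h (covX o)} -> {ae unif R d, forall x, g x = h x}.
Proof.
move=> mg mh [N [mN PN gN]]; pose D := [set x | g x <> h x].
have mD : measurable D.
  rewrite (_ : D = [set x | g x < h x] `|` [set x | h x < g x]).
    by apply: measurableU; exact: measurable_set_ltr.
  apply/seteqP; split=> x /=; first by move=> /eqP; rewrite neq_lt => /orP.
  by move=> gh; apply/eqP; rewrite neq_lt; apply/orP.
exists D; split=> //; rewrite -[LHS]X_unif//.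
apply/eqP; rewrite eq_le measure_ge0 andbT -PN le_measure ?inE//.
exact: measurable_covX_preimage.
Qed.

End versions.

Section regression_model.
Context (R : realType) (d : nat).
Variable P : probability (d.-tuple R * R * R)%type R.

(** What the moments of the estimators depend on: bounded versions [a], [y] of
    the responses and [p], [b] of their regression functions. *)
Record regression_model (a y : obs R d -> R) (p b : d.-tuple R -> R) (B : R)
  : Prop := RegressionModel {
  rm_law : forall phi, bmeas phi ->
    \int[P]_o phi (covX o) = \int[unif R d]_x phi x;
  rm_ma : bmeas a;
  rm_my : bmeas y;
  rm_mp : bmeas p;
  rm_mb : bmeas b;
  rm_a : forall o, `|a o| <= B;
  rm_y : forall o, `|y o| <= B;
  rm_p : forall x, `|p x| <= B;
  rm_b : forall x, `|b x| <= B;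
  rm_ap : forall phi, bmeas phi ->
    \int[P]_o (a o * phi (covX o)) = inner p phi;
  rm_yb : forall phi, bmeas phi ->
    \int[P]_o (y o * phi (covX o)) = inner b phi }.

Variables lo hi : R.
Hypothesis lohi : lo <= hi.

(** The responses are bounded only almost surely; clipping bounds them
    everywhere and changes no moment. *)
Definition clipA (o : obs R d) : R := clip lo hi (varA o).
Definition clipY (o : obs R d) : R := clip lo hi (varY o).

Let bclip (U : obs R d -> R) : measurable_fun [set: d.-tuple R * R * R] U ->
  bmeas (fun o : d.-tuple R * R * R => clip lo hi (U o)).
Proof. exact: bmeas_clip. Qed.

Hypothesis X_unif : forall B, measurable B -> P (@covX R d @^-1` B) = unif R d B.
Hypothesis range : {ae P, forall o, lo <= varA o <= hi /\ lo <= varY o <= hi}.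

Lemma clipA_ae : {ae P, forall o, varA o = clipA o}.
Proof. by apply: filterS range => o [h _]; rewrite /clipA clip_id. Qed.

Lemma clipY_ae : {ae P, forall o, varY o = clipY o}.
Proof. by apply: filterS range => o [_ h]; rewrite /clipY clip_id. Qed.

Let ba : bmeas (clipA : d.-tuple R * R * R -> R).
Proof. by apply: bclip; exact: measurable_varA. Qed.

Let bY : bmeas (clipY : d.-tuple R * R * R -> R).
Proof. by apply: bclip; exact: measurable_varY. Qed.

Section versions.
Variables (p b : d.-tuple R -> R).
Hypotheses (cp : is_condexp P (@varA R d) p) (cb : is_condexp P (@varY R d) b).

Let cpa : is_condexp P clipA p.
Proof.
by apply: is_condexp_ae cp; [exact: clipA_ae|exact: measurable_varA|case: ba].
Qed.

Let cby : is_condexp P clipY b.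
Proof.
by apply: is_condexp_ae cb; [exact: clipY_ae|exact: measurable_varY|case: bY].
Qed.

Let aitv o : lo <= clipA o <= hi. Proof. exact: clip_itv. Qed.
Let yitv o : lo <= clipY o <= hi. Proof. exact: clip_itv. Qed.

Definition clip_fun (g : d.-tuple R -> R) x := clip lo hi (g x).

Let cpc : is_condexp P clipA (clip_fun p).
Proof. by have [_] := is_condexp_clip lohi ba aitv cpa. Qed.

Let cbc : is_condexp P clipY (clip_fun b).
Proof. by have [_] := is_condexp_clip lohi bY yitv cby. Qed.

Let bp : bmeas (clip_fun p). Proof. by apply: bmeas_clip => //; case: cp. Qed.
Let bb : bmeas (clip_fun b). Proof. by apply: bmeas_clip => //; case: cb. Qed.

Lemma clip_regression_model :
  regression_model clipA clipY (clip_fun p) (clip_fun b) (Num.max `|lo| `|hi|).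
Proof.
split=> //; try by move=> ?; exact: clip_norm.
- exact: ex_covX.
- move=> phi bphi; rewrite (condexp_regression ba bp cpc bphi).
  by apply: (ex_covX X_unif); bm.
- move=> phi bphi; rewrite (condexp_regression bY bb cbc bphi).
  by apply: (ex_covX X_unif); bm.
Qed.

Lemma inner_clip_p f : bmeas f -> inner p f = inner (clip_fun p) f.
Proof.
move=> bf; have [mp _ _] := cp; have [ae _] := is_condexp_clip lohi ba aitv cpa.
have := ae_covX X_unif mp (proj1 bp) ae => pae.
apply: ex_ae.
- by apply: filterS pae => x /= ->.
- by apply: measurable_funM => //; case: bf.
- by apply: measurable_funM; [case: bp|case: bf].
Qed.

Lemma inner_clip_b f : bmeas f -> inner b f = inner (clip_fun b) f.
Proof.
move=> bf; have [mb _ _] := cb; have [ae _] := is_condexp_clip lohi bY yitv cby.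
have := ae_covX X_unif mb (proj1 bb) ae => bae.
apply: ex_ae.
- by apply: filterS bae => x /= ->.
- by apply: measurable_funM => //; case: bf.
- by apply: measurable_funM; [case: bb|case: bf].
Qed.

End versions.

(** The versions that define the functional enter only through moments that
    all versions share. *)
Lemma psi_moments (p b : d.-tuple R -> R) :
  is_condexp P (@varA R d) p -> is_condexp P (@varY R d) b ->
  psi P = \int[P]_o (clipA o * clipY o) - inner (clip_fun p) (clip_fun b).
Proof.
move=> cp cb.
pose gA := condexp P (@varA R d); pose gY := condexp P (@varY R d).
have cgA : is_condexp P (@varA R d) gA.
  by apply: (@xgetPex _ (fun=> 0) [set g | is_condexp P (@varA R d) g]); exists p.
have cgY : is_condexp P (@varY R d) gY.
  by apply: (@xgetPex _ (fun=> 0) [set g | is_condexp P (@varY R d) g]); exists b.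
have ca g : is_condexp P (@varA R d) g -> is_condexp P clipA g.
  by apply: is_condexp_ae; [exact: clipA_ae|exact: measurable_varA|case: ba].
have cy g : is_condexp P (@varY R d) g -> is_condexp P clipY g.
  by apply: is_condexp_ae; [exact: clipY_ae|exact: measurable_varY|case: bY].
have aitv o : lo <= clipA o <= hi by exact: clip_itv.
have yitv o : lo <= clipY o <= hi by exact: clip_itv.
have [aeA cA] := is_condexp_clip lohi ba aitv (ca _ cgA).
have [aeY cY] := is_condexp_clip lohi bY yitv (cy _ cgY).
pose ga := clip_fun gA; pose gy := clip_fun gY.
have bga : bmeas ga by apply: bmeas_clip => //; case: cgA.
have bgy : bmeas gy by apply: bmeas_clip => //; case: cgY.
have bgaX := bmeas_covX bga; have bgyX := bmeas_covX bgy.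
pose U o := (varA o - gA (covX o)) * (varY o - gY (covX o)).
pose V o := (clipA o - ga (covX o)) * (clipY o - gy (covX o)).
have bV : bmeas (V : d.-tuple R * R * R -> R) by rewrite /V; bm.
have mU : measurable_fun [set: d.-tuple R * R * R] U.
  apply: measurable_funM; apply: measurable_funB.
  - exact: measurable_varA.
  - by apply: (measurableT_comp _ (@measurable_covX R d)); case: cgA.
  - exact: measurable_varY.
  - by apply: (measurableT_comp _ (@measurable_covX R d)); case: cgY.
have UV : {ae P, forall o, U o = V o}.
  have e12 : {ae P, forall o, varA o = clipA o /\ varY o = clipY o}.
    by apply: filterS2 clipA_ae clipY_ae => o e1 e2; split.
  have e34 : {ae P, forall o, gA (covX o) = ga (covX o) /\ gY (covX o) = gy (covX o)}.
    by apply: filterS2 aeA aeY => o e1 e2; split.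
  by apply: filterS2 e12 e34 => o [e1 e2] [e3 e4]; rewrite /U /V e1 e2 e3 e4.
have cU : is_condexp P U (condcov P (@varA R d) (@varY R d)).
  apply: (@xgetPex _ (fun=> 0) [set g | is_condexp P U g]).
  have [h hV] := is_condexp_exists P bV; exists h.
  apply: is_condexp_ae hV => //; last by case: bV.
  by apply: filterS UV => o ->.
have -> : psi P = \int[P]_o V o.
  rewrite /psi unlock; congr fine.
  have [_ _ /(_ setT measurableT)] := cU; rewrite preimage_setT => ->.
  apply: ae_eq_integral => //.
  - exact/measurable_EFinP.
  - by apply/measurable_EFinP; case: bV.
  - by apply: filterS UV => o /= -> .
have bpc : bmeas (clip_fun p) by apply: bmeas_clip => //; case: cp.
have bbc : bmeas (clip_fun b) by apply: bmeas_clip => //; case: cb.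
have [_ cpc] := is_condexp_clip lohi ba aitv (ca _ cp).
have [_ cbc] := is_condexp_clip lohi bY yitv (cy _ cb).
have bayY : bmeas (fun o : d.-tuple R * R * R => clipA o * clipY o) by bm.
have -> : inner (clip_fun p) (clip_fun b) = \int[P]_o (ga (covX o) * gy (covX o)).
  rewrite -(condexp_regression ba bga cA)// (condexp_regression ba bpc cpc)//.
  under [RHS]ex_eq do rewrite mulrC.
  rewrite -(condexp_regression bY bgy cY)// (condexp_regression bY bbc cbc)//.
  under [RHS]ex_eq do rewrite mulrC.
  by rewrite (ex_covX X_unif (phi := fun x => clip_fun p x * clip_fun b x))//; bm.
transitivity (\int[P]_o (clipA o * clipY o - clipA o * gy (covX o) -
    (clipY o * ga (covX o) - ga (covX o) * gy (covX o)))).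
  by apply: ex_eq => o; rewrite /V; ring.
rewrite exB; [|bm..]; rewrite exB; [|bm..]; rewrite exB; [|bm..].
rewrite (condexp_regression ba bga cA)// (condexp_regression bY bgy cY)//.
by under [X in _ - (X - _)]ex_eq do rewrite mulrC; rewrite subrr subr0.
Qed.

End regression_model.

(** * Moments of the series estimators *)

Section series_estimator.
Context (R : realType) (d S J0 : nat) (W : wavelets R d).
Hypothesis W_cdv : cdv_basis W S J0.
Local Notation T0 := (d.-tuple R * R * R)%type.
Variables (P : probability T0 R) (a : T0 -> R) (p : d.-tuple R -> R) (B : R).
Hypothesis law : forall phi, bmeas phi ->
  \int[P]_o phi (covX o) = \int[unif R d]_x phi x.
Hypotheses (ba : bmeas a) (bp : bmeas p).
Hypotheses (aB : forall o, `|a o| <= B) (pB : forall x, `|p x| <= B).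
Hypothesis ap : forall phi, bmeas phi ->
  \int[P]_o (a o * phi (covX o)) = inner p phi.
Variables (n j : nat).
Hypotheses (n0 : (0 < n)%N) (J0j : (J0 <= j)%N).

Let B0 : 0 <= B. Proof. exact: le_trans (aB point). Qed.

Let bPhi (m : Z W j) : bmeas (Phi m).
Proof. exact: bmeas_Phi W_cdv _ _ _. Qed.
Hint Resolve bPhi : core.

Let oPhi (m m' : Z W j) : inner (Phi m) (Phi m') = (m == m')%:R.
Proof. exact: (Phi_orthonormal W_cdv). Qed.

Let ahat (D : n.-tuple T0) (x : d.-tuple R) : R := series_estimator W a j D x.

Lemma bmeas_proj_kernel d' (T : measurableType d') (x y : T -> d.-tuple R) :
  measurable_fun setT x -> measurable_fun setT y ->
  bmeas (fun t => proj_kernel W j (x t) (y t)).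
Proof.
move=> mx my; apply: bmeas_sum => m.
by apply: bmeasM; exact: (bmeas_comp (bPhi m)).
Qed.

Lemma bmeas_sample_mean d' (T : measurableType d') (D : T -> n.-tuple T0)
    (f : T -> T0 -> R) :
  measurable_fun setT D -> bmeas (fun z : T * T0 => f z.1 z.2) ->
  bmeas (fun t => sample_mean (D t) (f t)).
Proof.
move=> mD bf; apply: bmeasM; first exact: bmeas_cst.
apply: bmeas_sum => i; apply: (bmeas_comp bf (g := fun t => (t, tnth (D t) i))).
apply/measurable_fun_pairP; split; first exact: measurable_id.
exact: (measurableT_comp (measurable_tnth i) mD).
Qed.

Lemma bmeas_series_estimator d' (T : measurableType d') (D : T -> n.-tuple T0)
    (x : T -> d.-tuple R) :
  measurable_fun setT D -> measurable_fun setT x ->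
  bmeas (fun t => ahat (D t) (x t)).
Proof.
move=> mD mx; apply: (@bmeas_sample_mean _ _ _ (fun t o => a o * proj_kernel W j (covX o) (x t))) => //.
apply: bmeasM; first exact: (bmeas_comp ba measurable_snd).
apply: bmeas_proj_kernel.
  exact: (measurableT_comp (@measurable_covX R d) measurable_snd).
exact: (measurableT_comp mx measurable_fst).
Qed.

Lemma inner_series_estimator (D : n.-tuple T0) f : bmeas f ->
  inner (ahat D) f = sample_mean D (fun o => a o * projV W j f (covX o)).
Proof.
move=> bf; rewrite /ahat /series_estimator /sample_mean.
have bK o : bmeas (fun x => proj_kernel W j o x).
  by apply: bmeas_proj_kernel; [exact: measurable_cst|exact: measurable_id].
rewrite innerZl//; last by bm.
rewrite inner_suml//; last by move=> i; bm.
congr (_ * _); apply: eq_bigr => i _; rewrite innerZl//; congr (_ * _).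
rewrite /proj_kernel inner_suml//; last by move=> m; bm.
by apply: eq_bigr => m _; rewrite innerZl// mulrC innerC.
Qed.

Lemma bmeas_inner_estimator d' (T : measurableType d') (D : T -> n.-tuple T0)
    f : measurable_fun setT D -> bmeas f -> bmeas (fun t => inner (ahat (D t)) f).
Proof.
move=> mD bf; under eq_fun do rewrite inner_series_estimator//.
apply: (@bmeas_sample_mean _ _ _ (fun _ o => a o * projV W j f (covX o))) => //.
apply: (bmeas_comp _ measurable_snd (f := fun o => a o * projV W j f (covX o))).
by apply: bmeasM => //; apply: bmeas_covX; exact: bmeas_projV W_cdv _ _ _.
Qed.

Lemma ex_sample_mean (f : T0 -> R) : bmeas f ->
  \int[prob_pow P n]_D sample_mean D f = \int[P]_o f o.
Proof.
move=> bf; rewrite exZ; last first.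
  by apply: bmeas_sum => i; exact: bmeas_tnth.
by rewrite ex_sample_sum// mulrA mulVf ?mul1r// pnatr_eq0 -lt0n.
Qed.

Lemma ex_sqr_regression f : bmeas f ->
  \int[P]_o ((a o * f (covX o)) ^+ 2) <= B ^+ 2 * inner f f.
Proof.
move=> bf; have bfX := bmeas_covX bf.
apply: (@le_trans _ _ (\int[P]_o (B ^+ 2 * (f (covX o) * f (covX o))))).
  apply: ex_le; [by bm|by bm|move=> o].
  rewrite exprMn -[X in _ <= _ * X]expr2 ler_wpM2r ?sqr_ge0//.
  by rewrite -real_normK ?num_real// lerXn2r ?nnegrE.
rewrite exZ; last by bm.
by rewrite (law (phi := fun x => f x * f x)); [|bm].
Qed.

(** A linear functional of the estimator is the mean of a sample. *)
Lemma ex_inner_sqr f (c : R) : bmeas f ->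
  \int[prob_pow P n]_D (inner (ahat D) f - c) ^+ 2 <=
  n%:R^-1 * (B ^+ 2 * inner (projV W j f) (projV W j f)) +
  (inner (projV W j p) f - c) ^+ 2.
Proof.
move=> bf; have bpf := bmeas_projV W_cdv f J0j.
under ex_eq => D do rewrite inner_series_estimator//.
have bg : bmeas (fun o : T0 => a o * projV W j f (covX o)).
  by apply: bmeasM => //; exact: bmeas_covX.
rewrite [leLHS](ex_sample_mean_sqr P bg)// (ap bpf).
have -> : inner p (projV W j f) = inner (projV W j p) f by rewrite -inner_projC.
rewrite lerD2r ler_wpM2l ?invr_ge0// lerBlDr.
by apply: le_trans (ex_sqr_regression bpf) _; rewrite lerDl sqr_ge0.
Qed.

Lemma ex_inner f : bmeas f ->
  \int[prob_pow P n]_D inner (ahat D) f = inner (projV W j p) f.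
Proof.
move=> bf; have bpf := bmeas_projV W_cdv f J0j.
under ex_eq => D do rewrite inner_series_estimator//.
rewrite ex_sample_mean; last by apply: bmeasM => //; exact: bmeas_covX.
by rewrite ap// /projV -inner_projC.
Qed.

Let bK x : bmeas (fun y => proj_kernel W j y x).
Proof. by apply: bmeas_proj_kernel; [exact: measurable_id|exact: measurable_cst]. Qed.

Lemma inner_kernel f x : bmeas f ->
  inner f (fun y => proj_kernel W j y x) = projV W j f x.
Proof.
move=> bf; rewrite innerC inner_suml//; last by move=> m; bm.
apply: eq_bigr => m _; rewrite -innerC; under [LHS]ex_eq do rewrite mulrA mulrC.
by rewrite exZ; [rewrite mulrC|bm].
Qed.

Lemma kernel_sqr x :
  inner (fun y => proj_kernel W j y x) (fun y => proj_kernel W j y x) =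
  proj_kernel W j x x.
Proof.
rewrite inner_kernel// /projV /oproj.
apply: eq_bigr => m _; congr (_ * _); rewrite innerC inner_kernel//.
by rewrite /projV oproj_id//; exact: Phi_in_V.
Qed.

Lemma ex_pointwise_sqr (t : R) x :
  \int[prob_pow P n]_D (t - ahat D x) ^+ 2 =
  n%:R^-1 * (\int[P]_o (a o * proj_kernel W j (covX o) x) ^+ 2 -
             projV W j p x ^+ 2) + (projV W j p x - t) ^+ 2.
Proof.
have bg : bmeas (fun o : T0 => a o * proj_kernel W j (covX o) x).
  by apply: bmeasM => //; exact: (bmeas_covX (bK x)).
under ex_eq => D do rewrite -sqrrN opprB.
by rewrite [LHS](ex_sample_mean_sqr P bg)// (ap (bK x)) inner_kernel.
Qed.

Variables (C : R).
Hypothesis C_gt0 : 0 < C.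
Hypothesis geom : level_bounds J0 W C.
Local Notation L := (projV_norm d C).
Local Notation k := ((2 ^ (j * d))%:R : R).

Lemma projV_p_sqr x : projV W j p x ^+ 2 <= (B * L) ^+ 2.
Proof.
rewrite -real_normK ?num_real// lerXn2r ?nnegrE//.
  by rewrite mulr_ge0// projV_norm_ge0.
exact: (projV_bound W_cdv C_gt0 geom).
Qed.

(** The squared norm of the kernel at [x] is its diagonal value, which is of
    order k; a mean of n terms therefore has variance of order k / n. *)
Lemma ex_pointwise_le (t : R) x : `|t| <= B ->
  \int[prob_pow P n]_D (t - ahat D x) ^+ 2 <=
  B ^+ 2 * (C ^+ 3 + (L + 1) ^+ 2) * (1 + k / n%:R).
Proof.
move=> tB; rewrite ex_pointwise_sqr; have L0 : 0 <= L by exact: projV_norm_ge0.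
have ni0 : 0 <= n%:R^-1 :> R by rewrite invr_ge0.
have k0 := @res_gt0 R d j.
have h1 : \int[P]_o (a o * proj_kernel W j (covX o) x) ^+ 2 <= B ^+ 2 * (C ^+ 3 * k).
  apply: le_trans (ex_sqr_regression (bK x)) _.
  by rewrite ler_wpM2l ?sqr_ge0// kernel_sqr; apply: (proj_kernel_le C_gt0 geom).
have h2 : (projV W j p x - t) ^+ 2 <= (B * L + B) ^+ 2.
  rewrite -real_normK ?num_real// lerXn2r ?nnegrE//.
    by rewrite addr_ge0// mulr_ge0.
  apply: le_trans (ler_normB _ _) _; apply: lerD => //.
  exact: (projV_bound W_cdv C_gt0 geom).
apply: (@le_trans _ _ (n%:R^-1 * (B ^+ 2 * (C ^+ 3 * k)) + (B * L + B) ^+ 2)).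
  rewrite lerD// ler_wpM2l//; apply: le_trans h1.
  by rewrite lerBlDr lerDl sqr_ge0.
rewrite -subr_ge0 (_ : _ - _ = B ^+ 2 * (C ^+ 3 + (L + 1) ^+ 2 * (n%:R^-1 * k))).
  by rewrite !(mulr_ge0, addr_ge0, sqr_ge0, exprn_ge0)// ltW.
ring.
Qed.

(** The second moment bound on the response keeps the variance of a term
    comparable to the squared norm of the kernel. *)
Lemma ex_pointwise_ge (c0 t : R) x : 0 <= c0 -> (0 < S)%N -> cube x ->
  (forall phi, bmeas phi -> (forall y, 0 <= phi y) ->
    c0 * \int[unif R d]_y phi y <= \int[P]_o (a o ^+ 2 * phi (covX o))) ->
  n%:R^-1 * (c0 / (C * (2 * C) ^+ d) * k - (B * L) ^+ 2) <=
  \int[prob_pow P n]_D (t - ahat D x) ^+ 2.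
Proof.
move=> c00 S0 xc a2; rewrite ex_pointwise_sqr.
apply: (@le_trans _ _ (n%:R^-1 * (\int[P]_o (a o * proj_kernel W j (covX o) x) ^+ 2 -
             projV W j p x ^+ 2))); last by rewrite lerDl sqr_ge0.
rewrite ler_wpM2l ?invr_ge0// lerB ?projV_p_sqr//.
have D0 : 0 < C * (2 * C) ^+ d by rewrite mulr_gt0// exprn_gt0// mulr_gt0.
apply: (@le_trans _ _ (c0 * proj_kernel W j x x)).
  rewrite -mulrA ler_wpM2l// mulrC ler_pdivrMr// mulrC.
  exact: (proj_kernel_ge W_cdv C_gt0 geom).
rewrite -kernel_sqr.
have h := a2 (fun y => proj_kernel W j y x * proj_kernel W j y x).
apply: le_trans (h _ _) _; [by have b := bK x; bm|by move=> y; rewrite -expr2|].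
rewrite le_eqVlt; apply/orP; left; apply/eqP; apply: ex_eq => o.
by rewrite exprMn !expr2.
Qed.

End series_estimator.

(** * Inner product of the two estimators *)

Section cross_fit.
Context (R : realType) (d S J0 : nat) (W : wavelets R d).
Hypothesis W_cdv : cdv_basis W S J0.
Local Notation T0 := (d.-tuple R * R * R)%type.
Variables (P : probability T0 R) (a y : T0 -> R) (p b : d.-tuple R -> R) (B : R).
Hypothesis RM : regression_model P a y p b B.
Variables (n j1 j2 : nat).
Hypotheses (n0 : (0 < n)%N) (J1 : (J0 <= j1)%N) (J2 : (J0 <= j2)%N).
Variable C : R.
Hypothesis C_gt0 : 0 < C.
Hypothesis geom : level_bounds J0 W C.
Local Notation L := (projV_norm d C).
Local Notation Q := (prob_pow P n).

Let law := rm_law RM.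
Let ba := rm_ma RM.
Let bY := rm_my RM.
Let bp := rm_mp RM.
Let bb := rm_mb RM.
Let aB := rm_a RM.
Let yB := rm_y RM.
Let pB := rm_p RM.
Let bB := rm_b RM.
Let ap := rm_ap RM.
Let yb := rm_yb RM.

Let B0 : 0 <= B. Proof. exact: le_trans (aB point). Qed.
Let ni0 : 0 <= n%:R^-1 :> R. Proof. by rewrite invr_ge0. Qed.

Definition est_p (D : n.-tuple T0) (x : d.-tuple R) : R :=
  series_estimator W a j1 D x.
Definition est_b (D : n.-tuple T0) (x : d.-tuple R) : R :=
  series_estimator W y j2 D x.

Let bPhi j (m : Z W j) : (J0 <= j)%N -> bmeas (Phi m).
Proof. exact: (bmeas_Phi W_cdv m). Qed.

Let oPhi j (J : (J0 <= j)%N) (m m' : Z W j) : inner (Phi m) (Phi m') = (m == m')%:R.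
Proof. exact: (Phi_orthonormal W_cdv). Qed.

Let bproj j f : (J0 <= j)%N -> bmeas (projV W j f).
Proof. exact: (bmeas_projV W_cdv f). Qed.

Let bhp D : bmeas (est_p D).
Proof.
by apply: (bmeas_series_estimator W_cdv ba J1); [exact: measurable_cst|exact: measurable_id].
Qed.

Lemma est_p_sqr f (c : R) : bmeas f ->
  \int[Q]_D (inner (est_p D) f - c) ^+ 2 <=
  n%:R^-1 * (B ^+ 2 * inner (projV W j1 f) (projV W j1 f)) +
  (inner (projV W j1 p) f - c) ^+ 2.
Proof. by move=> bf; apply: (@ex_inner_sqr _ _ _ _ _ W_cdv _ _ p). Qed.

Lemma est_b_sqr f (c : R) : bmeas f ->
  \int[Q]_D (inner (est_b D) f - c) ^+ 2 <=
  n%:R^-1 * (B ^+ 2 * inner (projV W j2 f) (projV W j2 f)) +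
  (inner (projV W j2 b) f - c) ^+ 2.
Proof. by move=> bf; apply: (@ex_inner_sqr _ _ _ _ _ W_cdv _ _ b). Qed.

Let inner_p_le : inner p p <= B ^+ 2.
Proof. exact: inner_le_norm. Qed.
Let inner_b_le : inner b b <= B ^+ 2.
Proof. exact: inner_le_norm. Qed.

Lemma projV_sqr_le j f : (J0 <= j)%N -> bmeas f ->
  inner (projV W j f) (projV W j f) <= inner f f.
Proof.
move=> J bf; apply: inner_proj_le => // [m|m m']; first exact: bPhi.
exact: oPhi.
Qed.

Definition cross (D1 D2 : n.-tuple T0) : R := inner (est_p D1) (est_b D2).

Lemma bmeas_cross : bmeas (fun z : n.-tuple T0 * n.-tuple T0 => cross z.1 z.2).
Proof.
rewrite /cross; under eq_fun do rewrite innerC (inner_series_estimator W_cdv y J2)//.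
apply: (@bmeas_sample_mean _ _ _ _ _ _
  (fun z o => y o * projV W j2 (est_p z.1) (covX o))); first exact: measurable_snd.
apply: bmeasM; first exact: (bmeas_comp bY measurable_snd).
apply: bmeas_sum => m; apply: bmeasM.
  apply: (bmeas_inner_estimator W_cdv ba J1
      (D := fun t : (n.-tuple T0 * n.-tuple T0) * T0 => t.1.1)); last exact: bPhi.
  exact: (measurableT_comp measurable_fst measurable_fst).
apply: (bmeas_comp (bPhi m J2)).
exact: (measurableT_comp (@measurable_covX R d) measurable_snd).
Qed.

(** The Hilbert-Schmidt norm of a product of two projections is at most that
    of either factor. *)
Lemma sum_proj_Phi_le :
  \sum_(m : Z W j2) inner (projV W j1 (Phi m)) (projV W j1 (Phi m)) <=
  C * (minn (2 ^ (j1 * d)) (2 ^ (j2 * d)))%:R.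
Proof.
have [_ c1 _ _ _] := geom J1; have [_ c2 _ _ _] := geom J2.
have E (m : Z W j2) : inner (projV W j1 (Phi m)) (projV W j1 (Phi m)) =
    \sum_(m' : Z W j1) inner (Phi m') (Phi m) ^+ 2.
  rewrite inner_proj_proj//; [|by move=> i; exact: bPhi|exact: oPhi].
  by apply: eq_bigr => m' _; rewrite innerC expr2.
have [_|_] := leqP (2 ^ (j1 * d)) (2 ^ (j2 * d)).
  apply: le_trans c1; under eq_bigr do rewrite E.
  rewrite exchange_big/=; apply: (@le_trans _ _ (\sum_(m' : Z W j1) 1)); last first.
    by rewrite sumr_const.
  apply: ler_sum => m' _; rewrite -[X in _ <= X](_ : inner (Phi m') (Phi m') = 1).
    by apply: Bessel; [move=> i; exact: bPhi|exact: oPhi|exact: bPhi].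
  by rewrite oPhi// eqxx.
apply: le_trans c2; apply: (@le_trans _ _ (\sum_(m : Z W j2) 1)); last first.
  by rewrite sumr_const.
apply: ler_sum => m _; rewrite -[X in _ <= X](_ : inner (Phi m) (Phi m) = 1).
  by apply: projV_sqr_le => //; exact: bPhi.
by rewrite oPhi// eqxx.
Qed.

Let kmin : R := (minn (2 ^ (j1 * d)) (2 ^ (j2 * d)))%:R.

Lemma bmeas_inner_est_p f : bmeas f ->
  bmeas (fun D : n.-tuple T0 => inner (est_p D) f).
Proof. by apply: (bmeas_inner_estimator W_cdv ba J1 (D := id)); exact: measurable_id. Qed.

Lemma bmeas_inner_est_b f : bmeas f ->
  bmeas (fun D : n.-tuple T0 => inner (est_b D) f).
Proof. by apply: (bmeas_inner_estimator W_cdv bY J2 (D := id)); exact: measurable_id. Qed.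

Let projV_est_pE D : inner (projV W j2 (est_p D)) (projV W j2 (est_p D)) =
  \sum_(m : Z W j2) (inner (est_p D) (Phi m) - 0) ^+ 2.
Proof.
rewrite inner_proj_proj; [|by move=> i; exact: bPhi|exact: oPhi].
by apply: eq_bigr => m _; rewrite subr0 expr2.
Qed.

Let bmeas_projV_est_p : bmeas (fun D : n.-tuple T0 =>
  inner (projV W j2 (est_p D)) (projV W j2 (est_p D))).
Proof.
under eq_fun do rewrite projV_est_pE.
by bm; apply: bmeas_inner_est_p; exact: bPhi.
Qed.

(** Projecting onto the second space before taking the norm is what produces
    the smaller of the two resolutions. *)
Lemma ex_projV_est_p :
  \int[Q]_D inner (projV W j2 (est_p D)) (projV W j2 (est_p D)) <=
  n%:R^-1 * (B ^+ 2 * (C * kmin)) + B ^+ 2.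
Proof.
under ex_eq do rewrite projV_est_pE.
rewrite ex_sum; last by move=> m; bm; apply: bmeas_inner_est_p; exact: bPhi.
apply: (@le_trans _ _ (\sum_(m : Z W j2) (n%:R^-1 * (B ^+ 2 *
   inner (projV W j1 (Phi m)) (projV W j1 (Phi m))) +
   (inner (projV W j1 p) (Phi m) - 0) ^+ 2))).
  by apply: ler_sum => m _; apply: est_p_sqr; exact: bPhi.
rewrite big_split/=; apply: lerD.
  rewrite -!mulr_sumr ler_wpM2l// ler_wpM2l ?sqr_ge0//.
  exact: sum_proj_Phi_le.
under eq_bigr do rewrite subr0.
apply: le_trans (Bessel _ _ _) _; [by move=> m; exact: bPhi|exact: oPhi|exact: bproj|].
by apply: le_trans (projV_sqr_le J1 bp) inner_p_le.
Qed.

Definition cross_mean : R := inner (projV W j1 p) (projV W j2 b).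

Lemma ex_cross : \int[Q]_D1 \int[Q]_D2 cross D1 D2 = cross_mean.
Proof.
transitivity (\int[Q]_D1 inner (est_p D1) (projV W j2 b)).
  apply: ex_eq => D1; rewrite /cross innerC.
  under ex_eq do rewrite innerC.
  by rewrite (ex_inner W_cdv bY bb yb n0 J2 (bhp D1)).
exact: (ex_inner W_cdv ba bp ap n0 J1 (bproj _ J2)).
Qed.

Definition cross_var_bound : R :=
  B ^+ 4 * (2 * n%:R^-1 + C * kmin * n%:R^-1 ^+ 2).

(** Given the first sample, the inner product of the estimators is a linear
    functional of the second one, with conditional variance of order 1/n times
    the squared norm of the projected first estimator. *)
Lemma ex_cross_sqr :
  \int[Q]_D1 \int[Q]_D2 (cross D1 D2 - cross_mean) ^+ 2 <= cross_var_bound.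
Proof.
have bpb := bproj b J2; have bi := bmeas_inner_est_p bpb.
have bs := bmeas_sqr (bmeasB bi (bmeas_cst (n.-tuple T0) cross_mean)).
have bq := bmeasM (bmeas_cst (n.-tuple T0) n%:R^-1)
  (bmeasM (bmeas_cst _ (B ^+ 2)) bmeas_projV_est_p).
apply: (@le_trans _ _ (\int[Q]_D1 (n%:R^-1 * (B ^+ 2 *
   inner (projV W j2 (est_p D1)) (projV W j2 (est_p D1))) +
   (inner (est_p D1) (projV W j2 b) - cross_mean) ^+ 2))).
  apply: ex_le => [||D1]; [|exact: (bmeasD bq bs)|].
    apply: (bmeas_ex Q Q (f := fun z => (cross z.1 z.2 - cross_mean) ^+ 2)).
    exact: (bmeas_sqr (bmeasB bmeas_cross (bmeas_cst _ _))).
  rewrite /cross; under ex_eq do rewrite innerC.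
  by rewrite (innerC (est_p D1) (projV _ _ _)); exact: est_b_sqr.
rewrite (exD Q bq bs) (exZ Q _ (bmeasM (bmeas_cst _ _) bmeas_projV_est_p)).
rewrite (exZ Q _ bmeas_projV_est_p).
have h1 := ex_projV_est_p.
have h2 := est_p_sqr cross_mean bpb.
have h3 : inner (projV W j1 (projV W j2 b)) (projV W j1 (projV W j2 b)) <= B ^+ 2.
  apply: le_trans (projV_sqr_le J1 bpb) _.
  by apply: le_trans (projV_sqr_le J2 bb) _.
have h4 : \int[Q]_D (inner (est_p D) (projV W j2 b) - cross_mean) ^+ 2 <=
    n%:R^-1 * (B ^+ 2 * B ^+ 2).
  apply: le_trans h2 _; rewrite subrr expr0n/= addr0.
  by rewrite ler_wpM2l// ler_wpM2l ?sqr_ge0.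
apply: le_trans (lerD (ler_wpM2l ni0 (ler_wpM2l (sqr_ge0 B) h1)) h4) _.
by rewrite /cross_var_bound le_eqVlt; apply/orP; left; apply/eqP; ring.
Qed.

(** With [lam = 1] the residuals of the influence function estimator, with
    [lam = 0] the product integrated by Monte Carlo. *)
Section residuals.
Variable lam : R.

Let e := \int[P]_o (a o * y o).

(** Conditional mean of the product of residuals given the two estimators. *)
Definition resid_mean (D1 D2 : n.-tuple T0) : R :=
  lam ^+ 2 * e - lam * inner (est_b D2) p - lam * inner (est_p D1) b + cross D1 D2.

Definition resid_center : R :=
  lam ^+ 2 * e - lam * inner (projV W j2 b) p - lam * inner (projV W j1 p) b +
  cross_mean.

Lemma bmeas_resid_mean :
  bmeas (fun z : n.-tuple T0 * n.-tuple T0 => resid_mean z.1 z.2).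
Proof.
have b1 := bmeas_comp (bmeas_inner_est_b bp) (g := @snd (n.-tuple T0) (n.-tuple T0)) measurable_snd.
have b2 := bmeas_comp (bmeas_inner_est_p bb) (g := @fst (n.-tuple T0) (n.-tuple T0)) measurable_fst.
by have b3 := bmeas_cross; rewrite /resid_mean; bm.
Qed.

Lemma ex_resid_mean :
  \int[Q]_D1 \int[Q]_D2 resid_mean D1 D2 = resid_center.
Proof.
have b1 := bmeas_inner_est_b bp; have b2 := bmeas_inner_est_p bb.
have b3 D1 : bmeas (fun D2 => cross D1 D2).
  by apply: (bmeas_comp bmeas_cross (g := fun D2 => (D1, D2))); exact: measurable_pair1.
have b4 := bmeas_ex Q Q bmeas_cross.
transitivity (\int[Q]_D1 (lam ^+ 2 * e - lam * inner (projV W j2 b) p -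
    lam * inner (est_p D1) b + \int[Q]_D2 cross D1 D2)).
  apply: ex_eq => D1; rewrite /resid_mean; have b5 := b3 D1.
  rewrite exD; [|bm..]; rewrite exB; [|bm..]; rewrite exB; [|bm..].
  rewrite !ex_cst exZ; [|bm].
  by rewrite (ex_inner W_cdv bY bb yb n0 J2 bp).
rewrite exD; [|bm..]; rewrite exB; [|bm..]; rewrite ex_cst exZ; [|bm].
by rewrite ex_cross (ex_inner W_cdv ba bp ap n0 J1 bb).
Qed.

Definition resid_mean_bound : R :=
  3 * B ^+ 4 * (4 * n%:R^-1 + C * kmin * n%:R^-1 ^+ 2).

Hypothesis lam_itv : 0 <= lam <= 1.

Let lam2 : lam ^+ 2 <= 1.
Proof. by case/andP: lam_itv => l0 l1; rewrite expr_le1. Qed.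

Lemma ex_resid_mean_sqr :
  \int[Q]_D1 \int[Q]_D2 (resid_mean D1 D2 - resid_center) ^+ 2 <= resid_mean_bound.
Proof.
have b1 := bmeas_inner_est_b bp; have b2 := bmeas_inner_est_p bb.
have b3 D1 : bmeas (fun D2 => cross D1 D2).
  by apply: (bmeas_comp bmeas_cross (g := fun D2 => (D1, D2))); exact: measurable_pair1.
have b3' : bmeas (fun z : n.-tuple T0 * n.-tuple T0 => cross z.1 z.2 - cross_mean).
  by have := bmeas_cross => ?; bm.
have b4 := bmeas_ex Q Q (bmeas_sqr b3').
have h1 : \int[Q]_D (inner (est_b D) p - inner (projV W j2 b) p) ^+ 2 <=
    n%:R^-1 * (B ^+ 2 * B ^+ 2).
  apply: le_trans (est_b_sqr _ bp) _; rewrite subrr expr0n/= addr0.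
  rewrite ler_wpM2l// ler_wpM2l ?sqr_ge0//.
  exact: le_trans (projV_sqr_le J2 bp) inner_p_le.
have h2 : \int[Q]_D (inner (est_p D) b - inner (projV W j1 p) b) ^+ 2 <=
    n%:R^-1 * (B ^+ 2 * B ^+ 2).
  apply: le_trans (est_p_sqr _ bb) _; rewrite subrr expr0n/= addr0.
  rewrite ler_wpM2l// ler_wpM2l ?sqr_ge0//.
  exact: le_trans (projV_sqr_le J1 bb) inner_b_le.
apply: (@le_trans _ _ (\int[Q]_D1 (3 * ((\int[Q]_D2 (inner (est_b D2) p - inner (projV W j2 b) p) ^+ 2) +
   (inner (est_p D1) b - inner (projV W j1 p) b) ^+ 2 +
   \int[Q]_D2 (cross D1 D2 - cross_mean) ^+ 2)))).
  apply: ex_le => [||D1]; [|by bm|].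
    apply: (bmeas_ex Q Q (f := fun z => (resid_mean z.1 z.2 - resid_center) ^+ 2)).
    by have := bmeas_resid_mean => ?; bm.
  apply: (@le_trans _ _ (\int[Q]_D2 (3 * ((inner (est_b D2) p - inner (projV W j2 b) p) ^+ 2 +
   (inner (est_p D1) b - inner (projV W j1 p) b) ^+ 2 +
   (cross D1 D2 - cross_mean) ^+ 2)))).
    apply: ex_le => [||D2].
    - by rewrite /resid_mean; have := b3 D1 => ?; bm.
    - by have := b3 D1 => ?; bm.
    rewrite /resid_mean /resid_center.
    set x := inner (est_b D2) p - _; set z := inner (est_p D1) b - _.
    set w := cross D1 D2 - _.
    rewrite (_ : _ - _ = w - lam * x - lam * z); last by rewrite /x /z /w; ring.
    apply: (@le_trans _ _ (3 * (lam ^+ 2 * x ^+ 2 + lam ^+ 2 * z ^+ 2 + w ^+ 2))).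
      rewrite -subr_ge0 (_ : _ - _ = (w + lam * x) ^+ 2 + (w + lam * z) ^+ 2 +
         (lam * x - lam * z) ^+ 2); last by ring.
      by rewrite !addr_ge0.
    rewrite ler_wpM2l// lerD2r lerD//.
      by rewrite -[leRHS]mul1r ler_wpM2r// sqr_ge0.
    by rewrite -[leRHS]mul1r ler_wpM2r// sqr_ge0.
  have := b3 D1 => ?; rewrite exZ; [|bm]; rewrite exD; [|bm..]; rewrite exD; [|bm..].
  by rewrite ex_cst.
rewrite exZ; [|bm]; rewrite exD; [|bm..]; rewrite exD; [|bm..]; rewrite ex_cst.
have := ex_cross_sqr; rewrite /cross_var_bound /resid_mean_bound => h3.
apply: (@le_trans _ _ (3 * (n%:R^-1 * (B ^+ 2 * B ^+ 2) + n%:R^-1 * (B ^+ 2 * B ^+ 2) +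
  B ^+ 4 * (2 * n%:R^-1 + C * kmin * n%:R^-1 ^+ 2)))).
  by rewrite ler_wpM2l// lerD// lerD.
by rewrite le_eqVlt; apply/orP; left; apply/eqP; ring.
Qed.

End residuals.
End cross_fit.

(** * Products of residuals *)

Section residual_product.
Context (R : realType) (d S J0 : nat) (W : wavelets R d).
Hypothesis W_cdv : cdv_basis W S J0.
Local Notation T0 := (d.-tuple R * R * R)%type.
Variables (P : probability T0 R) (a y : T0 -> R) (p b : d.-tuple R -> R) (B : R).
Hypothesis RM : regression_model P a y p b B.
Variables (n j1 j2 : nat).
Hypotheses (n0 : (0 < n)%N) (J1 : (J0 <= j1)%N) (J2 : (J0 <= j2)%N).
Variable C : R.
Hypothesis C_gt0 : 0 < C.
Hypothesis geom : level_bounds J0 W C.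
Variable lam : R.
Hypothesis lam_itv : 0 <= lam <= 1.
Local Notation L := (projV_norm d C).
Local Notation Q := (prob_pow P n).
Local Notation nT := (n.-tuple T0).
Local Notation k1 := ((2 ^ (j1 * d))%:R : R).
Local Notation k2 := ((2 ^ (j2 * d))%:R : R).
Local Notation rmean := (resid_mean W P a y p b j1 j2 lam).
Local Notation rcenter := (resid_center W P a y p b j1 j2 lam).
Local Notation rbound := (resid_mean_bound d B n j1 j2 C).

Let ba := rm_ma RM.
Let bY := rm_my RM.
Let aB := rm_a RM.
Let yB := rm_y RM.
Let B0 : 0 <= B. Proof. exact: le_trans (aB point). Qed.
Let ni0 : 0 <= n%:R^-1 :> R. Proof. by rewrite invr_ge0. Qed.

Let lamB t : `|t| <= B -> `|lam * t| <= B.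
Proof.
case/andP: lam_itv => l0 l1 tB; rewrite normrM ger0_norm//.
by apply: le_trans tB; rewrite -[leRHS]mul1r ler_wpM2r.
Qed.

Definition resid_p (z : nT * T0) : R := lam * a z.2 - est_p W a j1 z.1 (covX z.2).
Definition resid_b (z : nT * T0) : R := lam * y z.2 - est_b W y j2 z.1 (covX z.2).

Let mX2 : measurable_fun [set: nT * T0] (fun z => covX z.2 : d.-tuple R).
Proof. exact: (measurableT_comp (@measurable_covX R d) measurable_snd). Qed.

Lemma bmeas_resid_p : bmeas resid_p.
Proof.
apply: bmeasB.
  by apply: bmeasM; [exact: bmeas_cst|exact: (bmeas_comp ba measurable_snd)].
by apply: (bmeas_series_estimator W_cdv ba J1); [exact: measurable_fst|exact: mX2].
Qed.

Lemma bmeas_resid_b : bmeas resid_b.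
Proof.
apply: bmeasB.
  by apply: bmeasM; [exact: bmeas_cst|exact: (bmeas_comp bY measurable_snd)].
by apply: (bmeas_series_estimator W_cdv bY J2); [exact: measurable_fst|exact: mX2].
Qed.

Definition resid_prod (D1 D2 : nT) (o : T0) : R := resid_p (D1, o) * resid_b (D2, o).

Lemma bmeas_resid_prod :
  bmeas (fun z : (nT * nT) * T0 => resid_prod z.1.1 z.1.2 z.2).
Proof.
apply: bmeasM.
  apply: (bmeas_comp bmeas_resid_p (g := fun z : (nT * nT) * T0 => (z.1.1, z.2))).
  apply/measurable_fun_pairP; split; last exact: measurable_snd.
  exact: (measurableT_comp measurable_fst measurable_fst).
apply: (bmeas_comp bmeas_resid_b (g := fun z : (nT * nT) * T0 => (z.1.2, z.2))).
apply/measurable_fun_pairP; split; last exact: measurable_snd.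
exact: (measurableT_comp measurable_snd measurable_fst).
Qed.

Let bprod (D1 D2 : nT) : bmeas (resid_prod D1 D2).
Proof.
apply: (bmeas_comp bmeas_resid_prod (g := fun o => ((D1, D2), o))).
exact: measurable_pair1.
Qed.

Let best_p (D : nT) : bmeas (est_p W a j1 D : d.-tuple R -> R).
Proof.
by apply: (bmeas_series_estimator W_cdv ba J1); [exact: measurable_cst|exact: measurable_id].
Qed.

Let best_b (D : nT) : bmeas (est_b W y j2 D : d.-tuple R -> R).
Proof.
by apply: (bmeas_series_estimator W_cdv bY J2); [exact: measurable_cst|exact: measurable_id].
Qed.

Lemma ex_resid_prod (D1 D2 : nT) : \int[P]_o resid_prod D1 D2 o = rmean D1 D2.
Proof.
have bp1 := best_p D1; have bb2 := best_b D2.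
have bp1X := bmeas_covX bp1; have bb2X := bmeas_covX bb2.
have b1 := bmeasM ba bY; have b2 := bmeasM ba bb2X; have b3 := bmeasM bY bp1X.
have b4 := bmeasM bp1X bb2X.
transitivity (\int[P]_o (lam ^+ 2 * (a o * y o) -
    lam * (a o * est_b W y j2 D2 (covX o)) - lam * (y o * est_p W a j1 D1 (covX o)) +
    est_p W a j1 D1 (covX o) * est_b W y j2 D2 (covX o))).
  by apply: ex_eq => o; rewrite /resid_prod /resid_p /resid_b/=; ring.
have c1 := bmeasM (bmeas_cst T0 (lam ^+ 2)) b1.
have c2 := bmeasM (bmeas_cst T0 lam) b2; have c3 := bmeasM (bmeas_cst T0 lam) b3.
rewrite (exD P (bmeasB (bmeasB c1 c2) c3) b4) (exB P (bmeasB c1 c2) c3) (exB P c1 c2).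
rewrite (exZ P _ b1) (exZ P _ b2) (exZ P _ b3) (rm_ap RM bb2) (rm_yb RM bp1).
rewrite (rm_law RM (bmeasM bp1 bb2)) /resid_mean /cross.
by rewrite (innerC p) (innerC b).
Qed.

Definition resid_sqr (D1 D2 : nT) : R := \int[P]_o (resid_prod D1 D2 o ^+ 2).

Definition resid_stat (D1 D2 D : nT) : R := sample_mean D (resid_prod D1 D2).

Lemma ex_resid_stat_sqr (D1 D2 : nT) (c : R) :
  \int[Q]_D (resid_stat D1 D2 D - c) ^+ 2 =
  n%:R^-1 * (resid_sqr D1 D2 - rmean D1 D2 ^+ 2) + (rmean D1 D2 - c) ^+ 2.
Proof.
by rewrite [LHS](ex_sample_mean_sqr P (bprod D1 D2))// ex_resid_prod.
Qed.

Definition sq_p (o : T0) : R := \int[Q]_D (resid_p (D, o) ^+ 2).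
Definition sq_b (o : T0) : R := \int[Q]_D (resid_b (D, o) ^+ 2).

Let mswap d1 d2 (T1 : measurableType d1) (T2 : measurableType d2) :
  measurable_fun [set: T1 * T2] (fun z => (z.2, z.1)).
Proof. by apply/measurable_fun_pairP; split; [exact: measurable_snd|exact: measurable_fst]. Qed.

Let bsq_p : bmeas sq_p.
Proof.
apply: (bmeas_ex P Q (f := fun z : T0 * nT => resid_p (z.2, z.1) ^+ 2)).
by apply: (bmeas_comp (bmeas_sqr bmeas_resid_p)); exact: mswap.
Qed.

Let bsq_b : bmeas sq_b.
Proof.
apply: (bmeas_ex P Q (f := fun z : T0 * nT => resid_b (z.2, z.1) ^+ 2)).
by apply: (bmeas_comp (bmeas_sqr bmeas_resid_b)); exact: mswap.
Qed.

(** At a given observation the two residuals depend on different samples, so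
    their squares are independent, each with mean of order 1 + k/n. *)
Lemma ex_resid_sqr :
  \int[Q]_D1 \int[Q]_D2 resid_sqr D1 D2 = \int[P]_o (sq_p o * sq_b o).
Proof.
have pairD (D : nT) := measurable_pair1 (T2 := T0) D.
transitivity (\int[Q]_D1 \int[P]_o (resid_p (D1, o) ^+ 2 * sq_b o)).
  apply: ex_eq => D1; rewrite /resid_sqr /resid_prod.
  rewrite (ex_prod_swap Q P (f := fun z => (resid_p (D1, z.2) * resid_b z) ^+ 2)).
    apply: ex_eq => o; under ex_eq do rewrite /= exprMn; rewrite exZ//.
    by apply: (bmeas_comp (bmeas_sqr bmeas_resid_b)); exact: measurable_pair2.
  apply: bmeas_sqr; apply: bmeasM; last exact: bmeas_resid_b.
  apply: (bmeas_comp bmeas_resid_p).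
  by apply/measurable_fun_pairP; split; [exact: measurable_cst|exact: measurable_snd].
rewrite (ex_prod_swap Q P (f := fun z => resid_p z ^+ 2 * sq_b z.2)).
  apply: ex_eq => o; rewrite /= mulrC -exZ.
    by apply: ex_eq => D; rewrite mulrC.
  by apply: (bmeas_comp (bmeas_sqr bmeas_resid_p)); exact: measurable_pair2.
apply: bmeasM; first exact: (bmeas_sqr bmeas_resid_p).
exact: (bmeas_comp bsq_b measurable_snd).
Qed.

Definition pointwise_const : R := B ^+ 2 * (C ^+ 3 + (L + 1) ^+ 2).

Let sq_p_le o : sq_p o <= pointwise_const * (1 + k1 / n%:R).
Proof.
exact: (ex_pointwise_le W_cdv (rm_law RM) ba (rm_mp RM) aB (rm_p RM) (rm_ap RM)
  n0 J1 C_gt0 geom (covX o) (lamB (aB o))).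
Qed.

Let sq_b_le o : sq_b o <= pointwise_const * (1 + k2 / n%:R).
Proof.
exact: (ex_pointwise_le W_cdv (rm_law RM) bY (rm_mb RM) yB (rm_b RM) (rm_yb RM)
  n0 J2 C_gt0 geom (covX o) (lamB (yB o))).
Qed.

Let sq_p_ge0 o : 0 <= sq_p o. Proof. exact: ex_ge0. Qed.
Let sq_b_ge0 o : 0 <= sq_b o. Proof. exact: ex_ge0. Qed.

Lemma ex_resid_sqr_le : \int[Q]_D1 \int[Q]_D2 resid_sqr D1 D2 <=
  pointwise_const ^+ 2 * (1 + k1 / n%:R) * (1 + k2 / n%:R).
Proof.
rewrite ex_resid_sqr; apply: ex_le_cst => [|o]; first exact: bmeasM.
apply: (@le_trans _ _ ((pointwise_const * (1 + k1 / n%:R)) *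
    (pointwise_const * (1 + k2 / n%:R)))); first exact: ler_pM.
by rewrite le_eqVlt; apply/orP; left; apply/eqP; ring.
Qed.

Let bsqr : bmeas (fun z : nT * nT => resid_sqr z.1 z.2).
Proof.
exact: (bmeas_ex (Q \x Q)%E P
  (f := fun z : (nT * nT) * T0 => resid_prod z.1.1 z.1.2 z.2 ^+ 2)
  (bmeas_sqr bmeas_resid_prod)).
Qed.

Let bmean := bmeas_resid_mean W_cdv RM n J1 J2 lam.

Let section2 (f : nT * nT -> R) D1 : bmeas f -> bmeas (fun D2 => f (D1, D2)).
Proof. by move=> bf; apply: (bmeas_comp bf); exact: measurable_pair1. Qed.

Let ex2D (f g : nT * nT -> R) : bmeas f -> bmeas g ->
  \int[Q]_D1 \int[Q]_D2 (f (D1, D2) + g (D1, D2)) =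
  \int[Q]_D1 \int[Q]_D2 f (D1, D2) + \int[Q]_D1 \int[Q]_D2 g (D1, D2).
Proof.
move=> bf bg; rewrite -exD; [|exact: (bmeas_ex Q Q bf)|exact: (bmeas_ex Q Q bg)].
by apply: ex_eq => D1; rewrite exD//; exact: section2.
Qed.

Let ex2Z (c : R) (f : nT * nT -> R) : bmeas f ->
  \int[Q]_D1 \int[Q]_D2 (c * f (D1, D2)) = c * \int[Q]_D1 \int[Q]_D2 f (D1, D2).
Proof.
move=> bf; rewrite -exZ; last exact: (bmeas_ex Q Q bf).
by apply: ex_eq => D1; rewrite exZ//; exact: section2.
Qed.

Let ex2_le (f g : nT * nT -> R) : bmeas f -> bmeas g -> (forall z, f z <= g z) ->
  \int[Q]_D1 \int[Q]_D2 f (D1, D2) <= \int[Q]_D1 \int[Q]_D2 g (D1, D2).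
Proof.
move=> bf bg fg; apply: ex_le => [||D1]; [exact: (bmeas_ex Q Q bf)|exact: (bmeas_ex Q Q bg)|].
by apply: ex_le => [||D2]; [exact: section2|exact: section2|exact: fg].
Qed.

Lemma ex_resid_stat : \int[Q]_D1 \int[Q]_D2 \int[Q]_D resid_stat D1 D2 D = rcenter.
Proof.
rewrite -(ex_resid_mean W_cdv RM n0 J1 J2).
by do 2 apply: ex_eq => ?; rewrite ex_sample_mean ?ex_resid_prod.
Qed.

(** Total variance: the mean of the conditional variance given the two
    estimators, plus the variance of the conditional mean. *)
Lemma ex_resid_stat_center :
  \int[Q]_D1 \int[Q]_D2 \int[Q]_D (resid_stat D1 D2 D - rcenter) ^+ 2 <=
  n%:R^-1 * (pointwise_const ^+ 2 * (1 + k1 / n%:R) * (1 + k2 / n%:R)) + rbound.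
Proof.
have bc := bmeas_sqr (bmeasB bmean (bmeas_cst _ rcenter)).
have bs := bmeasM (bmeas_cst _ n%:R^-1) bsqr.
apply: (@le_trans _ _ (\int[Q]_D1 \int[Q]_D2 (n%:R^-1 * resid_sqr D1 D2 +
   (rmean D1 D2 - rcenter) ^+ 2))).
  under ex_eq => D1 do under ex_eq => D2 do rewrite ex_resid_stat_sqr.
  apply: (ex2_le (f := fun z => n%:R^-1 * (resid_sqr z.1 z.2 - rmean z.1 z.2 ^+ 2) +
    (rmean z.1 z.2 - rcenter) ^+ 2) (bmeasD (bmeasM (bmeas_cst _ _)
     (bmeasB bsqr (bmeas_sqr bmean))) bc) (bmeasD bs bc)) => z.
  by rewrite lerD2r ler_wpM2l// gerBl sqr_ge0.
rewrite (ex2D bs bc) (ex2Z _ bsqr); apply: lerD.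
  by rewrite ler_wpM2l// ex_resid_sqr_le.
exact: (ex_resid_mean_sqr W_cdv RM n0 J1 J2 geom lam_itv).
Qed.

(** The conditional mean has a bounded second moment, so a large second moment
    of the product of residuals forces a large conditional variance. The
    centering [c] may depend on the estimators. *)
Lemma ex_resid_stat_sqr_ge (c : nT -> nT -> R) :
  bmeas (fun z => c z.1 z.2) ->
  n%:R^-1 * (\int[P]_o (sq_p o * sq_b o) - 2 * rbound - 2 * rcenter ^+ 2) <=
  \int[Q]_D1 \int[Q]_D2 \int[Q]_D (resid_stat D1 D2 D - c D1 D2) ^+ 2.
Proof.
move=> bcc; have bc := bmeas_sqr (bmeasB bmean (bmeas_cst _ rcenter)).
have b2 := bmeasM (bmeas_cst _ 2) bc.
have b3 := bmeasD (bmeasN b2) (bmeas_cst _ (- (2 * rcenter ^+ 2))).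
apply: (@le_trans _ _ (\int[Q]_D1 \int[Q]_D2 (n%:R^-1 * (resid_sqr D1 D2 +
   (- (2 * (rmean D1 D2 - rcenter) ^+ 2) + - (2 * rcenter ^+ 2)))))).
  rewrite (ex2Z _ (bmeasD bsqr b3)) (ex2D bsqr b3) ex_resid_sqr.
  rewrite ler_wpM2l// -addrA lerD2l.
  rewrite (ex2D (bmeasN b2) (bmeas_cst _ (- (2 * rcenter ^+ 2)))).
  apply: lerD; last by under ex_eq do rewrite ex_cst; rewrite ex_cst.
  under ex_eq => D1 do under ex_eq => D2 do rewrite -mulNr.
  rewrite (ex2Z _ bc) mulNr lerN2 ler_wpM2l//.
  exact: (ex_resid_mean_sqr W_cdv RM n0 J1 J2 geom lam_itv).
under [leRHS]ex_eq => D1 do under ex_eq => D2 do rewrite ex_resid_stat_sqr.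
apply: (ex2_le (f := fun z => n%:R^-1 * (resid_sqr z.1 z.2 +
   (- (2 * (rmean z.1 z.2 - rcenter) ^+ 2) + - (2 * rcenter ^+ 2))))
  (g := fun z => n%:R^-1 * (resid_sqr z.1 z.2 - rmean z.1 z.2 ^+ 2) +
    (rmean z.1 z.2 - c z.1 z.2) ^+ 2)).
- exact: (bmeasM (bmeas_cst _ _) (bmeasD bsqr b3)).
- exact: (bmeasD (bmeasM (bmeas_cst _ _) (bmeasB bsqr (bmeas_sqr bmean)))
    (bmeas_sqr (bmeasB bmean bcc))).
move=> z; apply: (@le_trans _ _ (n%:R^-1 * (resid_sqr z.1 z.2 - rmean z.1 z.2 ^+ 2))).
  rewrite ler_wpM2l// lerD2l -subr_ge0.
  set x := rmean _ _; set u := resid_center _ _ _ _ _ _ _ _ _.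
  rewrite [X in 0 <= X](_ : _ = (x - 2 * u) ^+ 2); last by ring.
  by rewrite sqr_ge0.
by rewrite lerDl sqr_ge0.
Qed.

Section nondegenerate.
Variable c0 : R.
Hypothesis c0_ge0 : 0 <= c0.
Hypothesis S_gt0 : (0 < S)%N.
Hypothesis a2 : forall phi, bmeas phi -> (forall x, 0 <= phi x) ->
  c0 * \int[unif R d]_x phi x <= \int[P]_o (a o ^+ 2 * phi (covX o)).
Hypothesis y2 : forall phi, bmeas phi -> (forall x, 0 <= phi x) ->
  c0 * \int[unif R d]_x phi x <= \int[P]_o (y o ^+ 2 * phi (covX o)).

Definition sq_low (k : R) : R :=
  n%:R^-1 * (c0 / (C * (2 * C) ^+ d) * k - (B * L) ^+ 2).

Lemma ex_resid_sqr_ge : 0 <= sq_low k1 -> 0 <= sq_low k2 ->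
  sq_low k1 * sq_low k2 <= \int[P]_o (sq_p o * sq_b o).
Proof.
move=> l1 l2; have mc := @measurable_cube R d.
apply: (@le_trans _ _ (\int[P]_o (sq_low k1 * sq_low k2 * \1_(@cube R d) (covX o)))).
  rewrite exZ; last exact: (bmeas_covX (bmeas_indic R mc)).
  rewrite (rm_law RM (bmeas_indic R mc)).
  rewrite (@ex_cube _ _ _ (fun=> 1)) ?ex_cst ?mulr1//.
  by move=> x xc; rewrite indicE mem_set.
apply: ex_le => [||o]; [|exact: bmeasM|].
  by apply: bmeasM; [exact: bmeas_cst|exact: (bmeas_covX (bmeas_indic R mc))].
rewrite indicE; have [|_] := boolP (covX o \in _); last by rewrite mulr0 mulr_ge0.
rewrite in_setE => xc; rewrite mulr1; apply: ler_pM => //.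
  exact: (ex_pointwise_ge W_cdv ba (rm_mp RM) aB (rm_p RM) (rm_ap RM)
    n0 J1 C_gt0 geom (lam * a o) c0_ge0 S_gt0 xc a2).
exact: (ex_pointwise_ge W_cdv bY (rm_mb RM) yB (rm_b RM) (rm_yb RM)
    n0 J2 C_gt0 geom (lam * y o) c0_ge0 S_gt0 xc y2).
Qed.

Lemma resid_stat_var_ge (c : nT -> nT -> R) : bmeas (fun z => c z.1 z.2) ->
  0 <= sq_low k1 -> 0 <= sq_low k2 ->
  n%:R^-1 * (sq_low k1 * sq_low k2 - 2 * rbound - 2 * rcenter ^+ 2) <=
  \int[Q]_D1 \int[Q]_D2 \int[Q]_D (resid_stat D1 D2 D - c D1 D2) ^+ 2.
Proof.
move=> bc l1 l2; apply: le_trans (ex_resid_stat_sqr_ge bc).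
by rewrite ler_wpM2l// !lerD2r; exact: ex_resid_sqr_ge.
Qed.

End nondegenerate.
End residual_product.

(** * Bias and variance of the three estimators *)

Section samples.
Context (R : realType) (d n : nat).
Local Notation T0 := (d.-tuple R * R * R)%type.
Local Notation nT := (n.-tuple T0).
Variable P : probability T0 R.
Local Notation Q := (prob_pow P n).

Definition mk_samples (E1 E2 E3 E4 : nT) : 4.-tuple nT :=
  tuple_cons (E1, tuple_cons (E2, tuple_cons (E3, tuple_cons (E4, [tuple])))).

Lemma D1_mk E1 E2 E3 E4 : D1 (mk_samples E1 E2 E3 E4) = E1.
Proof. by rewrite /D1 (tnth_nth E1)/= inordK. Qed.
Lemma D2_mk E1 E2 E3 E4 : D2 (mk_samples E1 E2 E3 E4) = E2.
Proof. by rewrite /D2 (tnth_nth E1)/= inordK. Qed.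
Lemma D3_mk E1 E2 E3 E4 : D3 (mk_samples E1 E2 E3 E4) = E3.
Proof. by rewrite /D3 (tnth_nth E1)/= inordK. Qed.
Lemma D4_mk E1 E2 E3 E4 : D4 (mk_samples E1 E2 E3 E4) = E4.
Proof. by rewrite /D4 (tnth_nth E1)/= inordK. Qed.

Lemma ex_samples (F : nT -> nT -> nT -> nT -> R) :
  bmeas (fun w : 4.-tuple nT => F (D1 w) (D2 w) (D3 w) (D4 w)) ->
  \int[sample_law n P]_w F (D1 w) (D2 w) (D3 w) (D4 w) =
  \int[Q]_E1 \int[Q]_E2 \int[Q]_E3 \int[Q]_E4 F E1 E2 E3 E4.
Proof.
move=> bF; have mc m := measurable_tuple_cons (T := nT) (n := m).
rewrite [LHS](ex_prob_pow Q bF); apply: ex_eq => E1.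
have b1 : bmeas (fun t => (fun w : 4.-tuple nT => F (D1 w) (D2 w) (D3 w) (D4 w))
    (tuple_cons (E1, t))).
  apply: (bmeas_comp bF (g := fun t => tuple_cons (E1, t))).
  exact: (measurableT_comp (mc 3) (measurable_pair1 E1)).
rewrite [LHS](ex_prob_pow Q b1); apply: ex_eq => E2.
have b2 : bmeas (fun t => (fun w : 4.-tuple nT => F (D1 w) (D2 w) (D3 w) (D4 w))
    (tuple_cons (E1, tuple_cons (E2, t)))).
  apply: (bmeas_comp b1 (g := fun t => tuple_cons (E2, t))).
  exact: (measurableT_comp (mc 2) (measurable_pair1 E2)).
rewrite [LHS](ex_prob_pow Q b2); apply: ex_eq => E3.
have b3 : bmeas (fun t => (fun w : 4.-tuple nT => F (D1 w) (D2 w) (D3 w) (D4 w))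
    (tuple_cons (E1, tuple_cons (E2, tuple_cons (E3, t))))).
  apply: (bmeas_comp b2 (g := fun t => tuple_cons (E3, t))).
  exact: (measurableT_comp (mc 1) (measurable_pair1 E3)).
rewrite [LHS](ex_prob_pow Q b3); apply: ex_eq => E4.
rewrite -[RHS](ex_cst (prob_pow Q 0)); apply: ex_eq => t.
rewrite [t]tuple0 -/(mk_samples E1 E2 E3 E4).
by rewrite D1_mk D2_mk D3_mk D4_mk.
Qed.

Lemma measurable_D1 : measurable_fun [set: 4.-tuple nT] (@D1 R d n).
Proof. exact: measurable_tnth. Qed.
Lemma measurable_D2 : measurable_fun [set: 4.-tuple nT] (@D2 R d n).
Proof. exact: measurable_tnth. Qed.
Lemma measurable_D3 : measurable_fun [set: 4.-tuple nT] (@D3 R d n).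
Proof. exact: measurable_tnth. Qed.
Lemma measurable_D4 : measurable_fun [set: 4.-tuple nT] (@D4 R d n).
Proof. exact: measurable_tnth. Qed.

Lemma samples_ae (B : set T0) : {ae P, forall o, B o} ->
  {ae sample_law n P, forall w, forall r i, B (tnth (tnth w r) i)}.
Proof.
move=> [N [mN PN BN]].
have PCN : P (~` N) = 1%E by rewrite probability_setC// PN sube0.
have [mb Pb] := prob_pow_box1 n (measurableC mN) PCN.
apply: filterS (prob_pow_ae 4 mb Pb) => w h r i; apply: contrapT => nB.
by apply: (h r i); exact: BN.
Qed.

(** The estimators are only almost surely functions of clipped responses; their
    moments do not see the difference and become integrals of bounded
    functions. *)
Lemma estimator_moments (f g : 4.-tuple nT -> R) (c : R) :
  measurable_fun setT f -> bmeas g -> {ae sample_law n P, forall w, f w = g w} ->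
  'E_(sample_law n P)[(fun w => f w - c)%R]%E = (\int[sample_law n P]_w g w - c)%:E /\
  'V_(sample_law n P)[f]%E =
    (\int[sample_law n P]_w (g w - \int[sample_law n P]_w g w) ^+ 2)%:E.
Proof.
move=> mf bg fg; have mg := proj1 bg.
have h0 (h : R -> R) : measurable_fun setT h -> bmeas (fun w => h (g w)) ->
    (\int[sample_law n P]_w (h (f w))%:E)%E = (\int[sample_law n P]_w h (g w))%:E.
  move=> mh bh; rewrite -EFin_ex//; apply: ae_eq_integral => //.
  - apply/measurable_EFinP; exact: (measurableT_comp mh mf).
  - by apply/measurable_EFinP; case: bh.
  - by apply: filterS fg => w /= ->.
split.
  rewrite unlock (h0 (fun x => x - c)).
  - by rewrite exB ?ex_cst//; exact: bmeas_cst.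
  - by apply: measurable_funB; [exact: measurable_id|exact: measurable_cst].
  - by apply: bmeasB => //; exact: bmeas_cst.
rewrite /variance unlock.
have -> : fine 'E_(sample_law n P)[f]%E = \int[sample_law n P]_w g w.
  by rewrite unlock (h0 id)//; exact: measurable_id.
set m := \int[_]_w g w; rewrite unlock.
rewrite -(h0 (fun x => (x - m) ^+ 2)).
- by apply: eq_integral => w _; rewrite expr2.
- apply: measurable_funX; apply: measurable_funB; first exact: measurable_id.
  exact: measurable_cst.
- by apply: bmeas_sqr; apply: bmeasB => //; exact: bmeas_cst.
Qed.

End samples.

Section measurability.
Context (R : realType) (d S J0 : nat) (W : wavelets R d).
Hypothesis W_cdv : cdv_basis W S J0.
Local Notation T0 := (d.-tuple R * R * R)%type.
Variables (n : nat).
Local Notation nT := (n.-tuple T0).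

Lemma measurable_sample_mean d' (T : measurableType d') (D : T -> nT)
    (f : T -> T0 -> R) :
  measurable_fun setT D -> measurable_fun setT (fun z : T * T0 => f z.1 z.2) ->
  measurable_fun setT (fun t => sample_mean (D t) (f t)).
Proof.
move=> mD mf; apply: measurable_funM; first exact: measurable_cst.
apply: measurable_sum => i.
apply: (measurableT_comp mf (g := fun t => (t, tnth (D t) i))).
apply/measurable_fun_pairP; split; first exact: measurable_id.
exact: (measurableT_comp (measurable_tnth i) mD).
Qed.

Lemma measurable_series_estimator U j d' (T : measurableType d') (D : T -> nT)
    (x : T -> d.-tuple R) : (J0 <= j)%N -> measurable_fun [set: T0] U ->
  measurable_fun setT D -> measurable_fun setT x ->
  measurable_fun setT (fun t => series_estimator W U j (D t) (x t)).
Proof.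
move=> J mU mD mx; apply: (@measurable_sample_mean _ _ _ (fun t o => U o * proj_kernel W j (covX o) (x t))) => //.
apply: measurable_funM; first exact: (measurableT_comp mU measurable_snd).
apply: (proj1 (bmeas_proj_kernel W_cdv J _ _)).
  exact: (measurableT_comp (@measurable_covX R d) measurable_snd).
exact: (measurableT_comp mx measurable_fst).
Qed.

Lemma bmeas_series_estimator_fixed U j (D : nT) : (J0 <= j)%N ->
  bmeas (fun x => series_estimator W U j D x).
Proof.
move=> J; apply: bmeasM; first exact: bmeas_cst.
apply: bmeas_sum => i; apply: bmeasM; first exact: bmeas_cst.
by apply: (bmeas_proj_kernel W_cdv J); [exact: measurable_cst|exact: measurable_id].
Qed.

Lemma measurable_inner_estimator U j d' (T : measurableType d') (D : T -> nT) f :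
  (J0 <= j)%N -> measurable_fun [set: T0] U -> measurable_fun setT D -> bmeas f ->
  measurable_fun setT (fun t => inner (series_estimator W U j (D t)) f).
Proof.
move=> J mU mD bf; under eq_fun do rewrite (inner_series_estimator W_cdv U J)//.
apply: (@measurable_sample_mean _ _ _ (fun _ o => U o * projV W j f (covX o))) => //.
apply: (measurableT_comp _ measurable_snd (f := fun o => U o * projV W j f (covX o))).
apply: measurable_funM => //.
by have [] := bmeas_covX (bmeas_projV W_cdv f J).
Qed.

Lemma measurable_cross (U V : T0 -> R) j1 j2 d' (T : measurableType d') (E1 E2 : T -> nT) :
  (J0 <= j1)%N -> (J0 <= j2)%N ->
  measurable_fun setT U -> measurable_fun setT V ->
  measurable_fun setT E1 -> measurable_fun setT E2 ->
  measurable_fun setT (fun t => inner (series_estimator W U j1 (E1 t))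
    (series_estimator W V j2 (E2 t))).
Proof.
move=> J1 J2 mU mV m1 m2.
under eq_fun => t do rewrite innerC (inner_series_estimator W_cdv V J2 (E2 t)
  (bmeas_series_estimator_fixed U (E1 t) J1)).
apply: (@measurable_sample_mean _ _ _
  (fun t o => V o * projV W j2 (series_estimator W U j1 (E1 t)) (covX o))) => //.
apply: measurable_funM; first exact: (measurableT_comp mV measurable_snd).
apply: measurable_sum => m; apply: measurable_funM.
  apply: (measurable_inner_estimator (D := fun t => E1 t.1)) => //.
    exact: (measurableT_comp m1 measurable_fst).
  exact: (bmeas_Phi W_cdv m).
apply: (measurableT_comp (proj1 (bmeas_Phi W_cdv m J2))).
exact: (measurableT_comp (@measurable_covX R d) measurable_snd).
Qed.

Let mA := @measurable_varA R d.
Let mY := @measurable_varY R d.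

Let mAY : measurable_fun [set: 4.-tuple nT]
  (fun w => sample_mean (D3 w) (fun o => varA o * varY o)).
Proof.
apply: (@measurable_sample_mean _ _ _ (fun _ o => varA o * varY o)).
  exact: measurable_D3.
apply: measurable_funM; first exact: (measurableT_comp mA measurable_snd).
exact: (measurableT_comp mY measurable_snd).
Qed.

Variables (j1 j2 : nat).
Hypotheses (J1 : (J0 <= j1)%N) (J2 : (J0 <= j2)%N).

Lemma measurable_psi_INT :
  measurable_fun [set: 4.-tuple nT] (@psi_INT R d W n j1 j2).
Proof.
apply: measurable_funB; first exact: mAY.
apply: measurable_cross => //; [exact: measurable_D1|exact: measurable_D2].
Qed.

Let mphat (D : 4.-tuple nT -> nT) : measurable_fun setT D ->
  measurable_fun setT (fun z : 4.-tuple nT * T0 => phat W j1 (D z.1) (covX z.2)).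
Proof.
move=> mD; apply: (measurable_series_estimator (D := fun z => D z.1)) => //.
  exact: (measurableT_comp mD measurable_fst).
exact: (measurableT_comp (@measurable_covX R d) measurable_snd).
Qed.

Let mbhat (D : 4.-tuple nT -> nT) : measurable_fun setT D ->
  measurable_fun setT (fun z : 4.-tuple nT * T0 => bhat W j2 (D z.1) (covX z.2)).
Proof.
move=> mD; apply: (measurable_series_estimator (D := fun z => D z.1)) => //.
  exact: (measurableT_comp mD measurable_fst).
exact: (measurableT_comp (@measurable_covX R d) measurable_snd).
Qed.

Lemma measurable_psi_MC :
  measurable_fun [set: 4.-tuple nT] (@psi_MC R d W n j1 j2).
Proof.
apply: measurable_funB; first exact: mAY.
apply: (@measurable_sample_mean _ _ _
  (fun w o => phat W j1 (D1 w) (covX o) * bhat W j2 (D2 w) (covX o))).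
  exact: measurable_D4.
apply: measurable_funM; first exact: (mphat (@measurable_D1 R d n)).
exact: (mbhat (@measurable_D2 R d n)).
Qed.

Lemma measurable_psi_IF :
  measurable_fun [set: 4.-tuple nT] (@psi_IF R d W n j1 j2).
Proof.
apply: (@measurable_sample_mean _ _ _
  (fun w o => (varA o - phat W j1 (D1 w) (covX o)) *
              (varY o - bhat W j2 (D2 w) (covX o)))).
  exact: measurable_D3.
apply: measurable_funM; apply: measurable_funB.
- exact: (measurableT_comp mA measurable_snd).
- exact: (mphat (@measurable_D1 R d n)).
- exact: (measurableT_comp mY measurable_snd).
- exact: (mbhat (@measurable_D2 R d n)).
Qed.

End measurability.

Section estimators.
Context (R : realType) (d S J0 : nat) (W : wavelets R d).
Hypothesis W_cdv : cdv_basis W S J0.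
Local Notation T0 := (d.-tuple R * R * R)%type.
Variables (P : probability T0 R) (a y : T0 -> R) (p b : d.-tuple R -> R) (B : R).
Hypothesis RM : regression_model P a y p b B.
Hypothesis P_ae : {ae P, forall o, varA o = a o /\ varY o = y o}.
Hypothesis psiE : psi P = \int[P]_o (a o * y o) - inner p b.
Variables (n j1 j2 : nat).
Hypotheses (n0 : (0 < n)%N) (J1 : (J0 <= j1)%N) (J2 : (J0 <= j2)%N).
Variable C : R.
Hypothesis C_gt0 : 0 < C.
Hypothesis geom : level_bounds J0 W C.
Local Notation nT := (n.-tuple T0).
Local Notation Q := (prob_pow P n).
Local Notation law := (sample_law n P).
Local Notation k1 := ((2 ^ (j1 * d))%:R : R).
Local Notation k2 := ((2 ^ (j2 * d))%:R : R).

Let ba := rm_ma RM.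
Let bY := rm_my RM.
Let aB := rm_a RM.
Let yB := rm_y RM.
Let B0 : 0 <= B. Proof. exact: le_trans (aB point). Qed.
Let ni0 : 0 <= n%:R^-1 :> R. Proof. by rewrite invr_ge0. Qed.
Let bay : bmeas (fun o : T0 => a o * y o). Proof. exact: bmeasM. Qed.

Let e := \int[P]_o (a o * y o).
Let mean_ay (E : nT) : R := sample_mean E (fun o => a o * y o).
Let stat lam (E1 E2 E3 : nT) : R := resid_stat W a y j1 j2 lam E1 E2 E3.
Let center lam : R := resid_center W P a y p b j1 j2 lam.

Definition clip_INT (w : 4.-tuple nT) : R :=
  mean_ay (D3 w) - cross W a y j1 j2 (D1 w) (D2 w).
Definition clip_MC (w : 4.-tuple nT) : R :=
  mean_ay (D3 w) - stat 0 (D1 w) (D2 w) (D4 w).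
Definition clip_IF (w : 4.-tuple nT) : R := stat 1 (D1 w) (D2 w) (D3 w).

Let good (w : 4.-tuple nT) := forall r i,
  varA (tnth (tnth w r) i) = a (tnth (tnth w r) i) /\
  varY (tnth (tnth w r) i) = y (tnth (tnth w r) i).

Let good_ae : {ae law, forall w, good w}.
Proof. exact: samples_ae P_ae. Qed.

Let good_A w r x : good w ->
  series_estimator W (@varA R d) j1 (tnth w r) x = est_p W a j1 (tnth w r) x.
Proof.
by move=> gw; congr (_ * _); apply: eq_bigr => i _; have [-> _] := gw r i.
Qed.

Let good_Y w r x : good w ->
  series_estimator W (@varY R d) j2 (tnth w r) x = est_b W y j2 (tnth w r) x.
Proof.
by move=> gw; congr (_ * _); apply: eq_bigr => i _; have [_ ->] := gw r i.
Qed.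

Let good_AY w : good w ->
  sample_mean (D3 w) (fun o => varA o * varY o) = mean_ay (D3 w).
Proof.
by move=> gw; congr (_ * _); apply: eq_bigr => i _; have [-> ->] := gw (inord 2) i.
Qed.

Let INT_ae : {ae law, forall w, psi_INT W j1 j2 w = clip_INT w}.
Proof.
apply: filterS good_ae => w gw; rewrite /psi_INT /clip_INT good_AY//.
by congr (_ - _); apply: ex_eq => x; rewrite [phat _ _ _ _]good_A// [bhat _ _ _ _]good_Y.
Qed.

Let MC_ae : {ae law, forall w, psi_MC W j1 j2 w = clip_MC w}.
Proof.
apply: filterS good_ae => w gw; rewrite /psi_MC /clip_MC good_AY//.
congr (_ - _ * _); apply: eq_bigr => i _.
rewrite [phat _ _ _ _]good_A// [bhat _ _ _ _]good_Y//.
by rewrite /resid_prod /resid_p /resid_b/= !mul0r !sub0r mulrNN.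
Qed.

Let IF_ae : {ae law, forall w, psi_IF W j1 j2 w = clip_IF w}.
Proof.
apply: filterS good_ae => w gw; rewrite /psi_IF /clip_IF.
congr (_ * _); apply: eq_bigr => i _.
rewrite [phat _ _ _ _]good_A// [bhat _ _ _ _]good_Y//.
by rewrite /resid_prod /resid_p /resid_b/= !mul1r; have [-> ->] := gw (inord 2) i.
Qed.

Let m1 := @measurable_D1 R d n.
Let m2 := @measurable_D2 R d n.
Let m3 := @measurable_D3 R d n.
Let m4 := @measurable_D4 R d n.

Let bmean (D : 4.-tuple nT -> nT) : measurable_fun setT D ->
  bmeas (fun w => mean_ay (D w)).
Proof.
move=> mD; apply: (bmeas_sample_mean (f := fun _ o => a o * y o)) => //.
exact: (bmeas_comp bay measurable_snd).
Qed.

Let bcross : bmeas (fun w : 4.-tuple nT => cross W a y j1 j2 (D1 w) (D2 w)).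
Proof.
apply: (bmeas_comp (bmeas_cross W_cdv RM n J1 J2) (g := fun w => (D1 w, D2 w))).
by apply/measurable_fun_pairP; split; [exact: m1|exact: m2].
Qed.

Let bstat lam (D : 4.-tuple nT -> nT) : measurable_fun setT D ->
  bmeas (fun w => stat lam (D1 w) (D2 w) (D w)).
Proof.
move=> mD; apply: (bmeas_sample_mean
  (f := fun w o => resid_prod W a y j1 j2 lam (D1 w) (D2 w) o)) => //.
apply: (bmeas_comp (bmeas_resid_prod W_cdv RM n J1 J2 lam)
  (g := fun z => ((D1 z.1, D2 z.1), z.2))).
apply/measurable_fun_pairP; split; last exact: measurable_snd.
apply/measurable_fun_pairP; split.
  exact: (measurableT_comp m1 measurable_fst).
exact: (measurableT_comp m2 measurable_fst).
Qed.

Let bINT : bmeas clip_INT.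
Proof. by apply: bmeasB; [exact: bmean|exact: bcross]. Qed.
Let bMC : bmeas clip_MC.
Proof. by apply: bmeasB; [exact: bmean|exact: bstat]. Qed.
Let bIF : bmeas clip_IF.
Proof. exact: bstat. Qed.

Let ex_mean : \int[law]_w mean_ay (D3 w) = e.
Proof.
rewrite (ex_samples P (F := fun _ _ E3 _ => mean_ay E3) (bmean m3)).
transitivity (\int[Q]_E3 mean_ay E3); last exact: ex_sample_mean.
rewrite -[RHS](ex_cst Q); apply: ex_eq => E1; rewrite -[RHS](ex_cst Q).
by apply: ex_eq => E2; apply: ex_eq => E3; rewrite ex_cst.
Qed.

Let ex_mean_sqr : \int[law]_w (mean_ay (D3 w) - e) ^+ 2 <= n%:R^-1 * B ^+ 4.
Proof.
rewrite (ex_samples P (F := fun _ _ E3 _ => (mean_ay E3 - e) ^+ 2)); last first.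
  by apply: bmeas_sqr; apply: bmeasB; [exact: bmean|exact: bmeas_cst].
rewrite [X in X <= _](_ : _ = \int[Q]_E3 (mean_ay E3 - e) ^+ 2); last first.
  rewrite -[RHS](ex_cst Q); apply: ex_eq => E1; rewrite -[RHS](ex_cst Q).
  by apply: ex_eq => E2; apply: ex_eq => E3; rewrite ex_cst.
rewrite [leLHS](ex_sample_mean_sqr P bay)// subrr expr0n/= addr0 ler_wpM2l//.
rewrite lerBlDr; apply: (@le_trans _ _ (B ^+ 4)); last by rewrite lerDl sqr_ge0.
apply: ex_le_cst => [|o]; first exact: bmeas_sqr.
rewrite -real_normK ?num_real// normrM (_ : B ^+ 4 = (B * B) ^+ 2); last by ring.
by rewrite lerXn2r ?nnegrE ?mulr_ge0// ler_pM.
Qed.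

Let ex_law_cross : \int[law]_w cross W a y j1 j2 (D1 w) (D2 w) = cross_mean W p b j1 j2.
Proof.
rewrite (ex_samples P (F := fun E1 E2 _ _ => cross W a y j1 j2 E1 E2) bcross).
rewrite -(ex_cross W_cdv RM n0 J1 J2).
by apply: ex_eq => E1; apply: ex_eq => E2; rewrite !ex_cst.
Qed.

Let ex_law_cross_sqr :
  \int[law]_w (cross W a y j1 j2 (D1 w) (D2 w) - cross_mean W p b j1 j2) ^+ 2 <=
  cross_var_bound d B n j1 j2 C.
Proof.
rewrite (ex_samples P (F := fun E1 E2 _ _ =>
  (cross W a y j1 j2 E1 E2 - cross_mean W p b j1 j2) ^+ 2)); last first.
  by apply: bmeas_sqr; apply: bmeasB; [exact: bcross|exact: bmeas_cst].
have := ex_cross_sqr W_cdv RM n0 J1 J2 geom; apply: le_trans.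
rewrite le_eqVlt; apply/orP; left; apply/eqP.
by apply: ex_eq => E1; apply: ex_eq => E2; rewrite !ex_cst.
Qed.

Let ex_law_stat3 (lam : R) f : bmeas (fun w => f (stat lam (D1 w) (D2 w) (D3 w))) ->
  \int[law]_w f (stat lam (D1 w) (D2 w) (D3 w)) =
  \int[Q]_E1 \int[Q]_E2 \int[Q]_E f (stat lam E1 E2 E).
Proof.
move=> bf; rewrite [LHS](ex_samples P (F := fun E1 E2 E3 _ => f (stat lam E1 E2 E3)) bf).
by apply: ex_eq => E1; apply: ex_eq => E2; apply: ex_eq => E3; rewrite ex_cst.
Qed.

Let ex_law_stat4 (lam : R) f : bmeas (fun w => f (stat lam (D1 w) (D2 w) (D4 w))) ->
  \int[law]_w f (stat lam (D1 w) (D2 w) (D4 w)) =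
  \int[Q]_E1 \int[Q]_E2 \int[Q]_E f (stat lam E1 E2 E).
Proof.
move=> bf; rewrite [LHS](ex_samples P (F := fun E1 E2 _ E4 => f (stat lam E1 E2 E4)) bf).
by apply: ex_eq => E1; apply: ex_eq => E2; rewrite ex_cst.
Qed.

Let ex_sqrB_le (f g : 4.-tuple nT -> R) (u v : R) : bmeas f -> bmeas g ->
  \int[law]_w ((f w - g w) - (u - v)) ^+ 2 <=
  2 * \int[law]_w (f w - u) ^+ 2 + 2 * \int[law]_w (g w - v) ^+ 2.
Proof.
move=> bf bg.
have b1 := bmeas_sqr (bmeasB bf (bmeas_cst _ u)).
have b2 := bmeas_sqr (bmeasB bg (bmeas_cst _ v)).
have b3 := bmeasM (bmeas_cst _ 2) b1; have b4 := bmeasM (bmeas_cst _ 2) b2.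
rewrite -(exZ law _ b1) -(exZ law _ b2) -(exD law b3 b4).
apply: ex_le => [|//|w].
- exact: (bmeas_sqr (bmeasB (bmeasB bf bg) (bmeas_cst _ _))).
- exact: (bmeasD b3 b4).
rewrite -subr_ge0 [X in 0 <= X](_ : _ = ((f w - u) + (g w - v)) ^+ 2) ?sqr_ge0//.
by ring.
Qed.

Let bias_minn : cross_mean W p b j1 j2 = coarse W (minn j1 j2) p b.
Proof. exact: (inner_projV2 W_cdv J1 J2 (rm_mp RM) (rm_mb RM)). Qed.

Let center0 : center 0 = cross_mean W p b j1 j2.
Proof. by rewrite /center /resid_center expr0n/= !mul0r !subr0 add0r. Qed.

Let center1 : center 1 - psi P = inner p b - coarse W (maxn j1 j2) p b.
Proof.
rewrite -(inner_sub_projV2 W_cdv J1 J2 (rm_mp RM) (rm_mb RM)) psiE.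
rewrite /center /resid_center /cross_mean expr1n !mul1r -/e.
by rewrite (innerC p (projV _ _ _)) (innerC b (projV _ _ _)); ring.
Qed.

Let INT_moments := estimator_moments (psi P)
  (@measurable_psi_INT _ _ _ _ _ W_cdv n _ _ J1 J2) bINT INT_ae.
Let MC_moments := estimator_moments (psi P)
  (@measurable_psi_MC _ _ _ _ _ W_cdv n _ _ J1 J2) bMC MC_ae.
Let IF_moments := estimator_moments (psi P)
  (@measurable_psi_IF _ _ _ _ _ W_cdv n _ _ J1 J2) bIF IF_ae.

Let ex_INT : \int[law]_w clip_INT w = e - cross_mean W p b j1 j2.
Proof. by rewrite exB; [rewrite ex_mean ex_law_cross|exact: bmean|exact: bcross]. Qed.

Let ex_MC : \int[law]_w clip_MC w = e - center 0.
Proof.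
rewrite exB; [|exact: bmean|exact: bstat]; rewrite ex_mean.
by rewrite (ex_law_stat4 (f := id)) ?(ex_resid_stat W_cdv RM n0 J1 J2)//; exact: bstat.
Qed.

Let ex_IF : \int[law]_w clip_IF w = center 1.
Proof.
by rewrite (ex_law_stat3 (f := id)) ?(ex_resid_stat W_cdv RM n0 J1 J2)//; exact: bstat.
Qed.

Lemma INT_bias : abs_bias (@psi_INT R d W n j1 j2) P =
  `|inner p b - coarse W (minn j1 j2) p b|%:E.
Proof.
have [E _] := INT_moments; rewrite /abs_bias [X in `|X|%E]E ex_INT bias_minn psiE.
by rewrite /= -/e; congr (`|_|%:E); ring.
Qed.

Lemma MC_bias : abs_bias (@psi_MC R d W n j1 j2) P =
  `|inner p b - coarse W (minn j1 j2) p b|%:E.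
Proof.
have [E _] := MC_moments; rewrite /abs_bias [X in `|X|%E]E ex_MC center0 bias_minn psiE.
by rewrite /= -/e; congr (`|_|%:E); ring.
Qed.

Lemma IF_bias : abs_bias (@psi_IF R d W n j1 j2) P =
  `|inner p b - coarse W (maxn j1 j2) p b|%:E.
Proof.
by have [E _] := IF_moments; rewrite /abs_bias [X in `|X|%E]E ex_IF center1.
Qed.

Lemma INT_var_le : (var (@psi_INT R d W n j1 j2) P <=
  (2 * (n%:R^-1 * B ^+ 4) + 2 * cross_var_bound d B n j1 j2 C)%:E)%E.
Proof.
have [_ V] := INT_moments; rewrite /var V lee_fin ex_INT.
apply: le_trans (ex_sqrB_le _ _ (bmean m3) bcross) _.
by rewrite lerD// ler_wpM2l.
Qed.

Let stat_bound : R :=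
  n%:R^-1 * (pointwise_const d B C ^+ 2 * (1 + k1 / n%:R) * (1 + k2 / n%:R)) +
  resid_mean_bound d B n j1 j2 C.

Let ex_stat_sqr lam : 0 <= lam <= 1 ->
  \int[Q]_E1 \int[Q]_E2 \int[Q]_E (stat lam E1 E2 E - center lam) ^+ 2 <= stat_bound.
Proof. exact: (ex_resid_stat_center W_cdv RM n0 J1 J2 C_gt0 geom). Qed.

Lemma MC_var_le : (var (@psi_MC R d W n j1 j2) P <=
  (2 * (n%:R^-1 * B ^+ 4) + 2 * stat_bound)%:E)%E.
Proof.
have [_ V] := MC_moments; rewrite /var V lee_fin ex_MC.
apply: le_trans (ex_sqrB_le _ _ (bmean m3) (bstat 0 m4)) _.
rewrite lerD// ler_wpM2l//.
rewrite (ex_law_stat4 (f := fun x => (x - center 0) ^+ 2)); last first.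
  by apply: bmeas_sqr; apply: bmeasB; [exact: bstat|exact: bmeas_cst].
by apply: ex_stat_sqr; rewrite lexx ler01.
Qed.

Lemma IF_var_le : (var (@psi_IF R d W n j1 j2) P <= stat_bound%:E)%E.
Proof.
have [_ V] := IF_moments; rewrite /var V lee_fin ex_IF.
rewrite (ex_law_stat3 (f := fun x => (x - center 1) ^+ 2)); last first.
  by apply: bmeas_sqr; apply: bmeasB; [exact: bstat|exact: bmeas_cst].
by apply: ex_stat_sqr; rewrite lexx ler01.
Qed.

Section lower_bounds.
Variable c0 : R.
Hypothesis c0_ge0 : 0 <= c0.
Hypothesis S_gt0 : (0 < S)%N.
Hypothesis a2 : forall phi, bmeas phi -> (forall x, 0 <= phi x) ->
  c0 * \int[unif R d]_x phi x <= \int[P]_o (a o ^+ 2 * phi (covX o)).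
Hypothesis y2 : forall phi, bmeas phi -> (forall x, 0 <= phi x) ->
  c0 * \int[unif R d]_x phi x <= \int[P]_o (y o ^+ 2 * phi (covX o)).
Local Notation low := (sq_low d B n C c0).
Hypotheses (l1 : 0 <= low k1) (l2 : 0 <= low k2).

Let center_le lam : 0 <= lam <= 1 -> `|center lam| <= 4 * B ^+ 2.
Proof.
move=> /andP[lam0 lam1].
have i (f g : d.-tuple R -> R) : bmeas f -> bmeas g -> inner f f <= B ^+ 2 -> inner g g <= B ^+ 2 ->
    `|inner f g| <= B ^+ 2.
  move=> bf bg fB gB; rewrite -ler_sqr ?nnegrE ?sqr_ge0// real_normK ?num_real//.
  apply: le_trans (inner_Cauchy_Schwarz bf bg) _.
  by rewrite [leRHS]expr2 ler_pM ?inner_ge0.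
have pr j (f : d.-tuple R -> R) : (J0 <= j)%N -> bmeas f -> inner f f <= B ^+ 2 ->
    inner (projV W j f) (projV W j f) <= B ^+ 2.
  by move=> J bf; apply: le_trans; exact: (projV_sqr_le W_cdv).
have bp := rm_mp RM; have bb := rm_mb RM.
have pB : inner p p <= B ^+ 2 by apply: inner_le_norm => //; exact: rm_p RM.
have bB : inner b b <= B ^+ 2 by apply: inner_le_norm => //; exact: rm_b RM.
have b1 := bmeas_projV W_cdv p J1; have b2 := bmeas_projV W_cdv b J2.
have h1 := i _ _ b2 bp (pr _ _ J2 bb bB) pB.
have h2 := i _ _ b1 bb (pr _ _ J1 bp pB) bB.
have h3 := i _ _ b1 b2 (pr _ _ J1 bp pB) (pr _ _ J2 bb bB).
have h4 : `|e| <= B ^+ 2.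
  apply: le_trans (ex_abs P bay) _; apply: ex_le_cst => [|o]; first exact: bmeas_norm.
  by rewrite normrM expr2 ler_pM.
have ll x : `|x| <= B ^+ 2 -> `|lam * x| <= B ^+ 2.
  move=> xB; rewrite normrM ger0_norm//; apply: le_trans xB.
  by rewrite -[leRHS]mul1r ler_wpM2r.
rewrite /center /resid_center -/e expr2 -mulrA.
have {}h4 := ll _ (ll _ h4); have {}h1 := ll _ h1; have {}h2 := ll _ h2.
rewrite (_ : 4 * B ^+ 2 = B ^+ 2 + B ^+ 2 + B ^+ 2 + B ^+ 2); last by ring.
apply: le_trans (ler_normD _ _) _; apply: lerD => //.
apply: le_trans (ler_normB _ _) _; apply: lerD => //.
by apply: le_trans (ler_normB _ _) _; apply: lerD.
Qed.

(** The conditional second moment, less what the conditional mean and its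
    center can take away. *)
Definition var_low : R :=
  n%:R^-1 * (low k1 * low k2 - 2 * resid_mean_bound d B n j1 j2 C - 32 * B ^+ 4).

Let stat_var_ge lam (c : nT -> nT -> R) : 0 <= lam <= 1 ->
  bmeas (fun z => c z.1 z.2) ->
  var_low <= \int[Q]_E1 \int[Q]_E2 \int[Q]_E (stat lam E1 E2 E - c E1 E2) ^+ 2.
Proof.
move=> lam01 bc.
apply: le_trans (resid_stat_var_ge W_cdv RM n0 J1 J2 C_gt0 geom lam01 c0_ge0 S_gt0 a2 y2 bc l1 l2).
rewrite ler_wpM2l// lerD2l lerN2.
rewrite (_ : 32 * B ^+ 4 = 2 * (4 * B ^+ 2) ^+ 2); last by ring.
by rewrite ler_wpM2l// -real_normK ?num_real// lerXn2r ?nnegrE ?mulr_ge0 ?sqr_ge0// center_le.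
Qed.

Lemma IF_var_ge : (var_low%:E <= var (@psi_IF R d W n j1 j2) P)%E.
Proof.
have [_ V] := IF_moments; rewrite /var V lee_fin ex_IF.
rewrite (ex_law_stat3 (f := fun x => (x - center 1) ^+ 2)); last first.
  by apply: bmeas_sqr; apply: bmeasB; [exact: bstat|exact: bmeas_cst].
apply: stat_var_ge; first by rewrite lexx ler01.
exact: bmeas_cst.
Qed.

(** The variance is at least its mean conditional value given the first three
    samples, and conditionally the estimator is a mean of n independent
    terms. *)
Lemma MC_var_ge : (var_low%:E <= var (@psi_MC R d W n j1 j2) P)%E.
Proof.
have [_ V] := MC_moments; rewrite /var V lee_fin ex_MC.
set m := e - center 0.
pose rm := resid_mean W P a y p b j1 j2 0 (n := n).
have lam0 : 0 <= (0 : R) <= 1 by rewrite lexx ler01.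
have brm := bmeas_resid_mean W_cdv RM n J1 J2 0.
have brmw : bmeas (fun w : 4.-tuple nT => rm (D1 w) (D2 w)).
  apply: (bmeas_comp brm (g := fun w => (D1 w, D2 w))).
  by apply/measurable_fun_pairP; split; [exact: m1|exact: m2].
have bs := bmeasB (bstat 0 m4) brmw.
have bt := bmeasB (bmeasB (bmean m3) (bmeas_cst _ m)) brmw.
have cross0 : \int[law]_w ((stat 0 (D1 w) (D2 w) (D4 w) - rm (D1 w) (D2 w)) *
    (mean_ay (D3 w) - m - rm (D1 w) (D2 w))) = 0.
  rewrite (ex_samples P (F := fun E1 E2 E3 E4 => (stat 0 E1 E2 E4 - rm E1 E2) *
    (mean_ay E3 - m - rm E1 E2)) (bmeasM bs bt)).
  rewrite -[RHS](ex_cst Q); apply: ex_eq => E1; rewrite -[RHS](ex_cst Q).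
  apply: ex_eq => E2; rewrite -[RHS](ex_cst Q); apply: ex_eq => E3.
  have bp12 : bmeas (resid_prod W a y j1 j2 0 E1 E2 : T0 -> R).
    apply: (bmeas_comp (bmeas_resid_prod W_cdv RM n J1 J2 0) (g := fun o => ((E1, E2), o))).
    exact: measurable_pair1.
  have b12 : bmeas (fun E4 : nT => stat 0 E1 E2 E4).
    apply: (bmeas_sample_mean (f := fun _ o => resid_prod W a y j1 j2 0 E1 E2 o)).
      exact: measurable_id.
    exact: (bmeas_comp bp12 measurable_snd).
  under ex_eq do rewrite mulrC.
  rewrite (exZ Q _ (bmeasB b12 (bmeas_cst _ (rm E1 E2)))).
  rewrite (exB Q b12 (bmeas_cst _ (rm E1 E2))) ex_cst ex_sample_mean//.
  by rewrite (ex_resid_prod W_cdv RM J1 J2) subrr mulr0.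
apply: (@le_trans _ _ (\int[law]_w (stat 0 (D1 w) (D2 w) (D4 w) - rm (D1 w) (D2 w)) ^+ 2)).
  rewrite (ex_samples P (F := fun E1 E2 _ E4 => (stat 0 E1 E2 E4 - rm E1 E2) ^+ 2) (bmeas_sqr bs)).
  apply: le_trans (stat_var_ge lam0 brm) _.
  rewrite le_eqVlt; apply/orP; left; apply/eqP.
  by apply: ex_eq => E1; apply: ex_eq => E2; rewrite ex_cst.
have b2 := bmeasM (bmeas_cst _ (- 2)) (bmeasM bs bt).
rewrite [leRHS](_ : _ = \int[law]_w ((stat 0 (D1 w) (D2 w) (D4 w) - rm (D1 w) (D2 w)) ^+ 2 +
   ((mean_ay (D3 w) - m - rm (D1 w) (D2 w)) ^+ 2 +
   - 2 * ((stat 0 (D1 w) (D2 w) (D4 w) - rm (D1 w) (D2 w)) *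
    (mean_ay (D3 w) - m - rm (D1 w) (D2 w)))))); last first.
  by apply: ex_eq => w; rewrite /clip_MC; ring.
rewrite (exD law (bmeas_sqr bs) (bmeasD (bmeas_sqr bt) b2)).
rewrite (exD law (bmeas_sqr bt) b2) (exZ law _ (bmeasM bs bt)) cross0 mulr0 addr0.
by rewrite lerDl ex_ge0.
Qed.

End lower_bounds.
End estimators.

(** * A function with prescribed wavelet coefficients *)

Section geometric_series.
Context (R : realType).

Lemma geometric_small (r c : R) : 0 < r < 1 -> 0 <= c ->
  forall e, 0 < e -> exists N0, forall N, (N0 <= N)%N -> c * r ^+ N <= e.
Proof.
move=> /andP[r0 r1] c0 e e0.
have c1 : 0 < c + 1 by rewrite ltr_wpDl.
have /cvgrPdist_le/(_ (e / (c + 1))) : r ^+ N @[N --> \oo] --> (0 : R).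
  by apply: cvg_expr; rewrite ger0_norm// ltW.
rewrite divr_gt0// => /(_ isT) [N0 _ hN]; exists N0 => N /hN /=.
rewrite sub0r normrN ger0_norm ?exprn_ge0 ?(ltW r0)// ler_pdivlMr// => h.
apply: le_trans h; rewrite mulrC ler_wpM2l ?exprn_ge0 ?(ltW r0)//.
by rewrite lerDl.
Qed.

Lemma geometric_eq0 (r c x : R) N0 : 0 < r < 1 -> 0 <= c ->
  (forall N, (N0 <= N)%N -> `|x| <= c * r ^+ N) -> x = 0.
Proof.
move=> r01 c0 h; apply/eqP; rewrite -normr_le0; apply/ler_addgt0Pr => e e0.
have [N1 hN] := geometric_small r01 c0 e0; rewrite add0r.
apply: le_trans (hN (maxn N0 N1) (leq_maxr _ _)); apply: h.
exact: leq_maxl.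
Qed.

(** Geometric domination makes the series converge uniformly, with an explicit
    error for the partial sums. *)
Lemma geometric_limit d (T : measurableType d) (g : nat -> T -> R) (A r : R) :
  0 <= A -> 0 < r < 1 -> (forall l, measurable_fun setT (g l)) ->
  (forall l x, `|g l x| <= A * r ^+ l) ->
  exists2 f : T -> R, bmeas f &
    forall N x, `|f x - \sum_(l < N) g l x| <= A * r ^+ N / (1 - r).
Proof.
move=> A0 r01 mg gA; have /andP[r0 r1] := r01.
have tail N m x : `|\sum_(l < N + m) g l x - \sum_(l < N) g l x| <=
    A * r ^+ N / (1 - r).
  have -> : \sum_(l < N + m) g l x = \sum_(l < N) g l x + \sum_(i < m) g (N + i)%N x.
    by rewrite big_split_ord.
  rewrite addrC addKr; apply: le_trans (ler_norm_sum _ _ _) _.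
  apply: (@le_trans _ _ (\sum_(i < m) A * r ^+ N * r ^+ i)).
    by apply: ler_sum => i _; rewrite -mulrA -exprD.
  by rewrite -mulr_sumr ler_wpM2l ?geometric_sum_le// mulr_ge0// exprn_ge0// ltW.
have cv x : cvgn (fun N => \sum_(l < N) g l x).
  have -> : (fun N => \sum_(l < N) g l x) = series (g^~ x).
    by apply/funext => N; rewrite /series/= big_mkord.
  apply: normed_cvg; apply: (series_le_cvg (v_ := fun l => A * r ^+ l)).
  - by move=> l; exact: normr_ge0.
  - by move=> l; rewrite mulr_ge0// exprn_ge0// ltW.
  - by move=> l; exact: gA.
  - by apply: is_cvg_geometric_series; rewrite ger0_norm// ltW.
pose f x := limn (fun N => \sum_(l < N) g l x).
have fE N x : `|f x - \sum_(l < N) g l x| <= A * r ^+ N / (1 - r).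
  apply/ler_addgt0Pr => e e0.
  have /cvgrPdist_le/(_ e e0) [N0 _ hN] := cv x.
  have {}hN := hN (N + N0)%N (leq_addl _ _).
  rewrite (_ : _ - _ = (\sum_(l < N + N0) g l x - \sum_(l < N) g l x) +
    (f x - \sum_(l < N + N0) g l x)); last by ring.
  by apply: le_trans (ler_normD _ _) _; apply: lerD.
exists f => //; split.
  apply: (measurable_fun_cvg (h := fun N x => \sum_(l < N) g l x)).
    by move=> N; apply: measurable_sum.
  by move=> x _; exact: cv.
exists (A / (1 - r)) => x; have := fE 0%N x.
by rewrite big_ord0 subr0 expr0 mulr1.
Qed.

End geometric_series.

Section uniform_continuity.
Context (R : realType) (d : nat).
Implicit Types f g : d.-tuple R -> R.

Lemma ucont_cubeD f g : ucont_cube f -> ucont_cube g ->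
  ucont_cube (fun x => f x + g x).
Proof.
move=> uf ug e e0; have e2 : 0 < e / 2 by rewrite divr_gt0.
have [r r0 hr] := uf _ e2; have [s s0 hs] := ug _ e2.
exists (Num.min r s); first by rewrite lt_min r0.
move=> x y xc yc xy.
have h1 : `|f x - f y| < e / 2 by apply: hr => // i; rewrite (lt_le_trans (xy i))// ge_min lexx.
have h2 : `|g x - g y| < e / 2 by apply: hs => // i; rewrite (lt_le_trans (xy i))// ge_min lexx orbT.
rewrite (_ : _ - _ = (f x - f y) + (g x - g y)); last by ring.
by apply: le_lt_trans (ler_normD _ _) _; lra.
Qed.

Lemma ucont_cube_cst (c : R) : ucont_cube (fun _ : d.-tuple R => c).
Proof. by move=> e e0; exists 1 => // x y _ _ _; rewrite subrr normr0. Qed.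

Lemma ucont_cubeZ (c : R) f : ucont_cube f -> ucont_cube (fun x => c * f x).
Proof.
move=> uf e e0; have c1 : 0 < `|c| + 1 by rewrite ltr_wpDl.
have [r r0 hr] := uf (e / (`|c| + 1)) (divr_gt0 e0 c1).
exists r => // x y xc yc xy; rewrite -mulrBr normrM.
have := hr x y xc yc xy; rewrite ltr_pdivlMr// => h.
by apply: le_lt_trans h; rewrite mulrC ler_wpM2l// lerDl.
Qed.

Lemma ucont_cube_sum (I : Type) (s : seq I) (F : I -> d.-tuple R -> R) :
  (forall i, ucont_cube (F i)) -> ucont_cube (fun x => \sum_(i <- s) F i x).
Proof.
move=> uF; elim: s => [|i s IHs].
  by under [X in ucont_cube X]eq_fun do rewrite big_nil; exact: ucont_cube_cst.
by under [X in ucont_cube X]eq_fun do rewrite big_cons; exact: ucont_cubeD.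
Qed.

Lemma ucont_cube_lipschitz (h : R -> R) f : (forall s t, `|h s - h t| <= `|s - t|) ->
  ucont_cube f -> ucont_cube (fun x => h (f x)).
Proof.
move=> lip uf e e0; have [r r0 hr] := uf e e0; exists r => // x y xc yc xy.
exact: le_lt_trans (lip _ _) (hr _ _ xc yc xy).
Qed.

Lemma ucont_cube_limit (f : d.-tuple R -> R) :
  (forall e, 0 < e -> exists2 g, ucont_cube g & forall x, `|f x - g x| <= e) ->
  ucont_cube f.
Proof.
move=> lim e e0; have e4 : 0 < e / 4 by rewrite divr_gt0.
have [g ug fg] := lim _ e4; have [r r0 hr] := ug _ e4; exists r => // x y xc yc xy.
have := hr _ _ xc yc xy; have := fg x; have := fg y; rewrite (distrC (f y)).
rewrite (_ : f x - f y = (f x - g x) + (g x - g y) + (g y - f y)); last by ring.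
move=> h1 h2 h3; apply: le_lt_trans (ler_normD _ _) _.
by have := ler_normD (f x - g x) (g x - g y); lra.
Qed.

Lemma clip_lipschitz (lo hi s t : R) : lo <= hi ->
  `|clip lo hi s - clip lo hi t| <= `|s - t|.
Proof.
rewrite /clip => lohi; rewrite ler_norml.
have := ler_norm (s - t); have := ler_norm (t - s); rewrite (distrC t).
rewrite !maxEle !minEle.
by case: (leP s hi) => ?; case: (leP t hi) => ?; repeat case: ifPn; rewrite -?ltNge => *; apply/andP; split; lra.
Qed.

End uniform_continuity.

Section wave.
Context (R : realType) (d S J0 : nat) (W : wavelets R d).
Hypothesis W_cdv : cdv_basis W S J0.
Variable C : R.
Hypothesis C_gt0 : 0 < C.
Hypothesis geom : level_bounds J0 W C.
Variable i0 : details d.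

Lemma V_ucont j g : (J0 <= j)%N -> V W j g -> ucont_cube g.
Proof.
move=> J [c ->]; have [_ _ am _ _] := geom J.
by apply: ucont_cube_sum => m; apply: ucont_cubeZ; have [] := am m.
Qed.

Let bump (l : nat) (x : d.-tuple R) : R := \sum_(m : Z W l) Psi i0 m x.

Let bbump l : (J0 <= l)%N -> bmeas (bump l).
Proof. by move=> J; apply: bmeas_sum => m; exact: (bmeas_Psi W_cdv). Qed.

Let bump_le l x : (J0 <= l)%N ->
  `|bump l x| <= C ^+ 2 * Num.sqrt (2 ^ (l * d))%:R.
Proof.
move=> J; have [_ _ _ am /(_ x)[_ cx]] := geom J.
rewrite /bump; under eq_bigr do rewrite -[Psi _ _ _]mul1r.
rewrite -[leRHS]mul1r; apply: overlap_sum => //.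
- exact: ltW.
- by move=> m; have [_ _ _ + _] := am i0 m; apply.
- by move=> m _; rewrite normr1.
Qed.

Let bump_same l i (m : Z W l) : (J0 <= l)%N ->
  inner (bump l) (Psi i m) = (i == i0)%:R.
Proof.
move=> J; rewrite inner_suml; [|by move=> m'; exact: (bmeas_Psi W_cdv)|exact: (bmeas_Psi W_cdv)].
rewrite (bigD1 m)//= (Psi_orthonormal W_cdv)// big1 ?addr0 => [|m' m'm].
  by rewrite xpair_eqE eqxx andbT eq_sym.
by rewrite (Psi_orthonormal W_cdv)// xpair_eqE (negPf m'm) andbF.
Qed.

Let bump_diff l l' i (m : Z W l) : (J0 <= l)%N -> (J0 <= l')%N -> l' <> l ->
  inner (bump l') (Psi i m) = 0.
Proof.
move=> J J' ll; rewrite inner_suml; [|by move=> m'; exact: (bmeas_Psi W_cdv)|exact: (bmeas_Psi W_cdv)].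
by apply: big1 => m' _; exact: (Psi_orthogonal W_cdv).
Qed.

Let bump_Phi l' (m : Z W J0) : (J0 <= l')%N -> inner (bump l') (Phi m) = 0.
Proof.
move=> J'; rewrite inner_suml; [|by move=> m'; exact: (bmeas_Psi W_cdv)|exact: (bmeas_Phi W_cdv)].
by apply: big1 => m' _; rewrite innerC; exact: (Phi_Psi_orthogonal W_cdv).
Qed.

(** A function whose wavelet coefficients of type [i0] all have the largest
    size that the Hoelder ball of smoothness [al] allows, up to a factor. *)
Lemma wave_exists (al : R) : 0 < al -> exists f : d.-tuple R -> R,
  [/\ bmeas f, ucont_cube f,
      forall x, `|f x| <= C ^+ 2 / (1 - decay al),
      forall l i (m : Z W l), (J0 <= l)%N ->
        inner f (Psi i m) = (i == i0)%:R / weight d al l &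
      forall m : Z W J0, inner f (Phi m) = 0].
Proof.
move=> al0; have r01 : 0 < decay al < 1 by rewrite decay_gt0 decay_lt1.
have /andP[r0 r1] := r01.
pose g l x := if (J0 <= l)%N then (weight d al l)^-1 * bump l x else 0.
have bg l : bmeas (g l).
  rewrite /g; case: leqP => [J|_]; last exact: bmeas_cst.
  by apply: bmeasM; [exact: bmeas_cst|exact: bbump].
have gA l x : `|g l x| <= C ^+ 2 * decay al ^+ l.
  rewrite /g; case: leqP => [J|_]; last first.
    by rewrite normr0 mulr_ge0 ?sqr_ge0// exprn_ge0// ltW.
  have w0 := weight_gt0 d al l.
  rewrite normrM ger0_norm ?invr_ge0 ?(ltW w0)// -(sqrt_res_weight d).
  rewrite mulrCA ler_wpM2l ?invr_ge0 ?(ltW w0)//; exact: bump_le.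
have [f bf fg] := geometric_limit (sqr_ge0 C) r01 (fun l => proj1 (bg l)) gA.
have bS N : bmeas (fun x => \sum_(l < N) g l x) by apply: bmeas_sum => l; exact: bg.
(* A coefficient is the limit of those of the partial sums. *)
have coef (h : d.-tuple R -> R) (v : R) N0 : bmeas h ->
    (forall N, (N0 <= N)%N -> \sum_(l < N) inner (g l) h = v) -> inner f h = v.
  move=> bh hv; apply/eqP; rewrite -subr_eq0; apply/eqP.
  have I0 : 0 <= \int[unif R d]_x `|h x| by apply: ex_ge0.
  apply: (@geometric_eq0 _ _ (C ^+ 2 / (1 - decay al) * \int[unif R d]_x `|h x|) _ N0 r01).
    by rewrite mulr_ge0// divr_ge0 ?sqr_ge0// subr_ge0 ltW.
  move=> N N0N; rewrite -(hv N N0N) -inner_suml// -innerBl//.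
  have bd : bmeas (fun x => f x - \sum_(l < N) g l x) by exact: bmeasB.
  apply: le_trans (inner_norm_le bd bh (fg N)) _.
  by rewrite le_eqVlt; apply/orP; left; apply/eqP; ring.
have gPsi l' l i (m : Z W l) : (J0 <= l)%N ->
    inner (g l') (Psi i m) = (l' == l)%:R * ((i == i0)%:R / weight d al l).
  move=> J; have bP := bmeas_Psi W_cdv i m J; rewrite /g; case: (leqP J0 l') => J'.
    have bb := bbump J'; rewrite innerZl//.
    have [e|/eqP ll] := eqVneq l' l; last by rewrite bump_diff// mulr0 mul0r.
    by rewrite mul1r mulrC; subst l'; rewrite bump_same.
  rewrite (_ : inner _ _ = 0); last first.
    by rewrite -[RHS](ex_cst (unif R d)); apply: ex_eq => x; rewrite mul0r.
  by rewrite ltn_eqF ?mul0r//; exact: leq_trans J' J.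
exists f; split=> //.
- apply: ucont_cube_limit => e e0.
  have [|N hN] := geometric_small (c := C ^+ 2 / (1 - decay al)) r01 _ e0.
    by rewrite divr_ge0 ?sqr_ge0// subr_ge0 ltW.
  exists (fun x => \sum_(l < N) g l x).
    apply: ucont_cube_sum => l; rewrite /g; case: leqP => [J|_]; last exact: ucont_cube_cst.
    apply: ucont_cubeZ; apply: ucont_cube_sum => m.
    by have [_ _ _ /(_ i0 m)[]] := geom J.
  move=> x; apply: le_trans (fg N x) _; rewrite mulrAC; exact: hN.
- by move=> x; have := fg 0%N x; rewrite big_ord0 subr0 expr0 mulr1.
- move=> l i m J; apply: (coef _ _ l.+1); first exact: (bmeas_Psi W_cdv).
  move=> N lN; rewrite (bigD1 (Ordinal lN))//= gPsi// eqxx mul1r big1 ?addr0// => l' l'l.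
  rewrite gPsi// (_ : (l' : nat) == l = false) ?mul0r//.
  by apply: contraNF l'l => /eqP e; apply/eqP/val_inj.
- move=> m; apply: (coef _ _ 0%N); first exact: (bmeas_Phi W_cdv).
  move=> N _; apply: big1 => l _; rewrite /g; case: leqP => J.
    by rewrite innerZl ?bump_Phi ?mulr0//; [exact: bbump|exact: (bmeas_Phi W_cdv)].
  by rewrite -[RHS](ex_cst (unif R d)); apply: ex_eq => x; rewrite mul0r.
Qed.

End wave.

Lemma details_inhabited d : (0 < d)%N -> details d.
Proof.
move=> d0; exists [ffun=> true]; apply/eqP => /ffunP /(_ (Ordinal d0)).
by rewrite !ffunE.
Qed.

(** * Room in the model for a perturbation *)

Section holder_norm.
Context (R : realType) (d J0 : nat) (W : wavelets R d).
Implicit Types h : d.-tuple R -> R.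

Definition coarse_norm (a : R) h : R :=
  weight d a J0 * \big[Num.max/0]_(m : Z W J0) `|inner h (Phi m)|.

Lemma holder_norm_ge a h (M : R) l i (m : Z W l) : (J0 <= l)%N ->
  (holder_norm W J0 a h <= M%:E)%E ->
  coarse_norm a h + weight d a l * `|inner h (Psi i m)| <= M.
Proof.
move=> J hM; rewrite -lee_fin; apply: le_trans hM; rewrite EFinD leeD2l//.
by apply: ereal_sup_ubound; exists l, m, i.
Qed.

Lemma holder_norm_le a h (M : R) :
  (forall l i (m : Z W l), (J0 <= l)%N ->
    coarse_norm a h + weight d a l * `|inner h (Psi i m)| <= M) ->
  (holder_norm W J0 a h <= M%:E)%E.
Proof.
move=> hM; rewrite /holder_norm -/(coarse_norm a h) -leeBrDl//.
apply: ge_ereal_sup => t [l [m [i [J ->]]]].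
by rewrite -EFinB lee_fin lerBrDl; exact: hM.
Qed.

Lemma coarse_norm_le a h (c : R) : 0 <= c ->
  (forall m : Z W J0, weight d a J0 * `|inner h (Phi m)| <= c) ->
  coarse_norm a h <= c.
Proof.
move=> c0 hc; rewrite /coarse_norm; have w0 := weight_gt0 d a J0.
rewrite mulrC -ler_pdivlMr//; apply: bigmax_le => [|m _].
  by rewrite divr_ge0// ltW.
by rewrite ler_pdivlMr// mulrC.
Qed.

Lemma le_coarse_norm a h (m : Z W J0) :
  weight d a J0 * `|inner h (Phi m)| <= coarse_norm a h.
Proof.
rewrite /coarse_norm ler_wpM2l ?(ltW (weight_gt0 _ _ _))//.
exact: (le_bigmax_cond _ (fun m : Z W J0 => `|inner h (Phi m)|)).
Qed.

Lemma coarse_norm_ge0 a h : 0 <= coarse_norm a h.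
Proof.
rewrite mulr_ge0 ?(ltW (weight_gt0 _ _ _))//.
by apply: (big_ind (fun x => 0 <= x)) => // x y x0 y0; rewrite le_max x0.
Qed.

End holder_norm.

Section perturbation.
Context (R : realType) (d S J0 : nat) (W : wavelets R d).
Hypothesis W_cdv : cdv_basis W S J0.
Variable C : R.
Hypothesis C_gt0 : 0 < C.
Hypothesis geom : level_bounds J0 W C.
Hypothesis S_gt0 : (0 < S)%N.
Variable i0 : details d.
Variables (al M' M lo hi : R) (p0 : d.-tuple R -> R).
Hypotheses (al0 : 0 < al) (MM : M' < M) (lohi : lo < hi).
Hypothesis mp0 : measurable_fun setT p0.
Hypothesis p0_holder : holder_ball W J0 al M' p0.
Local Notation p1 := (clip_fun lo hi p0).
Hypothesis p0_clip : forall f, bmeas f -> inner p0 f = inner p1 f.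

(** Smoothing [p0] by its projection onto a fine [V J] and pulling it slightly
    towards the constant (lo + hi)/2 makes room, both in the interval and in
    the Hoelder ball, for a small multiple of a function with large
    coefficients at every level. *)
Lemma perturbation_exists : exists J lo' hi' tau (u v : d.-tuple R -> R),
  [/\ (J0 <= J)%N, lo < lo', lo' <= hi', hi' < hi & 0 < tau] /\
  [/\ bmeas v, V W J u,
    forall l i (m : Z W l), (J0 <= l)%N ->
      inner v (Psi i m) = (i == i0)%:R / weight d al l,
    forall s x, `|s| <= tau -> cube x -> lo' <= u x + s * v x <= hi' &
    forall s, `|s| <= tau ->
      holder_ball W J0 al M (fun x => clip lo' hi' (u x + s * v x))].
Proof.
have [v [bv uv vA vPsi vPhi]] := wave_exists W_cdv C_gt0 geom i0 al0.
set A := C ^+ 2 / _ in vA.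
have A0 : 0 <= A by apply: le_trans (vA point).
have [e1 e1V e1E] := one_in_V W_cdv S_gt0 (leqnn J0).
have be1 := V_bmeas W_cdv (leqnn J0) e1V.
pose mid := (lo + hi) / 2.
have bme : bmeas (fun x => mid * e1 x) by apply: bmeasM => //; exact: bmeas_cst.
pose Nc := coarse_norm J0 W al (fun x => mid * e1 x).
have Nc0 : 0 <= Nc by exact: coarse_norm_ge0.
have den0 : 0 < 4 * (`|M'| + Nc + 1).
  by rewrite mulr_gt0// ltr_wpDl// addr_ge0.
have MM0 : 0 < M - M' by rewrite subr_gt0.
(* Pulling by [eps] gains eps (hi - lo)/2 at both ends of the range; the
   projection error and the perturbation cost at most a quarter of that each.
   In the Hoelder ball they cost at most half of M - M'. *)
pose eps := Num.min 2^-1 ((M - M') / (4 * (`|M'| + Nc + 1))).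
have eps0 : 0 < eps by rewrite lt_min invr_gt0 ltr0n divr_gt0.
have eps2 : eps <= 2^-1 by rewrite ge_min lexx.
have epsM : eps * (`|M'| + Nc) <= (M - M') / 4.
  have : eps * (4 * (`|M'| + Nc + 1)) <= M - M'.
    by rewrite -ler_pdivlMr// ge_min lexx orbT.
  by have := eps0; have := Nc0; have := normr_ge0 M'; lra.
pose eta0 := eps * (hi - lo) / 8.
have eta00 : 0 < eta0 by rewrite divr_gt0// mulr_gt0// subr_gt0.
have bp1 : bmeas p1 by apply: bmeas_clip => //; exact: ltW.
have p1itv x : lo <= p1 x <= hi by apply: clip_itv; exact: ltW.
have up1 : ucont_cube p1.
  apply: ucont_cube_lipschitz => [s t|]; first by apply: clip_lipschitz; exact: ltW.
  by case: p0_holder.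
pose L := projV_norm d C; have L0 : 0 <= L by exact: projV_norm_ge0.
have eta1 : 0 < eta0 / (L + 1) by rewrite divr_gt0// ltr_wpDl.
have [r r0 hr] := up1 _ eta1.
have r2 : 0 < r / 2 by rewrite divr_gt0.
have half : 0 < (2^-1 : R) < 1 by rewrite invr_gt0 ltr0n invf_lt1// ltr1n.
have C2 : 0 <= 2 * C by rewrite mulr_ge0// ltW.
have [N1 hN] := geometric_small half C2 r2.
pose J := maxn J0 N1; have J0J : (J0 <= J)%N := leq_maxl _ _.
have pJ x : cube x -> `|projV W J p1 x - p1 x| <= eta0.
  move=> xc; apply: (@le_trans _ _ (eta0 / (L + 1) * L)); last first.
    by rewrite mulrAC ler_pdivrMr ?ltr_wpDl// ler_wpM2l ?(ltW eta00)// lerDl.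
  apply: (projV_approx W_cdv C_gt0 geom) => //; first exact: ltW.
  move=> y yc yx; apply/ltW/hr => // i; apply: le_lt_trans (yx i) _.
  have := hN J (leq_maxr _ _); rewrite exprVn -natrX => h.
  by apply: le_lt_trans h _; rewrite ltr_pdivrMr// ltr_pMr// ltr1n.
pose tau := Num.min (eta0 / (A + 1)) ((M - M') / 4).
have tau0 : 0 < tau.
  by rewrite lt_min; apply/andP; split; apply: divr_gt0 => //; rewrite ltr_wpDl.
have tauA : tau * A <= eta0.
  apply: (@le_trans _ _ (eta0 / (A + 1) * A)).
    by rewrite ler_wpM2r// ge_min lexx.
  by rewrite mulrAC ler_pdivrMr ?ltr_wpDl// ler_wpM2l ?(ltW eta00)// lerDl.
have tauM : tau <= (M - M') / 4 by rewrite ge_min lexx orbT.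
pose u x := (1 - eps) * projV W J p1 x + eps * (mid * e1 x).
have bpJ := bmeas_projV W_cdv p1 J0J.
have bu : bmeas u by rewrite /u; bm.
pose lo' := lo + eps * (hi - lo) / 4; pose hi' := hi - eps * (hi - lo) / 4.
have ehl : 0 < eps * (hi - lo) by rewrite mulr_gt0// subr_gt0.
have lo'hi' : lo' <= hi'.
  have : eps * (hi - lo) <= 2^-1 * (hi - lo) by rewrite ler_wpM2r// subr_ge0 ltW.
  by rewrite /lo' /hi'; have := lohi; lra.
have range s x : `|s| <= tau -> cube x -> lo' <= u x + s * v x <= hi'.
  move=> st xc; have sv : `|s * v x| <= eta0.
    rewrite normrM; apply: le_trans tauA; apply: ler_pM => //.
  move: sv (pJ x xc) (p1itv x); rewrite !ler_norml => /andP[v1 v2] /andP[q1 q2] /andP[t1 t2].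
  have e1' : 0 <= 1 - eps by have := eps2; lra.
  have w1 : (1 - eps) * (lo - eta0) <= (1 - eps) * projV W J p1 x.
    by rewrite ler_wpM2l//; lra.
  have w2 : (1 - eps) * projV W J p1 x <= (1 - eps) * (hi + eta0).
    by rewrite ler_wpM2l//; lra.
  have ee : 0 <= eps * eta0 by rewrite mulr_ge0// ltW.
  rewrite /u e1E// mulr1; move: w1 w2 ee v1 v2; rewrite /lo' /hi' /mid /eta0 => w1 w2 ee v1 v2.
  apply/andP; split; lra.
exists J, lo', hi', tau, u, v; split.
  by split=> //; rewrite /lo' /hi'; have := ehl; lra.
have uV : V W J u.
  have [c1 c1E] := projV_in_V W J p1.
  have [c2 c2E] := V_sub W_cdv (j := J0) (j' := J) (introT andP (conj (leqnn J0) J0J)) e1V.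
  exists (fun m => (1 - eps) * c1 m + eps * mid * c2 m); apply/funext => x.
  rewrite /u c1E c2E !mulr_sumr -big_split/=; apply: eq_bigr => m _; ring.
split=> //.
move=> s st; split.
  apply: ucont_cube_lipschitz => [a b|]; first exact: clip_lipschitz.
  apply: ucont_cubeD; last exact: ucont_cubeZ.
  exact: (V_ucont geom J0J uV).
pose q x := clip lo' hi' (u x + s * v x).
have qE f : (forall x, ~ cube x -> f x = 0) -> bmeas f ->
    inner q f = (1 - eps) * inner (projV W J p1) f + eps * inner (fun x => mid * e1 x) f +
      s * inner v f.
  move=> f0 bf; have b1 : bmeas (fun x => (1 - eps) * projV W J p1 x) by bm.
  have b2 : bmeas (fun x => eps * (mid * e1 x)) by bm.
  have b3 : bmeas (fun x => s * v x) by bm.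
  rewrite -(innerZl (1 - eps) bpJ bf) -(innerZl eps bme bf) -(innerZl s bv bf).
  rewrite -(innerDl b1 b2 bf) -(innerDl (bmeasD b1 b2) b3 bf).
  apply: ex_eq => x; have [xc|xc] := pselect (cube x); last by rewrite f0// !mulr0.
  by rewrite /q clip_id// range.
have Phi0 j (m : Z W j) : (J0 <= j)%N -> forall x, ~ cube x -> Phi m x = 0.
  by move=> Jj; apply: (V_cube0 W_cdv Jj); exact: Phi_in_V.
have Psi0 j i (m : Z W j) : (J0 <= j)%N -> forall x, ~ cube x -> Psi i m x = 0.
  by move=> Jj; have [_ _ _ /(_ i m)[]] := geom Jj.
have bPhi j (m : Z W j) : (J0 <= j)%N -> bmeas (Phi m) by exact: (bmeas_Phi W_cdv).
have bPsi j i (m : Z W j) : (J0 <= j)%N -> bmeas (Psi i m) by exact: (bmeas_Psi W_cdv).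
have oPhi (m m' : Z W J) : inner (Phi m) (Phi m') = (m == m')%:R.
  exact: (Phi_orthonormal W_cdv).
have bPhiJ (m : Z W J) : bmeas (Phi m) by exact: bPhi.
have inV f : bmeas f -> V W J f -> inner (projV W J p1) f = inner p0 f.
  move=> bf fV; rewrite p0_clip// /projV (inner_projC bPhiJ)//.
  by rewrite (oproj_id bPhiJ oPhi fV).
have qPhi (m : Z W J0) : weight d al J0 * `|inner q (Phi m)| <=
    (1 - eps) * coarse_norm J0 W al p0 + eps * Nc.
  rewrite (qE _ (Phi0 _ _ _) (bPhi _ _ _))// vPhi mulr0 addr0.
  rewrite inV//; [|exact: bPhi|]; last first.
    by apply: (V_sub W_cdv (j := J0) (j' := J)); [rewrite leqnn|exact: Phi_in_V].
  have := le_coarse_norm al p0 m; have := le_coarse_norm al (fun x => mid * e1 x) m.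
  rewrite -/Nc; set w := weight _ _ _; have w0 : 0 < w by exact: weight_gt0.
  set x1 := inner _ _; set x2 := inner _ _ => h1 h2.
  have e1' : 0 <= 1 - eps by have := eps2; lra.
  apply: (@le_trans _ _ ((1 - eps) * (w * `|x2|) + eps * (w * `|x1|))).
    rewrite [leRHS](_ : _ = w * ((1 - eps) * `|x2| + eps * `|x1|)); last by ring.
    rewrite ler_wpM2l ?(ltW w0)//; apply: le_trans (ler_normD _ _) _.
    by rewrite !normrM (ger0_norm e1') (ger0_norm (ltW eps0)).
  by rewrite lerD// ler_wpM2l// ltW.
have qPsi l i (m : Z W l) : (J0 <= l)%N -> weight d al l * `|inner q (Psi i m)| <=
    (1 - eps) * (weight d al l * `|inner p0 (Psi i m)|) + tau.
  move=> J0l; rewrite (qE _ (Psi0 _ _ _ _) (bPsi _ _ _ _))// vPsi//.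
  have -> : inner (fun x => mid * e1 x) (Psi i m) = 0.
    rewrite innerZl ?(V_Psi_orthogonal W_cdv i m (j := J0)) ?mulr0// ?leqnn//.
    exact: bPsi.
  have pl : `|inner (projV W J p1) (Psi i m)| <= `|inner p0 (Psi i m)|.
    have [lJ|Jl] := ltnP l J.
      rewrite inV//; first exact: bPsi.
      apply: (V_sub W_cdv (j := l.+1) (j' := J)); first by rewrite leqW.
      rewrite (multiresolution W_cdv)//; exists (fun z => (z == inr (i, m))%:R).
      apply/funext => x; rewrite (bigD1 (inr (i, m)))//= eqxx mul1r big1 ?addr0// => z zm.
      by rewrite (negPf zm) mul0r.
    rewrite (V_Psi_orthogonal W_cdv i m (j := J)) ?normr0 ?J0J//.
    exact: projV_in_V.
  set w := weight _ _ _; have w0 : 0 < w by exact: weight_gt0.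
  have e1' : 0 <= 1 - eps by have := eps2; lra.
  rewrite mulr0 addr0; set x1 := inner (projV _ _ _) _ in pl *; set x2 := inner p0 _ in pl *.
  apply: (@le_trans _ _ (w * ((1 - eps) * `|x2| + tau / w))).
    rewrite ler_wpM2l ?(ltW w0)//; apply: le_trans (ler_normD _ _) _; apply: lerD.
      by rewrite normrM (ger0_norm e1') ler_wpM2l.
    rewrite normrM normrM normfV (ger0_norm (ltW w0)).
    apply: ler_pM => //; first by rewrite divr_ge0// ltW.
    by rewrite ler_pdivrMr// mulVf ?gt_eqF// normr_nat lern1 leq_b1.
  rewrite le_eqVlt; apply/orP; left; apply/eqP.
  by field; rewrite gt_eqF.
apply: holder_norm_le => l i m J0l.
have e1' : 0 <= 1 - eps by have := eps2; lra.
have h1 : coarse_norm J0 W al q <= (1 - eps) * coarse_norm J0 W al p0 + eps * Nc.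
  apply: coarse_norm_le qPhi; apply: addr_ge0; apply: mulr_ge0 => //.
    exact: coarse_norm_ge0.
  exact: ltW.
have h2 := qPsi l i m J0l.
have h3 : (1 - eps) * (coarse_norm J0 W al p0 + weight d al l * `|inner p0 (Psi i m)|) <=
    (1 - eps) * M'.
  by rewrite ler_wpM2l//; apply: holder_norm_ge => //; case: p0_holder.
have h4 : - eps * M' <= eps * `|M'|.
  by rewrite mulNr -mulrN ler_wpM2l ?(ltW eps0)// -normrN ler_norm.
move: h1 h2 h3 h4 epsM tauM MM0; rewrite -/q.
set X := coarse_norm _ _ _ q; set X0 := coarse_norm _ _ _ p0.
set Y := _ * `|inner q _|; set Y0 := _ * `|inner p0 _|.
by move=> *; lra.
Qed.

End perturbation.

(** * Laws with two-valued responses and given regression functions *)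

Section two_point.
Context (R : realType) (d : nat).
Local Notation T0 := (d.-tuple R * R * R)%type.
Local Notation O := (d.-tuple R * R)%type.
Variables (lo hi : R).
Hypothesis lohi : lo < hi.

Let hl : 0 < hi - lo. Proof. by rewrite subr_gt0. Qed.

(** Given [x], the value is [hi] with the probability that makes the mean
    [g x]. *)
Definition up_set (g : d.-tuple R -> R) : set O :=
  [set z | z.2 < (g z.1 - lo) / (hi - lo)].
Definition two_point (g : d.-tuple R -> R) (z : O) : R :=
  lo + (hi - lo) * \1_(up_set g) z.

Section one_function.
Variables (g : d.-tuple R -> R) (del : R).
Hypothesis bg : bmeas g.
Hypothesis del0 : 0 <= del.
Hypothesis g_itv : forall x, lo + del * (hi - lo) <= g x <= hi - del * (hi - lo).

Let prob x := (g x - lo) / (hi - lo).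

Let prob_itv x : del <= prob x <= 1 - del.
Proof.
have /andP[h1 h2] := g_itv x; rewrite /prob ler_pdivlMr// ler_pdivrMr//.
by apply/andP; split; have := hl; lra.
Qed.

Let prob01 x : 0 <= prob x <= 1.
Proof. by have /andP[h1 h2] := prob_itv x; apply/andP; split; have := del0; lra. Qed.

Lemma measurable_up_set : measurable (up_set g).
Proof.
apply: measurable_set_ltr; first exact: measurable_snd.
have bpr : bmeas prob by rewrite /prob; bm.
exact: (measurableT_comp (proj1 bpr) measurable_fst).
Qed.

Lemma bmeas_two_point : bmeas (two_point g).
Proof.
apply: bmeasD; first exact: bmeas_cst.
by apply: bmeasM; [exact: bmeas_cst|apply: bmeas_indic; exact: measurable_up_set].
Qed.

Lemma two_point_itv z : lo <= two_point g z <= hi.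
Proof.
rewrite /two_point indicE; case: (_ \in _); rewrite ?mulr1 ?mulr0.
  by rewrite addrC subrK lexx (ltW lohi).
by rewrite addr0 lexx (ltW lohi).
Qed.

Let ex_up x : \int[unif01 R]_u (\1_(up_set g) (x, u) : R) = prob x.
Proof.
have ms : measurable [set u : R | u < prob x].
  by apply: measurable_set_ltr; [exact: measurable_id|exact: measurable_cst].
rewrite -[RHS](unif01_lt (prob01 x)) -(ex_indic (unif01 R) ms).
by apply: ex_eq => u; rewrite !indicE.
Qed.

Let bup x : bmeas (fun u : R => \1_(up_set g) (x, u) : R).
Proof.
by apply: (bmeas_comp (bmeas_indic R measurable_up_set)); exact: measurable_pair1.
Qed.

Lemma ex_two_point x : \int[unif01 R]_u two_point g (x, u) = g x.
Proof.
have b1 := bmeasM (bmeas_cst R (hi - lo)) (bup x).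
rewrite /two_point (exD _ (bmeas_cst R lo) b1) ex_cst (exZ _ _ (bup x)) ex_up.
by rewrite /prob; field; rewrite gt_eqF.
Qed.

(** Both endpoints have probability at least [del]. *)
Lemma ex_two_point_sqr x :
  del * (lo ^+ 2 + hi ^+ 2) <= \int[unif01 R]_u (two_point g (x, u) ^+ 2).
Proof.
have b1 := bmeasM (bmeas_cst R (hi ^+ 2 - lo ^+ 2)) (bup x).
rewrite (_ : (fun u => _) = fun u => lo ^+ 2 + (hi ^+ 2 - lo ^+ 2) * \1_(up_set g) (x, u)); last first.
  apply/funext => u; rewrite /two_point indicE; case: (_ \in _); rewrite ?mulr1 ?mulr0; ring.
rewrite (exD _ (bmeas_cst R (lo ^+ 2)) b1) ex_cst (exZ _ _ (bup x)) ex_up.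
have /andP[h1 h2] := prob_itv x.
have l2 : 0 <= lo ^+ 2 by [].
have r2 : 0 <= hi ^+ 2 by [].
have := mulr_ge0 l2 (_ : 0 <= 1 - del - prob x).
have := mulr_ge0 r2 (_ : 0 <= prob x - del).
by rewrite !subr_ge0 => /(_ h1) e1 /(_ h2) e2; lra.
Qed.

End one_function.

Variables (p b : d.-tuple R -> R) (del : R).
Hypotheses (bp : bmeas p) (bb : bmeas b) (del0 : 0 <= del).
Hypothesis p_itv : forall x, lo + del * (hi - lo) <= p x <= hi - del * (hi - lo).
Hypothesis b_itv : forall x, lo + del * (hi - lo) <= b x <= hi - del * (hi - lo).

Let G (z : O) : T0 := (z.1, two_point p z, two_point b z).

Let mG : measurable_fun setT G.
Proof.
apply/measurable_fun_pairP; split; last by case: (bmeas_two_point bb).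
apply/measurable_fun_pairP; split; first exact: measurable_fst.
by case: (bmeas_two_point bp).
Qed.

Let Gm : {mfun O >-> T0} := HB.pack G (@isMeasurableFun.Build _ _ _ _ _ mG).
Let base := (unif R d \x unif01 R)%E.

(** The covariate is uniform, and one further uniform variable drives both
    responses. *)
Definition two_point_law : probability T0 R := distribution base Gm.
Local Notation P := two_point_law.

Let ex_law (f : T0 -> R) : bmeas f ->
  \int[P]_o f o = \int[unif R d]_x \int[unif01 R]_u f (G (x, u)).
Proof.
move=> bf; transitivity (\int[base]_z f (G z)); first exact: (ex_distribution base Gm bf).
by rewrite ex_prod//; exact: (bmeas_comp bf mG).
Qed.

Lemma two_point_law_X B : measurable B -> P (@covX R d @^-1` B) = unif R d B.
Proof.
move=> mB; transitivity (base (B `*` setT)).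
  by congr (base _); apply/seteqP; split => -[x u] //= [].
by rewrite [LHS]product_measure1E// [X in (_ * X)%E](probability_setT (unif01 R)) mule1.
Qed.

Lemma two_point_law_range :
  {ae P, forall o, lo <= varA o <= hi /\ lo <= varY o <= hi}.
Proof.
have mI : measurable [set t : R | lo <= t <= hi].
  rewrite (_ : [set t | _] = `[lo, hi]%classic); first exact: measurable_itv.
  by apply/seteqP; split => x /=; rewrite in_itv.
pose N : set T0 := @varA R d @^-1` [set t | lo <= t <= hi] `&` @varY R d @^-1` [set t | lo <= t <= hi].
have mN : measurable N.
  by apply: measurableI; rewrite -[X in measurable X]setTI; [exact: measurable_varA|exact: measurable_varY].
exists (~` N); split; first exact: measurableC.
  transitivity (base set0); last exact: measure0.
  congr (base _); apply/seteqP; split => z //=; apply.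
  by split=> /=; exact: two_point_itv.
by move=> o /= no [h1 h2]; apply: no.
Qed.

Let clip_G g z : clip lo hi (two_point g z) = two_point g z.
Proof. by rewrite clip_id// two_point_itv. Qed.

Let ae := two_point_law_range.

Let condexp_two (U : T0 -> R) (g : d.-tuple R -> R) : bmeas U -> bmeas g ->
  (forall x, lo + del * (hi - lo) <= g x <= hi - del * (hi - lo)) ->
  (forall z, U (G z) = two_point g z) -> is_condexp P U g.
Proof.
move=> bU bg g_itv UG; split; first by case: bg.
  by apply: bmeas_integrable; exact: bmeas_covX.
move=> B mB; have mXB := measurable_covX_preimage mB.
have E f : bmeas f -> (\int[P]_(o in @covX R d @^-1` B) (f o)%:E)%E =
    (\int[P]_o (f o * \1_B (covX o)))%:E.
  move=> bf; rewrite integral_mkcond -EFin_ex; last first.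
    by apply: bmeasM => //; apply: bmeas_covX; exact: bmeas_indic.
  apply: eq_integral => o _; rewrite patchE indicE.
  rewrite (_ : (o \in _) = (covX o \in B)) ?in_setE//.
  by case: ifP => _; rewrite ?mulr1 ?mulr0.
rewrite !E//; last exact: bmeas_covX.
have bB := bmeas_covX (bmeas_indic R mB).
congr (_%:E); rewrite !ex_law; last 2 first.
- exact: bmeasM.
- by apply: bmeasM => //; exact: bmeas_covX.
apply: ex_eq => x; transitivity (\1_B x * g x); first by
  rewrite mulrC -[RHS](ex_cst (unif01 R)); apply: ex_eq => u.
transitivity (\int[unif01 R]_u (\1_B x * two_point g (x, u))); last first.
  by apply: ex_eq => u; rewrite UG mulrC.
rewrite exZ; first by rewrite (ex_two_point bg del0 g_itv).
by apply: (bmeas_comp (bmeas_two_point bg)); exact: measurable_pair1.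
Qed.

Lemma two_point_law_p : is_condexp P (@varA R d) p.
Proof.
have bc : bmeas (clipA lo hi : T0 -> R).
  by apply: bmeas_clip; [exact: ltW|exact: measurable_varA].
apply: (@is_condexp_ae _ _ _ (clipA lo hi)).
- by apply: filterS (clipA_ae ae) => o <-.
- by case: bc.
- exact: measurable_varA.
- by apply: condexp_two => // z; rewrite /clipA /varA /= clip_G.
Qed.

Lemma two_point_law_b : is_condexp P (@varY R d) b.
Proof.
have bc : bmeas (clipY lo hi : T0 -> R).
  by apply: bmeas_clip; [exact: ltW|exact: measurable_varY].
apply: (@is_condexp_ae _ _ _ (clipY lo hi)).
- by apply: filterS (clipY_ae ae) => o <-.
- by case: bc.
- exact: measurable_varY.
- by apply: condexp_two => // z; rewrite /clipY /varY /= clip_G.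
Qed.

Let second_moment (U : T0 -> R) (g : d.-tuple R -> R) : bmeas U -> bmeas g ->
  (forall x, lo + del * (hi - lo) <= g x <= hi - del * (hi - lo)) ->
  (forall z, U (G z) = two_point g z) ->
  forall phi, bmeas phi -> (forall x, 0 <= phi x) ->
  del * (lo ^+ 2 + hi ^+ 2) * \int[unif R d]_x phi x <=
  \int[P]_o (U o ^+ 2 * phi (covX o)).
Proof.
move=> bU bg g_itv UG phi bphi phi0.
rewrite ex_law; last by apply: bmeasM; [exact: bmeas_sqr|exact: bmeas_covX].
have b2 : bmeas (fun z : O => two_point g z ^+ 2) by apply: bmeas_sqr; exact: bmeas_two_point.
have b2x x : bmeas (fun u : R => two_point g (x, u) ^+ 2).
  by apply: (bmeas_comp b2); exact: measurable_pair1.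
rewrite -exZ//; apply: (@le_trans _ _ (\int[unif R d]_x (phi x *
    \int[unif01 R]_u (two_point g (x, u) ^+ 2)))).
  apply: ex_le => [||x]; [by bm| |].
    by apply: bmeasM => //; exact: (bmeas_ex (unif R d) (unif01 R) b2).
  by rewrite mulrC ler_wpM2l//; exact: (ex_two_point_sqr bg del0 g_itv).
rewrite le_eqVlt; apply/orP; left; apply/eqP; apply: ex_eq => x.
by rewrite -exZ//; apply: ex_eq => u; rewrite UG mulrC.
Qed.

Lemma two_point_law_A2 phi : bmeas phi -> (forall x, 0 <= phi x) ->
  del * (lo ^+ 2 + hi ^+ 2) * \int[unif R d]_x phi x <=
  \int[P]_o (clipA lo hi o ^+ 2 * phi (covX o)).
Proof.
apply: (second_moment (g := p)) => //.
  by apply: bmeas_clip; [exact: ltW|exact: measurable_varA].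
by move=> z; rewrite /clipA /varA /= clip_G.
Qed.

Lemma two_point_law_Y2 phi : bmeas phi -> (forall x, 0 <= phi x) ->
  del * (lo ^+ 2 + hi ^+ 2) * \int[unif R d]_x phi x <=
  \int[P]_o (clipY lo hi o ^+ 2 * phi (covX o)).
Proof.
apply: (second_moment (g := b)) => //.
  by apply: bmeas_clip; [exact: ltW|exact: measurable_varY].
by move=> z; rewrite /clipY /varY /= clip_G.
Qed.

End two_point.

(** * Uniform bounds over the model *)

Section arithmetic.
Context (R : realType).

Lemma res_minn j1 j2 d :
  minn (2 ^ (j1 * d)) (2 ^ (j2 * d)) = (2 ^ (minn j1 j2 * d))%N.
Proof.
wlog le12 : j1 j2 / (j1 <= j2)%N => [hw|].
  by case/orP: (leq_total j1 j2) => [|le21]; [exact: hw|rewrite minnC hw// minnC].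
have h : (2 ^ (j1 * d) <= 2 ^ (j2 * d))%N by rewrite leq_pexp2l// leq_mul2r le12 orbT.
by rewrite (minn_idPl h) (minn_idPl le12).
Qed.

Lemma res_maxn j1 j2 d :
  maxn (2 ^ (j1 * d)) (2 ^ (j2 * d)) = (2 ^ (maxn j1 j2 * d))%N.
Proof.
wlog le12 : j1 j2 / (j1 <= j2)%N => [hw|].
  by case/orP: (leq_total j1 j2) => [|le21]; [exact: hw|rewrite maxnC hw// maxnC].
have h : (2 ^ (j1 * d) <= 2 ^ (j2 * d))%N by rewrite leq_pexp2l// leq_mul2r le12 orbT.
by rewrite (maxn_idPr h) (maxn_idPr le12).
Qed.

Lemma INT_arith (B C x km : R) : 0 <= B -> 0 <= C -> 0 <= x -> 0 <= km ->
  2 * (x * B ^+ 4) + 2 * (B ^+ 4 * (2 * x + C * km * x ^+ 2)) <=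
  (B ^+ 4 * (6 + 2 * C) + 1) * (x + km * x ^+ 2).
Proof.
move=> B0 C0 x0 k0; rewrite -subr_ge0 [X in 0 <= X](_ : _ =
  B ^+ 4 * (6 * (km * x ^+ 2) + 2 * C * x) + x + km * x ^+ 2); last by ring.
by rewrite !(addr_ge0, mulr_ge0, exprn_ge0).
Qed.

Definition stat_const (B C pc : R) : R := 2 * pc ^+ 2 + 3 * B ^+ 4 * (4 + C) + 1.

Lemma stat_arith (B C pc x k1 k2 km kM : R) : 0 <= B -> 0 <= C -> 0 <= x ->
  0 <= k1 -> 0 <= k2 -> 0 <= km -> km <= kM -> k1 <= kM -> k2 <= kM ->
  x * (pc ^+ 2 * (1 + k1 * x) * (1 + k2 * x)) +
    3 * B ^+ 4 * (4 * x + C * km * x ^+ 2) <=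
  stat_const B C pc * (x + kM * x ^+ 2 + k1 * k2 * x ^+ 3).
Proof.
move=> B0 C0 x0 k10 k20 km0 kmM k1M k2M.
have kM0 : 0 <= kM := le_trans km0 kmM.
have B4 : 0 <= B ^+ 4 by rewrite exprn_ge0.
have x2 : 0 <= x ^+ 2 by [].
have h1 : pc ^+ 2 * (k1 * x ^+ 2) <= pc ^+ 2 * (kM * x ^+ 2).
  by rewrite ler_wpM2l// ler_wpM2r.
have h2 : pc ^+ 2 * (k2 * x ^+ 2) <= pc ^+ 2 * (kM * x ^+ 2).
  by rewrite ler_wpM2l// ler_wpM2r.
have h3 : 3 * B ^+ 4 * (C * (km * x ^+ 2)) <= 3 * B ^+ 4 * (C * (kM * x ^+ 2)).
  by rewrite ler_wpM2l ?mulr_ge0// ler_wpM2l// ler_wpM2r.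
apply: (@le_trans _ _ (pc ^+ 2 * (x + k1 * k2 * x ^+ 3) +
   (pc ^+ 2 * (kM * x ^+ 2) + pc ^+ 2 * (kM * x ^+ 2)) +
   (12 * B ^+ 4 * x + 3 * B ^+ 4 * (C * (kM * x ^+ 2))))).
  rewrite -subr_ge0 [X in 0 <= X](_ : _ =
    (pc ^+ 2 * (kM * x ^+ 2) - pc ^+ 2 * (k1 * x ^+ 2)) +
    (pc ^+ 2 * (kM * x ^+ 2) - pc ^+ 2 * (k2 * x ^+ 2)) +
    (3 * B ^+ 4 * (C * (kM * x ^+ 2)) - 3 * B ^+ 4 * (C * (km * x ^+ 2)))); last by ring.
  by apply: addr_ge0; [apply: addr_ge0|]; rewrite subr_ge0.
rewrite /stat_const -subr_ge0 [X in 0 <= X](_ : _ =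
  pc ^+ 2 * (x + k1 * k2 * x ^+ 3) +
  3 * B ^+ 4 * (4 * (kM * x ^+ 2) + C * x + (4 + C) * (k1 * k2 * x ^+ 3)) +
  (x + kM * x ^+ 2 + k1 * k2 * x ^+ 3)); last by ring.
by do ! [exact: sqr_ge0|exact: exprn_ge0|apply: addr_ge0|apply: mulr_ge0].
Qed.

(** Here x = 1/n and the resolutions exceed T n; the leading term of the
    variance dominates once [T] is large. *)
Lemma var_low_arith (B C ka BL x k1 k2 km T : R) :
  0 <= B -> 0 <= C -> 0 < ka -> 0 < x <= 1 -> 1 <= T ->
  2 * BL ^+ 2 <= ka * T -> 896 * B ^+ 4 <= ka ^+ 2 * T ->
  96 * C * B ^+ 4 <= ka ^+ 2 * T ->
  T <= k1 * x -> T <= k2 * x -> 0 <= km -> km * T <= k1 * k2 ->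
  [/\ 0 <= x * (ka * k1 - BL ^+ 2), 0 <= x * (ka * k2 - BL ^+ 2) &
  ka ^+ 2 / 8 * (k1 * k2 * x ^+ 3) <=
    x * ((x * (ka * k1 - BL ^+ 2)) * (x * (ka * k2 - BL ^+ 2)) -
      2 * (3 * B ^+ 4 * (4 * x + C * km * x ^+ 2)) - 32 * B ^+ 4)].
Proof.
move=> B0 C0 ka0 /andP[x0 x1] T1 TBL TB TC Tk1 Tk2 km0 kmT.
have B4 : 0 <= B ^+ 4 by rewrite exprn_ge0.
have half k : T <= k * x -> x * (ka * k) / 2 <= x * (ka * k - BL ^+ 2).
  move=> Tk; have k0 : 0 <= k by rewrite -(pmulr_lge0 _ x0); lra.
  have Tk' : T <= k by apply: le_trans Tk _; rewrite ler_piMr.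
  have : ka * T <= ka * k by rewrite ler_wpM2l// ltW.
  by move=> h; rewrite -mulrA ler_wpM2l ?(ltW x0)//; lra.
have := half k1 Tk1; have := half k2 Tk2.
set l1 := x * (ka * k1 - _); set l2 := x * (ka * k2 - _) => h2 h1.
have p k : T <= k * x -> 0 <= x * (ka * k) / 2.
  move=> Tk; have k0 : 0 <= k by rewrite -(pmulr_lge0 _ x0); lra.
  by rewrite divr_ge0// mulr_ge0 ?(ltW x0)// mulr_ge0// ltW.
have p1 := p _ Tk1; have p2 := p _ Tk2.
split; [exact: le_trans h1|exact: le_trans h2|].
have prod : (x * (ka * k1) / 2) * (x * (ka * k2) / 2) <= l1 * l2 by apply: ler_pM.
pose z := k1 * k2 * x ^+ 2.
have zT : T <= z.
  apply: (@le_trans _ _ (T * T)); first by rewrite ler_peMl//; lra.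
  rewrite /z (_ : k1 * k2 * x ^+ 2 = (k1 * x) * (k2 * x)); last by ring.
  by apply: ler_pM => //; lra.
(* Of the main term ka^2/4 z, the two errors take a sixteenth each. *)
have e1 : 56 * B ^+ 4 <= ka ^+ 2 / 16 * z.
  have : ka ^+ 2 * T <= ka ^+ 2 * z by rewrite ler_wpM2l.
  by lra.
have e2 : 6 * B ^+ 4 * (C * km * x ^+ 2) <= ka ^+ 2 / 16 * z.
  have : 96 * C * B ^+ 4 * (km * x ^+ 2) <= ka ^+ 2 * T * (km * x ^+ 2).
    by rewrite ler_wpM2r// mulr_ge0.
  have : ka ^+ 2 * (km * T * x ^+ 2) <= ka ^+ 2 * z.
    by rewrite ler_wpM2l// /z ler_wpM2r.
  by lra.
have e3 : 24 * B ^+ 4 * x <= 24 * B ^+ 4 by rewrite ler_piMr// mulr_ge0.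
rewrite (_ : ka ^+ 2 / 8 * _ = x * (ka ^+ 2 / 8 * z)); last by rewrite /z; ring.
rewrite ler_wpM2l ?(ltW x0)//.
have e4 : (x * (ka * k1) / 2) * (x * (ka * k2) / 2) = ka ^+ 2 / 4 * z.
  by rewrite /z; field.
move: prod e1 e2 e3; rewrite e4 => prod e1 e2 e3.
have -> : 2 * (3 * B ^+ 4 * (4 * x + C * km * x ^+ 2)) =
  24 * B ^+ 4 * x + 6 * B ^+ 4 * (C * km * x ^+ 2) by ring.
by lra.
Qed.

End arithmetic.

Section model_bounds.
Context (R : realType) (d S J0 : nat) (W : wavelets R d).
Hypothesis W_cdv : cdv_basis W S J0.
Variable C : R.
Hypothesis C_gt0 : 0 < C.
Hypothesis geom : level_bounds J0 W C.
Variables (al be M lo hi : R).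
Hypotheses (al0 : 0 < al) (be0 : 0 < be) (M0 : 0 < M) (lohi : lo < hi).
Local Notation T0 := (d.-tuple R * R * R)%type.
Local Notation B := (Num.max `|lo| `|hi|).
Local Notation pc := (pointwise_const d B C).
Local Notation k j := ((2 ^ (j * d))%:R : R).

Let B0 : 0 <= B. Proof. by rewrite le_max normr_ge0. Qed.

Definition bias_const : R :=
  #|details d|%:R * C * (M * M) / (1 - decay (al + be)).

Let decay01 : 0 < decay (al + be) < 1.
Proof. by rewrite decay_gt0 decay_lt1// addr_gt0. Qed.

Lemma bias_const_ge0 : 0 <= bias_const.
Proof.
have /andP[_ r1] := decay01.
by rewrite divr_ge0 ?subr_ge0 ?(ltW r1)// !mulr_ge0// ltW.
Qed.

Lemma truncation_le (p b : d.-tuple R -> R) j : (J0 <= j)%N ->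
  bmeas p -> bmeas b ->
  (forall l i (m : Z W l), (J0 <= l)%N -> `|inner p (Psi i m)| <= M / weight d al l) ->
  (forall l i (m : Z W l), (J0 <= l)%N -> `|inner b (Psi i m)| <= M / weight d be l) ->
  `|inner p b - coarse W j p b| <= bias_const * decay (al + be) ^+ j.
Proof.
move=> J bp bb hp hb; rewrite /bias_const mulrAC.
apply: (tail_le W_cdv J bp bb _ decay01) => [|l jl].
  by rewrite !mulr_ge0// ltW.
have Jl := leq_trans J jl.
by apply: (detail_bound geom) => //; [exact: ltW|exact: ltW|move=> i m; exact: hp|move=> i m; exact: hb].
Qed.

(** Everything about a law of the model that the bounds use. *)
Lemma model_data (P : probability T0 R) : model W J0 al be M lo hi P ->
  exists p b, [/\ regression_model P (clipA lo hi) (clipY lo hi) p b B,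
    {ae P, forall o, varA o = clipA lo hi o /\ varY o = clipY lo hi o},
    psi P = \int[P]_o (clipA lo hi o * clipY lo hi o) - inner p b,
    (forall l i (m : Z W l), (J0 <= l)%N -> `|inner p (Psi i m)| <= M / weight d al l) &
    (forall l i (m : Z W l), (J0 <= l)%N -> `|inner b (Psi i m)| <= M / weight d be l)].
Proof.
move=> [X_unif range [p0 cp hp] [b0 cb hb]].
have lh := ltW lohi.
exists (clip_fun lo hi p0), (clip_fun lo hi b0); split.
- exact: clip_regression_model.
- by apply: filterS2 (clipA_ae range) (clipY_ae range) => o; split.
- exact: psi_moments.
- move=> l i m J; rewrite -(inner_clip_p lh X_unif range cp); last exact: (bmeas_Psi W_cdv).
  exact: holder_ball_Psi hp.
- move=> l i m J; rewrite -(inner_clip_b lh X_unif range cb); last exact: (bmeas_Psi W_cdv).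
  exact: holder_ball_Psi hb.
Qed.

Section fixed_levels.
Variables (n j1 j2 : nat).
Hypotheses (n0 : (0 < n)%N) (J1 : (J0 <= j1)%N) (J2 : (J0 <= j2)%N).
Local Notation Pab := (model W J0 al be M lo hi).
Local Notation kmin := ((minn (2 ^ (j1 * d)) (2 ^ (j2 * d)))%:R : R).
Local Notation kmax := ((maxn (2 ^ (j1 * d)) (2 ^ (j2 * d)))%:R : R).

Let Jmin : (J0 <= minn j1 j2)%N. Proof. by rewrite leq_min J1. Qed.
Let Jmax : (J0 <= maxn j1 j2)%N. Proof. by rewrite leq_max J1. Qed.

Lemma sup_bias_INT : (ereal_sup [set abs_bias (@psi_INT R d W n j1 j2) P | P in Pab] <=
  (bias_const * decay (al + be) ^+ minn j1 j2)%:E)%E.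
Proof.
apply: ge_ereal_sup => _ [P /model_data[p [b [RM Pae psiE hp hb]]] <-].
rewrite (INT_bias W_cdv RM Pae psiE n0 J1 J2) lee_fin.
by apply: truncation_le => //; [exact: (rm_mp RM)|exact: (rm_mb RM)].
Qed.

Lemma sup_bias_MC : (ereal_sup [set abs_bias (@psi_MC R d W n j1 j2) P | P in Pab] <=
  (bias_const * decay (al + be) ^+ minn j1 j2)%:E)%E.
Proof.
apply: ge_ereal_sup => _ [P /model_data[p [b [RM Pae psiE hp hb]]] <-].
rewrite (MC_bias W_cdv RM Pae psiE n0 J1 J2) lee_fin.
by apply: truncation_le => //; [exact: (rm_mp RM)|exact: (rm_mb RM)].
Qed.

Lemma sup_bias_IF : (ereal_sup [set abs_bias (@psi_IF R d W n j1 j2) P | P in Pab] <=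
  (bias_const * decay (al + be) ^+ maxn j1 j2)%:E)%E.
Proof.
apply: ge_ereal_sup => _ [P /model_data[p [b [RM Pae psiE hp hb]]] <-].
rewrite (IF_bias W_cdv RM Pae psiE n0 J1 J2) lee_fin.
by apply: truncation_le => //; [exact: (rm_mp RM)|exact: (rm_mb RM)].
Qed.

Let ni0 : 0 <= n%:R^-1 :> R. Proof. by rewrite invr_ge0. Qed.

Lemma sup_var_INT : (ereal_sup [set var (@psi_INT R d W n j1 j2) P | P in Pab] <=
  ((B ^+ 4 * (6 + 2 * C) + 1) * (n%:R^-1 + kmin / n%:R ^+ 2))%:E)%E.
Proof.
apply: ge_ereal_sup => _ [P /model_data[p [b [RM Pae _ _ _]]] <-].
apply: le_trans (INT_var_le W_cdv RM Pae n0 J1 J2 geom) _; rewrite lee_fin.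
by rewrite -exprVn; apply: INT_arith => //; exact: ltW.
Qed.

Let stat_le :
  n%:R^-1 * (pc ^+ 2 * (1 + k j1 / n%:R) * (1 + k j2 / n%:R)) +
  resid_mean_bound d B n j1 j2 C <=
  stat_const B C pc * (n%:R^-1 + kmax / n%:R ^+ 2 + k j1 * k j2 / n%:R ^+ 3).
Proof.
rewrite -!exprVn; apply: stat_arith => //; rewrite ?ler_nat ?leq_maxl ?leq_maxr//.
  exact: ltW.
by rewrite (leq_trans (geq_minl _ _))// leq_maxl.
Qed.

Lemma sup_var_IF : (ereal_sup [set var (@psi_IF R d W n j1 j2) P | P in Pab] <=
  (stat_const B C pc * (n%:R^-1 + kmax / n%:R ^+ 2 + k j1 * k j2 / n%:R ^+ 3))%:E)%E.
Proof.
apply: ge_ereal_sup => _ [P /model_data[p [b [RM Pae _ _ _]]] <-].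
apply: le_trans (IF_var_le W_cdv RM Pae n0 J1 J2 C_gt0 geom) _.
by rewrite lee_fin.
Qed.

Lemma sup_var_MC : (ereal_sup [set var (@psi_MC R d W n j1 j2) P | P in Pab] <=
  ((2 * B ^+ 4 + 2 * stat_const B C pc) *
    (n%:R^-1 + kmax / n%:R ^+ 2 + k j1 * k j2 / n%:R ^+ 3))%:E)%E.
Proof.
apply: ge_ereal_sup => _ [P /model_data[p [b [RM Pae _ _ _]]] <-].
apply: le_trans (MC_var_le W_cdv RM Pae n0 J1 J2 C_gt0 geom) _.
rewrite lee_fin [leRHS]mulrDl; apply: lerD.
  rewrite [leLHS](_ : _ = 2 * B ^+ 4 * n%:R^-1); last by ring.
  rewrite ler_wpM2l ?mulr_ge0 ?exprn_ge0//.
  by rewrite -addrA lerDl addr_ge0// ?mulr_ge0 ?invr_ge0 ?exprn_ge0.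
by rewrite -[leRHS]mulrA ler_wpM2l.
Qed.

End fixed_levels.
End model_bounds.

(** * Least favorable laws *)

Section truncation.
Context (R : realType) (d S J0 : nat) (W : wavelets R d).
Hypothesis W_cdv : cdv_basis W S J0.
Implicit Types f g u v : d.-tuple R -> R.

(** What the approximation at level [j] misses of the inner product: the bias
    of the estimators. *)
Definition truncation (j : nat) f g : R := inner f g - coarse W j f g.

Lemma truncationC j f g : truncation j f g = truncation j g f.
Proof.
rewrite /truncation innerC; congr (_ - _).
by apply: eq_bigr => m _; exact: mulrC.
Qed.

Variable j : nat.
Hypothesis J0j : (J0 <= j)%N.

Let bPhi (m : Z W j) : bmeas (Phi m). Proof. exact: (bmeas_Phi W_cdv). Qed.

Lemma truncation_lin u v g s : bmeas u -> bmeas v -> bmeas g ->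
  truncation j (fun x => u x + s * v x) g = truncation j u g + s * truncation j v g.
Proof.
move=> bu bv bg; have bsv := bmeasM (bmeas_cst _ s) bv.
have lin h : bmeas h -> inner (fun x => u x + s * v x) h = inner u h + s * inner v h.
  by move=> bh; rewrite innerDl// innerZl.
rewrite /truncation lin//; suff -> : coarse W j (fun x => u x + s * v x) g =
  coarse W j u g + s * coarse W j v g by ring.
rewrite /coarse mulr_sumr -big_split/=; apply: eq_bigr => m _.
by rewrite lin//; ring.
Qed.

Lemma truncation_bilin u v u' v' s t : bmeas u -> bmeas v -> bmeas u' -> bmeas v' ->
  truncation j (fun x => u x + s * v x) (fun x => u' x + t * v' x) =
  truncation j u u' + t * truncation j u v' + s * truncation j v u' +
  s * t * truncation j v v'.
Proof.
move=> bu bv bu' bv'; have bg : bmeas (fun x => u' x + t * v' x) by bm.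
have E h : bmeas h -> truncation j h (fun x => u' x + t * v' x) =
    truncation j h u' + t * truncation j h v'.
  move=> bh; rewrite truncationC (truncation_lin t bu' bv' bh).
  by rewrite (truncationC j u' h) (truncationC j v' h).
by rewrite (truncation_lin s bu bv bg) (E _ bu) (E _ bv); ring.
Qed.

Lemma truncation_V u g : V W j u -> bmeas g -> truncation j u g = 0.
Proof.
move=> uV bg; rewrite /truncation -(inner_projV_l W_cdv _ J0j bg).
have oPhi (m m' : Z W j) : inner (Phi m) (Phi m') = (m == m')%:R.
  exact: (Phi_orthonormal W_cdv).
by rewrite /projV (oproj_id bPhi oPhi uV) subrr.
Qed.

Lemma truncation_cube f f' g g' : bmeas f -> bmeas f' -> bmeas g -> bmeas g' ->
  (forall x, cube x -> f x = f' x) -> (forall x, cube x -> g x = g' x) ->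
  truncation j f g = truncation j f' g'.
Proof.
move=> bf bf' bg bg' ff gg.
have E (h h' q : d.-tuple R -> R) : bmeas h -> bmeas h' -> bmeas q ->
    (forall x, cube x -> h x = h' x) -> inner h q = inner h' q.
  move=> bh bh' bq hh; apply: ex_cube => [x /hh -> //||].
    by case: (bmeasM bh bq).
  by case: (bmeasM bh' bq).
rewrite /truncation (E f f')// innerC (E g g')// innerC; congr (_ - _).
by apply: eq_bigr => m _; rewrite (E f f')// (E g g').
Qed.

Variable C : R.
Hypothesis C_gt0 : 0 < C.
Hypothesis geom : level_bounds J0 W C.
Variables (i0 : details d) (al be : R) (v v' : d.-tuple R -> R).
Hypotheses (bv : bmeas v) (bv' : bmeas v').
Hypothesis vPsi : forall l i (m : Z W l), (J0 <= l)%N ->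
  inner v (Psi i m) = (i == i0)%:R / weight d al l.
Hypothesis v'Psi : forall l i (m : Z W l), (J0 <= l)%N ->
  inner v' (Psi i m) = (i == i0)%:R / weight d be l.

Lemma detail_wave l : (J0 <= l)%N ->
  detail W l v v' = #|Z W l|%:R * ((weight d al l)^-1 * (weight d be l)^-1).
Proof.
move=> J; rewrite /detail.
rewrite (eq_bigr (fun z : details d * Z W l => (z.1 == i0)%:R *
  ((weight d al l)^-1 * (weight d be l)^-1))); last first.
  move=> [i m] _ /=; rewrite vPsi// v'Psi//.
  by case: (i == i0); rewrite ?mul1r ?mul0r.
rewrite -(pair_bigA _ (fun i (m : Z W l) => (i == i0)%:R *
  ((weight d al l)^-1 * (weight d be l)^-1)))/=.
rewrite (bigD1 i0)//= [X in _ + X]big1 ?addr0 => [|i /negPf ->].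
  by rewrite eqxx mul1r sumr_const mulr_natl.
by apply: big1 => m _; rewrite mul0r.
Qed.

(** The coefficients of the two waves are nonnegative, so the details add up. *)
Lemma truncation_wave_ge : C^-1 * decay (al + be) ^+ j <= truncation j v v'.
Proof.
have w0 a l := ltW (weight_gt0 d a l).
have pos l : (j <= l)%N -> 0 <= detail W l v v'.
  move=> jl; rewrite (detail_wave (leq_trans J0j jl)) mulr_ge0//.
  by apply: mulr_ge0; rewrite invr_ge0 w0.
apply: le_trans (tail_ge W_cdv J0j bv bv' pos).
rewrite detail_wave// -(res_weight d al be j).
have [kZ _ _ _ _] := geom J0j.
by rewrite -mulrA mulrA ler_wpM2r ?mulr_ge0 ?invr_ge0 ?w0// ler_pdivrMl.
Qed.

End truncation.

Section four_laws.
Context (R : realType) (d S J0 : nat) (W : wavelets R d).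
Hypothesis W_cdv : cdv_basis W S J0.
Variable C : R.
Hypothesis C_gt0 : 0 < C.
Hypothesis geom : level_bounds J0 W C.
Hypotheses (S_gt0 : (0 < S)%N) (d_gt0 : (0 < d)%N).
Variables (al be M' M lo hi : R).
Hypotheses (al0 : 0 < al) (be0 : 0 < be) (MM : M' < M) (lohi : lo < hi).
Local Notation T0 := (d.-tuple R * R * R)%type.
Local Notation B := (Num.max `|lo| `|hi|).

(** For the values of a bilinear form at arguments perturbed with signs, the
    alternating sum leaves only the pure perturbation term, whatever the other
    terms are. *)
Lemma alternating4 (F : bool -> bool -> R) (D : R) :
  F true true - F true false - F false true + F false false = 4 * D ->
  exists s t, D <= `|F s t|.
Proof.
move=> FD; have [h1|h1] := leP D `|F true true|; first by exists true, true.
have [h2|h2] := leP D `|F true false|; first by exists true, false.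
have [h3|h3] := leP D `|F false true|; first by exists false, true.
exists false, false; apply: contraTT isT; rewrite -ltNge => h4.
have := ler_norm (F true true); have := ler_norm (F false false).
have := ler_norm (- F true false); have := ler_norm (- F false true).
by rewrite !normrN; lra.
Qed.

(** The regression functions are perturbed by waves with signs [s] and [t]. At
    every level one of the four laws has a large truncation error, but which one
    may depend on the level. Beyond the level [Js] of the unperturbed functions
    the other terms vanish, and one law serves all levels. *)
Lemma least_favorable_laws (P0 : probability T0 R) :
  model W J0 al be M' lo hi P0 ->
  exists (Js : nat) (cst c0 : R) (P : bool -> bool -> probability T0 R)
    (p b : bool -> d.-tuple R -> R),
  [/\ 0 < cst, 0 < c0 & forall s t, model W J0 al be M lo hi (P s t)] /\
  [/\ forall s t, [/\ regression_model (P s t) (clipA lo hi) (clipY lo hi) (p s) (b t) B,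
    {ae P s t, forall o, varA o = clipA lo hi o /\ varY o = clipY lo hi o} &
    psi (P s t) = \int[P s t]_o (clipA lo hi o * clipY lo hi o) - inner (p s) (b t)],
    forall s t phi, bmeas phi -> (forall x, 0 <= phi x) ->
      c0 * \int[unif R d]_x phi x <= \int[P s t]_o (clipA lo hi o ^+ 2 * phi (covX o)),
    forall s t phi, bmeas phi -> (forall x, 0 <= phi x) ->
      c0 * \int[unif R d]_x phi x <= \int[P s t]_o (clipY lo hi o ^+ 2 * phi (covX o)),
    forall j, (J0 <= j)%N -> exists s t,
      cst * decay (al + be) ^+ j <= `|truncation W j (p s) (b t)| &
    forall j, (J0 <= j)%N -> (Js <= j)%N ->
      cst * decay (al + be) ^+ j <= `|truncation W j (p true) (b true)|].
Proof.
move=> [X_unif range [p0 cp hp] [b0 cb hb]]; have lh := ltW lohi.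
have i0 := details_inhabited d_gt0.
have [J1 [lo1 [hi1 [tau1 [u [v [[JJ1 lolo1 lohi1 hihi1 tau10] [bv uV vPsi pr1 pH1]]]]]]]] :=
  perturbation_exists W_cdv C_gt0 geom S_gt0 i0 al0 MM lohi
    (let: And3 m _ _ := cp in m) hp (inner_clip_p lh X_unif range cp).
have [J2 [lo2 [hi2 [tau2 [u' [v' [[JJ2 lolo2 lohi2 hihi2 tau20] [bv' uV' v'Psi pr2 pH2]]]]]]]] :=
  perturbation_exists W_cdv C_gt0 geom S_gt0 i0 be0 MM lohi
    (let: And3 m _ _ := cb in m) hb (inner_clip_b lh X_unif range cb).
pose sg (s : bool) (tau : R) := if s then tau else - tau.
have sgn s tau : 0 < tau -> `|sg s tau| <= tau.
  by move=> t0; rewrite /sg; case: s; rewrite ?normrN ger0_norm// ltW.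
have bu := V_bmeas W_cdv JJ1 uV; have bu' := V_bmeas W_cdv JJ2 uV'.
pose rp s x := u x + sg s tau1 * v x; pose rb t x := u' x + sg t tau2 * v' x.
have brp s : bmeas (rp s) by rewrite /rp; bm.
have brb t : bmeas (rb t) by rewrite /rb; bm.
pose p s x := clip lo1 hi1 (rp s x); pose b t x := clip lo2 hi2 (rb t x).
have bp s : bmeas (p s) by apply: bmeas_clip => //; case: (brp s).
have bb t : bmeas (b t) by apply: bmeas_clip => //; case: (brb t).
have hl : 0 < hi - lo by rewrite subr_gt0.
pose del := Num.min (Num.min ((lo1 - lo) / (hi - lo)) ((hi - hi1) / (hi - lo)))
                    (Num.min ((lo2 - lo) / (hi - lo)) ((hi - hi2) / (hi - lo))).
have del0 : 0 < del by rewrite !lt_min !divr_gt0// subr_gt0.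
have : del <= del by [].
rewrite {2}/del !le_min !ler_pdivlMr// => /andP[/andP[d1 d2] /andP[d3 d4]].
have p_itv s x : lo + del * (hi - lo) <= p s x <= hi - del * (hi - lo).
  have /andP[h1 h2] := clip_itv lohi1 (rp s x); rewrite -/(p s x) in h1 h2.
  by clear -h1 h2 d1 d2; apply/andP; split; lra.
have b_itv t x : lo + del * (hi - lo) <= b t x <= hi - del * (hi - lo).
  have /andP[h1 h2] := clip_itv lohi2 (rb t x); rewrite -/(b t x) in h1 h2.
  by clear -h1 h2 d3 d4; apply/andP; split; lra.
pose P s t := two_point_law lo hi (bp s) (bb t).
have dhl : 0 <= del * (hi - lo) by rewrite mulr_ge0// ltW.
have clip_p s : clip_fun lo hi (p s) = p s.
  apply/funext => x; rewrite /clip_fun clip_id//.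
  have /andP[h1 h2] := p_itv s x; clear -h1 h2 dhl.
  by apply/andP; split; lra.
have clip_b t : clip_fun lo hi (b t) = b t.
  apply/funext => x; rewrite /clip_fun clip_id//.
  have /andP[h1 h2] := b_itv t x; clear -h1 h2 dhl.
  by apply/andP; split; lra.
have PX s t := two_point_law_X lo hi (bp s) (bb t).
have Pr s t := two_point_law_range lohi (bp s) (bb t).
have Pp s t := two_point_law_p lohi (bp s) (bb t) (ltW del0) (p_itv s).
have Pb s t := two_point_law_b lohi (bp s) (bb t) (ltW del0) (b_itv t).
have c00 : 0 < del * (lo ^+ 2 + hi ^+ 2).
  rewrite mulr_gt0// lt_neqAle addr_ge0// andbT eq_sym paddr_eq0// !sqrf_eq0.
  by apply/negP => /andP[/eqP l0 /eqP h0]; move: lohi; rewrite l0 h0 ltxx.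
have Ci0 : 0 < C^-1 by rewrite invr_gt0.
have F j s t : (J0 <= j)%N -> truncation W j (p s) (b t) =
    truncation W j u u' + sg t tau2 * truncation W j u v' +
    sg s tau1 * truncation W j v u' + sg s tau1 * sg t tau2 * truncation W j v v'.
  move=> J; rewrite -(truncation_bilin W_cdv J)//.
  apply: (truncation_cube W_cdv J) => //.
  - exact: brp.
  - exact: brb.
  - by move=> x xc; rewrite /p clip_id//; apply: pr1 => //; exact: sgn.
  - by move=> x xc; rewrite /b clip_id//; apply: pr2 => //; exact: sgn.
have vv j : (J0 <= j)%N -> tau1 * tau2 * C^-1 * decay (al + be) ^+ j <=
    tau1 * tau2 * truncation W j v v'.
  move=> J; rewrite -mulrA ler_wpM2l ?mulr_ge0 ?(ltW tau10) ?(ltW tau20)//.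
  exact: (truncation_wave_ge W_cdv J C_gt0 geom bv bv' vPsi v'Psi).
exists (maxn J1 J2), (tau1 * tau2 * C^-1), (del * (lo ^+ 2 + hi ^+ 2)), P, p, b.
split; split=> //.
- by rewrite !mulr_gt0.
- move=> s t; split; [exact: PX|exact: Pr| |].
    by exists (p s); [exact: Pp|apply: pH1; exact: sgn].
  by exists (b t); [exact: Pb|apply: pH2; exact: sgn].
- move=> s t; split.
  + rewrite -[X in regression_model _ _ _ X _ _](clip_p s) -[X in regression_model _ _ _ _ X _](clip_b t).
    exact: (clip_regression_model lh (PX s t) (Pr s t) (Pp s t) (Pb s t)).
  + by apply: filterS2 (clipA_ae (Pr s t)) (clipY_ae (Pr s t)) => o; split.
  + rewrite (psi_moments lh (PX s t) (Pr s t) (Pp s t) (Pb s t)).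
    by rewrite clip_p clip_b.
- by move=> s t phi; exact: (two_point_law_A2 lohi (bp s) (bb t) (ltW del0) (p_itv s)).
- by move=> s t phi; exact: (two_point_law_Y2 lohi (bp s) (bb t) (ltW del0) (b_itv t)).
- move=> j J; have [|s [t st]] := @alternating4 (fun s t => truncation W j (p s) (b t))
    (tau1 * tau2 * truncation W j v v').
    by rewrite !F// /sg; ring.
  by exists s, t; apply: le_trans st; exact: vv.
- move=> j J; rewrite geq_max => /andP[j1 j2].
  have uj : V W j u by apply: (V_sub W_cdv _ uV); rewrite JJ1.
  have u'j : V W j u' by apply: (V_sub W_cdv _ uV'); rewrite JJ2.
  rewrite F// (truncation_V W_cdv J uj bu') (truncation_V W_cdv J uj bv').
  rewrite (truncationC _ _ v) (truncation_V W_cdv J u'j bv) !mulr0 !add0r /=.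
  exact: le_trans (vv j J) (ler_norm _).
Qed.

End four_laws.

(** * Asymptotic comparisons *)

Section asymptotics.
Context (R : realType) (I : Type) (D : set I).
Implicit Types (a : I -> nat -> \bar R) (b : I -> nat -> R).

Lemma lesssim_of_le a b c : 0 <= c ->
  (forall i n, D i -> (0 < n)%N -> 0 <= b i n) ->
  (forall i n, D i -> (0 < n)%N -> (a i n <= (c * b i n)%:E)%E) ->
  lesssim D a (fun i n => (b i n)%:E).
Proof.
move=> c0 b0 ab; exists (c + 1); first by rewrite ltr_wpDl.
move=> i Di; exists 1%N => // n /= n0; apply: le_trans (ab i n Di n0) _.
by rewrite -EFinM lee_fin ler_wpM2r ?b0// lerDl.
Qed.

Lemma gtrsim_of_ge a b c : 0 < c ->
  (forall i, D i -> \forall n \near \oo, ((c * b i n)%:E <= a i n)%E) ->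
  gtrsim D a (fun i n => (b i n)%:E).
Proof.
move=> c0 ab; exists c^-1; first by rewrite invr_gt0.
move=> i /ab; apply: filterS => n h.
have -> : (b i n)%:E = (c^-1%:E * (c * b i n)%:E)%E.
  by rewrite -EFinM mulKf// gt_eqF.
by rewrite lee_wpmul2l// lee_fin invr_ge0 ltW.
Qed.

End asymptotics.

Section large_levels.
Context (R : realType) (d J0 : nat).

Lemma much_less_ratio (k : nat -> nat) (T : R) : (forall n, 0 < k n)%N -> 0 < T ->
  much_less (fun n => n%:R : R) (fun n => (k n)%:R) ->
  \forall n \near \oo, T <= (k n)%:R * n%:R^-1.
Proof.
move=> k0 T0 /cvgr0Pnorm_lt/(_ T^-1); rewrite invr_gt0 T0 => /(_ isT) h.
near=> n.
have n0 : (0 : R) < n%:R by rewrite ltr0n; near: n; exists 1%N.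
have kn : (0 : R) < (k n)%:R by rewrite ltr0n.
have : `|n%:R / (k n)%:R| < T^-1 by near: n.
rewrite ger0_norm ?divr_ge0// ltr_pdivrMr// ltr_pdivlMl// => hT.
by rewrite ltW// ltr_pdivlMr.
Unshelve. all: by end_near. Qed.

Lemma large_levels_ratio j (T : R) : large_level_seqs R d J0 j -> 0 < T ->
  \forall n \near \oo, [/\ (0 < n)%N, (J0 <= j.1 n)%N, (J0 <= j.2 n)%N,
    T <= (2 ^ (j.1 n * d))%:R * n%:R^-1 & T <= (2 ^ (j.2 n * d))%:R * n%:R^-1].
Proof.
move=> [jJ [m1 m2]] T0; have k0 (i : nat -> nat) n : (0 < resolution d i n)%N.
  by rewrite expn_gt0.
have h1 := much_less_ratio (k0 j.1) T0 m1.
have h2 := much_less_ratio (k0 j.2) T0 m2.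
near=> n; have [? ?] := jJ n; split => //.
- by near: n; exists 1%N.
- by near: n.
- by near: n.
Unshelve. all: by end_near. Qed.

Lemma level_ge Js j n : (0 < d)%N -> (0 < n)%N ->
  (2 ^ (Js * d))%:R <= (2 ^ (j * d))%:R * n%:R^-1 :> R -> (Js <= j)%N.
Proof.
move=> d0 n0 h; suff : (2 ^ (Js * d) <= 2 ^ (j * d))%N.
  by rewrite leq_exp2l// leq_mul2r eqn0Ngt d0.
rewrite -(ler_nat R); apply: le_trans h _.
by apply: ler_piMr => //; rewrite invf_le1 ?ler1n ?ltr0n.
Qed.

Lemma var_low_ge (B C c0 : R) : 0 <= B -> 0 < C -> 0 < c0 ->
  exists c T : R, [/\ 0 < c, 0 < T & forall n j1 j2, (0 < n)%N ->
    T <= (2 ^ (j1 * d))%:R * n%:R^-1 -> T <= (2 ^ (j2 * d))%:R * n%:R^-1 ->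
    [/\ 0 <= sq_low d B n C c0 (2 ^ (j1 * d))%:R,
        0 <= sq_low d B n C c0 (2 ^ (j2 * d))%:R &
        c * ((2 ^ (j1 * d))%:R * (2 ^ (j2 * d))%:R / n%:R ^+ 3) <=
          var_low d B n j1 j2 C c0]].
Proof.
move=> B0 C0 c00; pose ka := c0 / (C * (2 * C) ^+ d); pose BL := B * projV_norm d C.
have ka0 : 0 < ka by rewrite divr_gt0// mulr_gt0// exprn_gt0// mulr_gt0.
have B4 : 0 <= B ^+ 4 by rewrite exprn_ge0.
pose t1 := 2 * BL ^+ 2 / ka; pose t2 := 896 * B ^+ 4 / ka ^+ 2.
pose t3 := 96 * C * B ^+ 4 / ka ^+ 2.
have t10 : 0 <= t1 := divr_ge0 (mulr_ge0 (ler0n R 2) (sqr_ge0 BL)) (ltW ka0).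
have t20 : 0 <= t2 := divr_ge0 (mulr_ge0 (ler0n R 896) B4) (sqr_ge0 ka).
have t30 : 0 <= t3 :=
  divr_ge0 (mulr_ge0 (mulr_ge0 (ler0n R 96) (ltW C0)) B4) (sqr_ge0 ka).
have T1 : 1 <= 1 + t1 + t2 + t3 by lra.
exists (ka ^+ 2 / 8), (1 + t1 + t2 + t3); split; last 1 first.
- move=> n j1 j2 n0 h1 h2.
  have n1 : 0 < (n%:R^-1 : R) <= 1 by rewrite invr_gt0 invf_le1 ?ler1n ?ltr0n ?n0.
  have le_k j : (2 ^ (j * d))%:R * n%:R^-1 <= (2 ^ (j * d))%:R :> R.
    by have /andP[_ ?] := n1; rewrite ler_piMr.
  rewrite -exprVn; apply: (var_low_arith B0 (ltW C0) ka0 n1 T1) => //.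
  + by rewrite -ler_pdivrMl// mulrC; rewrite -/t1; lra.
  + by rewrite -ler_pdivrMl ?exprn_gt0// mulrC; rewrite -/t2; lra.
  + by rewrite -ler_pdivrMl ?exprn_gt0// mulrC; rewrite -/t3; lra.
  + wlog le12 : j1 j2 h1 h2 / (2 ^ (j1 * d) <= 2 ^ (j2 * d))%N => [hw|].
      case/orP: (leq_total (2 ^ (j1 * d)) (2 ^ (j2 * d))) => [|le21]; first exact: hw.
      by rewrite minnC mulrC [leRHS]mulrC mulrC; apply: hw.
    by rewrite (minn_idPl le12) ler_wpM2l// (le_trans h2).
- by rewrite divr_gt0// exprn_gt0.
- exact: lt_le_trans T1.
Qed.

End large_levels.

Theorem theorem1 (R : realType) (d S J0 : nat) (alpha beta M C1 C2 : R)
    (W : wavelets R d)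
    (d_gt0 : (0 < d)%N) (alpha_gt0 : 0 < alpha) (beta_gt0 : 0 < beta)
    (M_gt0 : 0 < M) (C1_lt_C2 : C1 < C2)
    (S_ge1 : (1 <= S)%N) (S_gt : Num.max alpha beta < S%:R)
    (J0_S : (S <= 2 ^ J0)%N)
    (W_cdv : cdv_basis W S J0)
    (M_slack : exists2 M' : R, M' < M &
       model W J0 alpha beta M' C1 C2 !=set0) :
  let Pab := model W J0 alpha beta M C1 C2 in
  let k1 (j : (nat -> nat) * (nat -> nat)) n := resolution d j.1 n in
  let k2 (j : (nat -> nat) * (nat -> nat)) n := resolution d j.2 n in
  let kmin j n : R := (minn (k1 j n) (k2 j n))%:R in
  let kmax j n : R := (maxn (k1 j n) (k2 j n))%:R in
  let kprod j n : R := (k1 j n)%:R * (k2 j n)%:R in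
  let rate (k : R) : \bar R := (k `^ (- ((alpha + beta) / d%:R)))%:E in
  let INT j n := @psi_INT R d W n (j.1 n) (j.2 n) in
  let MC j n := @psi_MC R d W n (j.1 n) (j.2 n) in
  let IF j n := @psi_IF R d W n (j.1 n) (j.2 n) in
  let K := level_seqs J0 in
  let Kn := large_level_seqs R d J0 in
  [/\ (* 1 *)
      asymp K (fun j n => ereal_sup [set abs_bias (INT j n) P | P in Pab])
              (fun j n => rate (kmin j n)) /\
      lesssim K (fun j n => ereal_sup [set var (INT j n) P | P in Pab])
                (fun j n => (n%:R^-1 + kmin j n / n%:R ^+ 2)%:E),
      (* 2a *)
      asymp K (fun j n => ereal_sup [set abs_bias (MC j n) P | P in Pab])
              (fun j n => rate (kmin j n)) /\
      lesssim K (fun j n => ereal_sup [set var (MC j n) P | P in Pab])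
                (fun j n => (n%:R^-1 + kmax j n / n%:R ^+ 2
                             + kprod j n / n%:R ^+ 3)%:E),
      (* 2b *)
      exists2 P, Pab P &
        gtrsim Kn (fun j n => abs_bias (MC j n) P)
                  (fun j n => rate (kmin j n)) /\
        gtrsim Kn (fun j n => var (MC j n) P)
                  (fun j n => (kprod j n / n%:R ^+ 3)%:E),
      (* 3a *)
      asymp K (fun j n => ereal_sup [set abs_bias (IF j n) P | P in Pab])
              (fun j n => rate (kmax j n)) /\
      lesssim K (fun j n => ereal_sup [set var (IF j n) P | P in Pab])
                (fun j n => (n%:R^-1 + kmax j n / n%:R ^+ 2
                             + kprod j n / n%:R ^+ 3)%:E) &
      (* 3b *)
      exists2 P, Pab P &
        gtrsim Kn (fun j n => abs_bias (IF j n) P)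
                  (fun j n => rate (kmax j n)) /\
        gtrsim Kn (fun j n => var (IF j n) P)
                  (fun j n => (kprod j n / n%:R ^+ 3)%:E)].
Proof.
move=> Pab k1 k2 kmin kmax kprod rate INT MC IF K Kn.
have [C C_gt0 geom] := level_geometry W_cdv.
have [M' M'M [P0 modelP0]] := M_slack.
have [Js [cst [c0 [P [p [b [[cst0 c00 modelP] [data A2 Y2 signs large]]]]]]]] :=
  least_favorable_laws W_cdv C_gt0 geom S_ge1 d_gt0 alpha_gt0 beta_gt0 M'M
    C1_lt_C2 modelP0.
pose B := Num.max `|C1| `|C2|; pose pc := pointwise_const d B C.
have B0 : 0 <= B by rewrite le_max normr_ge0.
pose tail l := decay (alpha + beta) ^+ l : R.
have rate_min : (fun j n => rate (kmin j n)) =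
    (fun j n => (tail (minn (j.1 n) (j.2 n)))%:E).
  apply/funext => j; apply/funext => n.
  by rewrite /rate /kmin /k1 /k2 /resolution res_minn rateE.
have rate_max : (fun j n => rate (kmax j n)) =
    (fun j n => (tail (maxn (j.1 n) (j.2 n)))%:E).
  apply/funext => j; apply/funext => n.
  by rewrite /rate /kmax /k1 /k2 /resolution res_maxn rateE.
rewrite rate_min rate_max => {rate_min rate_max}.
have tail_ge0 l : 0 <= tail l by rewrite exprn_ge0// ltW// decay_gt0.
have bias_ge0 := bias_const_ge0 d C_gt0 alpha_gt0 beta_gt0 M_gt0.
have stat_ge0 : 0 <= stat_const B C pc.
  by rewrite /stat_const; rewrite !(addr_ge0, mulr_ge0, exprn_ge0, sqr_ge0)// ltW.
have risk2_ge0 j n : 0 <= n%:R^-1 + kmin j n / n%:R ^+ 2.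
  by rewrite addr_ge0 ?divr_ge0 ?invr_ge0 ?exprn_ge0.
have risk3_ge0 j n : 0 <= n%:R^-1 + kmax j n / n%:R ^+ 2 + kprod j n / n%:R ^+ 3.
  by rewrite !addr_ge0 ?divr_ge0 ?mulr_ge0 ?invr_ge0 ?exprn_ge0.
have [cv [T [cv0 T0 var_low_T]]] := @var_low_ge R d B C c0 B0 C_gt0 c00.
(* Resolutions beyond 2^(Js d) n are at levels beyond Js. *)
pose T' := Num.max T (2 ^ (Js * d))%:R.
have T'0 : 0 < T' by rewrite lt_max T0.
have Kn_near j : Kn j -> \forall n \near \oo,
    [/\ (0 < n)%N, (J0 <= j.1 n)%N /\ (J0 <= j.2 n)%N, (Js <= j.1 n)%N /\ (Js <= j.2 n)%N,
      T <= (2 ^ (j.1 n * d))%:R * n%:R^-1 & T <= (2 ^ (j.2 n * d))%:R * n%:R^-1].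
  move=> /large_levels_ratio/(_ T'0); apply: filterS => n [n0 h1 h2].
  rewrite !ge_max => /andP[T1 l1] /andP[T2 l2]; split => //; split.
    exact: (level_ge d_gt0 n0 l1).
  exact: (level_ge d_gt0 n0 l2).
(* An estimator whose bias is the truncation error at the level [lev]. *)
pose tail_bias (est : forall n, nat -> nat -> samples R d n -> R) lev :=
  forall n j1 j2 s t, (0 < n)%N -> (J0 <= j1)%N -> (J0 <= j2)%N ->
  abs_bias (est n j1 j2) (P s t) = `|truncation W (lev j1 j2) (p s) (b t)|%:E.
have sup_bias est lev : tail_bias est lev ->
    (forall l j1 j2, (l <= j1)%N -> (l <= j2)%N -> (l <= lev j1 j2)%N) ->
    (forall n j1 j2, (0 < n)%N -> (J0 <= j1)%N -> (J0 <= j2)%N ->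
      (ereal_sup [set abs_bias (est n j1 j2) Q | Q in Pab] <=
       (bias_const d C alpha beta M * tail (lev j1 j2))%:E)%E) ->
    asymp K (fun j n => ereal_sup [set abs_bias (est n (j.1 n) (j.2 n)) Q | Q in Pab])
            (fun j n => (tail (lev (j.1 n) (j.2 n)))%:E).
  move=> E lev_ge up; split.
    by apply: (lesssim_of_le bias_ge0) => // j n /(_ n)[h1 h2] n0; exact: up.
  apply: (gtrsim_of_ge cst0) => j Kj; exists 1%N => // n /= n0.
  have [h1 h2] := Kj n; have [s [t st]] := signs _ (lev_ge _ _ _ h1 h2).
  apply: (@le_trans _ _ (abs_bias (est n (j.1 n) (j.2 n)) (P s t))).
    by rewrite E// lee_fin.
  by apply: ereal_sup_ubound; exists (P s t) => //; exact: modelP.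
have law_bias est lev : tail_bias est lev ->
    (forall l j1 j2, (l <= j1)%N -> (l <= j2)%N -> (l <= lev j1 j2)%N) ->
    gtrsim Kn (fun j n => abs_bias (est n (j.1 n) (j.2 n)) (P true true))
              (fun j n => (tail (lev (j.1 n) (j.2 n)))%:E).
  move=> E lev_ge; apply: (gtrsim_of_ge cst0) => j /Kn_near.
  apply: filterS => n [n0 [h1 h2] [l1 l2] _ _].
  by rewrite E// lee_fin; apply: large; exact: lev_ge.
have min_ge l j1 j2 : (l <= j1)%N -> (l <= j2)%N -> (l <= minn j1 j2)%N.
  by rewrite leq_min => ->.
have max_ge l j1 j2 : (l <= j1)%N -> (l <= j2)%N -> (l <= maxn j1 j2)%N.
  by rewrite leq_max => ->.
have INT_tail : tail_bias (@psi_INT R d W) minn.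
  by move=> n j1 j2 s t n0 h1 h2; have [RM Pae psiE] := data s t; exact: (INT_bias W_cdv RM Pae psiE).
have MC_tail : tail_bias (@psi_MC R d W) minn.
  by move=> n j1 j2 s t n0 h1 h2; have [RM Pae psiE] := data s t; exact: (MC_bias W_cdv RM Pae psiE).
have IF_tail : tail_bias (@psi_IF R d W) maxn.
  by move=> n j1 j2 s t n0 h1 h2; have [RM Pae psiE] := data s t; exact: (IF_bias W_cdv RM Pae psiE).
have [RM Pae _] := data true true.
split.
- split; first by apply: (sup_bias _ _ INT_tail) => // *; exact: (sup_bias_INT W_cdv).
  apply: (@lesssim_of_le _ _ _ _ _ (B ^+ 4 * (6 + 2 * C) + 1)) => //.
    by rewrite !(addr_ge0, mulr_ge0, exprn_ge0)// ltW.
  by move=> j n /(_ n)[h1 h2] n0; exact: (sup_var_INT W_cdv C_gt0 geom).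
- split; first by apply: (sup_bias _ _ MC_tail) => // *; exact: (sup_bias_MC W_cdv).
  apply: (@lesssim_of_le _ _ _ _ _ (2 * B ^+ 4 + 2 * stat_const B C pc)) => //.
    by apply: addr_ge0; apply: mulr_ge0 => //; exact: exprn_ge0.
  by move=> j n /(_ n)[h1 h2] n0; exact: (sup_var_MC W_cdv C_gt0 geom).
- exists (P true true); first exact: modelP.
  split; first exact: (law_bias _ _ MC_tail).
  apply: (gtrsim_of_ge cv0) => j /Kn_near; apply: filterS => n [n0 [h1 h2] _ t1 t2].
  have [v1 v2 v3] := var_low_T n _ _ n0 t1 t2.
  apply: le_trans (MC_var_ge W_cdv RM Pae n0 h1 h2 C_gt0 geom (ltW c00) S_ge1
    (A2 _ _) (Y2 _ _) v1 v2).
  by rewrite lee_fin.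
- split; first by apply: (sup_bias _ _ IF_tail) => // *; exact: (sup_bias_IF W_cdv).
  apply: (lesssim_of_le stat_ge0) => //.
  by move=> j n /(_ n)[h1 h2] n0; exact: (sup_var_IF W_cdv C_gt0 geom).
- exists (P true true); first exact: modelP.
  split; first exact: (law_bias _ _ IF_tail).
  apply: (gtrsim_of_ge cv0) => j /Kn_near; apply: filterS => n [n0 [h1 h2] _ t1 t2].
  have [v1 v2 v3] := var_low_T n _ _ n0 t1 t2.
  apply: le_trans (IF_var_ge W_cdv RM Pae n0 h1 h2 C_gt0 geom (ltW c00) S_ge1
    (A2 _ _) (Y2 _ _) v1 v2).
  by rewrite lee_fin.
Qed.
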